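(* Let $F$ be an infinite field and let $n\ge 1$. Then there exists an isomorphism $$H_\ast(\mathrm{GL}_n(F),\mathrm{GL}_{n-1}(F);\mathbb{Q})\;\cong\; H_{\ast+1}\bigl((\widetilde{A}^{(n)}_{\ast})_{\mathrm{GL}_n(F)}\bigr)\otimes\mathbb{Q}$$ in every degree, where $(\widetilde{A}^{(n)}_{\ast})_{\mathrm{GL}_n(F)}$ is the chain complex obtained from the unordered general position complex $\widetilde{A}^{(n)}_\ast$ by taking $\mathrm{GL}_n(F)$-coinvariants degreewise.
   Context: For $k\ge 1$, let $A^{(n)}_k$ be the free abelian group on the set of $k$-tuples $[X_1,\dots,X_k]$ of column vectors in $F^n$ (equivalently, $n\times k$ matrices over $F$) such that every subset of $\min(n,k)$ of the vectors is linearly independent; set $A^{(n)}_0=\mathbb{Z}$. These form a chain complex of $\mathrm{GL}_n(F)$-modules ($\mathrm{GL}_n(F)$ acts by left multiplication on tuples, trivially on $A_0^{(n)}$) with differential $\partial_k[X_1,\dots,X_k]=\sum_{j=1}^k(-1)^{j+1}[X_1,\dots,\widehat{X_j},\dots,X_k]$ (so $\partial_1[X_1]=1$). The unordered complex is $\widetilde{A}^{(n)}_k$, the quotient of $A^{(n)}_k$ by the subgroup generated by all $[X_1,\dots,X_k]-\operatorname{sgn}(\sigma)[X_{\sigma^{-1}(1)},\dots,X_{\sigma^{-1}(k)}]$ with $\sigma\in S_k$, $\operatorname{sgn}(\sigma)\in\{\pm1\}$ (i.e. the coinvariants of the sign-twisted permutation action), with the induced differential and $\mathrm{GL}_n(F)$-action.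 For a $G$-module $M$, $M_G$ denotes coinvariants. $\mathrm{GL}_{n-1}(F)\hookrightarrow\mathrm{GL}_n(F)$ is the standard block-diagonal embedding (adding a diagonal entry $1$), $\mathrm{GL}_0(F)$ is the trivial group, and $H_\ast(\mathrm{GL}_n(F),\mathrm{GL}_{n-1}(F);\mathbb{Q})$ is the relative group homology of this embedding, fitting in the usual long exact sequence. *)

(* Defs.v *)
From HB Require Import structures.
From mathcomp.multinomials Require Import freeg.
From mathcomp Require Import all_boot all_order all_algebra perm zify.
From mathcomp Require Import boolp.

Set Implicit Arguments.
Unset Strict Implicit.
Unset Printing Implicit Defensive.

Import GRing.Theory.
Local Open Scope ring_scope.
Local Open Scope quotient_scope.

Section GeneratedSubgroup.
Variables (M : zmodType) (S : M -> Prop).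

Inductive gen_sub : M -> Prop :=
| gen_sub0 : gen_sub 0
| gen_sub_in x : S x -> gen_sub x
| gen_subB x y : gen_sub x -> gen_sub y -> gen_sub (x - y).

Definition gen_pred : {pred M} := fun x => `[< gen_sub x >].

Lemma gen_predP x : reflect (gen_sub x) (x \in gen_pred).
Proof. exact: asboolP. Qed.

Lemma gen_pred_zmod_closed : zmod_closed gen_pred.
Proof.
split=> [|x y /gen_predP gx /gen_predP gy]; apply/gen_predP.
  exact: gen_sub0.
exact: gen_subB.
Qed.

HB.instance Definition _ :=
  GRing.isZmodClosed.Build M gen_pred gen_pred_zmod_closed.

(* M modulo the subgroup generated by S. *)
Definition quo : zmodType := Quotient.quot gen_pred.

Definition quo_pi (x : M) : quo := \pi_(Quotient.quot gen_pred) x.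

Lemma quo_pi_is_zmod_morphism : zmod_morphism quo_pi.
Proof. exact: raddfB. Qed.

HB.instance Definition _ :=
  GRing.isZmodMorphism.Build M quo quo_pi quo_pi_is_zmod_morphism.

Lemma quo_pi_eq x y : quo_pi x = quo_pi y <-> gen_sub (x - y).
Proof.
split=> [/eqP|/gen_predP]; rewrite /quo_pi.
  by rewrite -Quotient.idealrBE => /gen_predP.
by rewrite Quotient.idealrBE => /eqP.
Qed.

Lemma quo_pi_repr (q : quo) : quo_pi (repr (q : Quotient.quot gen_pred)) = q.
Proof. exact: reprK. Qed.

Lemma quo_piP (q : quo) : exists x, q = quo_pi x.
Proof. by exists (repr (q : Quotient.quot gen_pred)); rewrite quo_pi_repr. Qed.

End GeneratedSubgroup.

Lemma gen_sub_map (M N : zmodType) (S : M -> Prop) (T : N -> Prop)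
    (f : {additive M -> N}) :
  (forall x, S x -> gen_sub T (f x)) ->
  forall x, gen_sub S x -> gen_sub T (f x).
Proof.
move=> fST x; elim=> [|y /fST //|y z _ fy _ fz].
  by rewrite raddf0; exact: gen_sub0.
by rewrite raddfB; exact: gen_subB.
Qed.

Section QuotientMap.
Variables (M N : zmodType) (S : M -> Prop) (T : N -> Prop).
Variable f : {additive M -> N}.
Hypothesis fST : forall x, S x -> gen_sub T (f x).

Definition quo_map (q : quo S) : quo T :=
  quo_pi T (f (repr (q : Quotient.quot (gen_pred S)))).

Lemma quo_mapE x : quo_map (quo_pi S x) = quo_pi T (f x).
Proof.
apply/quo_pi_eq; rewrite -raddfB; apply: (gen_sub_map fST).
by apply/quo_pi_eq; rewrite quo_pi_repr.
Qed.

Lemma quo_map_is_zmod_morphism : zmod_morphism quo_map.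
Proof.
move=> p q; have [x ->] := quo_piP p; have [y ->] := quo_piP q.
by rewrite -raddfB !quo_mapE !raddfB.
Qed.

Definition quo_hom : {additive quo S -> quo T} :=
  HB.pack quo_map
    (GRing.isZmodMorphism.Build _ _ quo_map quo_map_is_zmod_morphism).

Lemma quo_homE x : quo_hom (quo_pi S x) = quo_pi T (f x).
Proof. exact: quo_mapE. Qed.

End QuotientMap.

(* M (x)_Z N is the free abelian group on M x N modulo biadditivity, which
   already implies that integers may be moved across. *)
Inductive tensor_rel (M N : zmodType) : {freeg (M * N)%type / int} -> Prop :=
| tensor_relDl x y b : tensor_rel (<< (x + y, b) >> - (<< (x, b) >> + << (y, b) >>))
| tensor_relDr x a b : tensor_rel (<< (x, a + b) >> - (<< (x, a) >> + << (x, b) >>)).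

Definition tensor (M N : zmodType) : zmodType := quo (@tensor_rel M N).

(* An additive map between rational vector spaces is automatically
   rat-linear, so between two such groups this is also isomorphism of rational
   vector spaces. *)
Definition zmod_isomorphic (M N : zmodType) : Prop :=
  exists f : {additive M -> N}, bijective f.

Record chainComplex := ChainComplex {
  cc_obj :> nat -> zmodType;
  cc_d : forall k, {additive cc_obj k.+1 -> cc_obj k};
  cc_dd : forall k x, cc_d k (cc_d k.+1 x) = 0
}.

Section Homology.
Variables (C : chainComplex) (k : nat).

Definition cycle_pred : {pred C k} :=
  match k return {pred C k} with
  | 0 => fun=> true
  | l.+1 => fun x => cc_d C l x == 0
  end.

Lemma cycle_pred_zmod_closed : zmod_closed cycle_pred.
Proof.
rewrite /cycle_pred; case: k => [//|l].
split=> [|x y]; rewrite !unfold_in ?raddf0 // => /eqP dx /eqP dy.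
by rewrite raddfB dx dy subr0.
Qed.

HB.instance Definition _ :=
  GRing.isZmodClosed.Build (C k) cycle_pred cycle_pred_zmod_closed.

Record cycles := Cycle { cycle_val : C k; _ : cycle_val \in cycle_pred }.

HB.instance Definition _ := [isSub for cycle_val].
HB.instance Definition _ := [Choice of cycles by <:].
HB.instance Definition _ := [SubChoice_isSubZmodule of cycles by <:].

Definition homology_nat : zmodType :=
  quo (fun z : cycles => exists y : C k.+1, cycle_val z = cc_d C k y).

End Homology.

(* Complexes are extended by zero to negative degrees; 'I_1 is the zero group. *)
Definition homology (C : chainComplex) (i : int) : zmodType :=
  match i with Posz k => homology_nat C k | Negz _ => 'I_1 end.

(* The quotient by the subgroups generated by the S k, which d preserves. *)
Section QuotientComplex.
Variables (C : chainComplex) (S : forall k, C k -> Prop).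
Hypothesis dS : forall k x, @S k.+1 x -> gen_sub (@S k) (cc_d C k x).

Definition quo_complex_d k := quo_hom (@dS k).

Lemma quo_complex_dd k x : quo_complex_d k (quo_complex_d k.+1 x) = 0.
Proof.
have [y ->] := quo_piP x.
by rewrite [quo_complex_d k.+1 _]quo_homE quo_homE cc_dd raddf0.
Qed.

Definition quo_complex : chainComplex := ChainComplex quo_complex_dd.

End QuotientComplex.

Record gComplex (G : groupType) := GComplex {
  gc_cc :> chainComplex;
  gc_act : G -> forall k, {additive gc_cc k -> gc_cc k};
  gc_act1 : forall k x, gc_act 1%g k x = x;
  gc_actM : forall g h k x, gc_act (g * h)%g k x = gc_act g k (gc_act h k x);
  gc_actd : forall g k x, gc_act g k (cc_d _ k x) = cc_d _ k (gc_act g k.+1 x)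
}.

Section QuotientGComplex.
Variables (G : groupType) (C : gComplex G) (S : forall k, C k -> Prop).
Hypothesis dS : forall k x, @S k.+1 x -> gen_sub (@S k) (cc_d C k x).
Hypothesis actS :
  forall g k x, @S k x -> gen_sub (@S k) (gc_act C g k x).

Let Q := quo_complex dS.

Definition quo_act g k : {additive Q k -> Q k} := quo_hom (@actS g k).

Lemma quo_act1 k x : quo_act 1%g k x = x.
Proof. by have [y ->] := quo_piP x; rewrite quo_homE gc_act1. Qed.

Lemma quo_actM g h k x :
  quo_act (g * h)%g k x = quo_act g k (quo_act h k x).
Proof.
have [y ->] := quo_piP x.
by rewrite quo_homE gc_actM [quo_act h k _]quo_homE quo_homE.
Qed.

Lemma quo_actd g k x :
  quo_act g k (cc_d Q k x) = cc_d Q k (quo_act g k.+1 x).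
Proof.
have [y ->] := quo_piP x.
by rewrite [cc_d Q k _]quo_homE [quo_act g k.+1 _]quo_homE !quo_homE gc_actd.
Qed.

Definition quo_gComplex : gComplex G := GComplex quo_act1 quo_actM quo_actd.

End QuotientGComplex.

Section Coinvariants.
Variables (G : groupType) (C : gComplex G).

Definition coinv_rel k (x : C k) : Prop :=
  exists (g : G) (m : C k), x = gc_act C g k m - m.

Lemma coinv_rel_d k x :
  @coinv_rel k.+1 x -> gen_sub (@coinv_rel k) (cc_d C k x).
Proof.
move=> [g [m ->]]; apply: gen_sub_in.
by exists g, (cc_d C k m); rewrite raddfB gc_actd.
Qed.

Definition coinvariants : chainComplex := quo_complex coinv_rel_d.

End Coinvariants.

Section FreeModules.
Variable R : nzRingType.

Lemma fglift_is_zmod_morphism (X : choiceType) (M : lmodType R) (f : X -> M) :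
  zmod_morphism (fglift f).
Proof. exact: lift_is_additive. Qed.

HB.instance Definition _ (X : choiceType) (M : lmodType R) (f : X -> M) :=
  GRing.isZmodMorphism.Build {freeg X / R} M (fglift f)
    (fglift_is_zmod_morphism f).

Lemma fglift_is_scalable (X : choiceType) (M : lmodType R) (f : X -> M) :
  scalable (fglift f).
Proof.
move=> c D.
have -> : fglift f D = \sum_(x <- dom D) coeff x D *: f x.
  rewrite -{1}[D]freeg_sumE raddf_sum.
  by apply: eq_bigr => x _; rewrite /= liftU.
rewrite [c *: D]/(fgscale c D) /fgscale raddf_sum scaler_sumr.
by apply: eq_bigr => x _; rewrite /= liftU scalerA.
Qed.

HB.instance Definition _ (X : choiceType) (M : lmodType R) (f : X -> M) :=
  GRing.isScalable.Build R {freeg X / R} M *:%R (fglift f)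
    (fglift_is_scalable f).

Lemma fglift1 (X : choiceType) (M : lmodType R) (f : X -> M) x :
  fglift f << x >> = f x.
Proof. by rewrite liftU scale1r. Qed.

Lemma freegZ1 (X : choiceType) (c : R) (x : X) :
  << c *g x >> = c *: << x >> :> {freeg X / R}.
Proof.
by apply/eqP/freeg_eqP=> y; rewrite coeffZ !coeffU mul1r.
Qed.

Lemma freeg_ext (X : choiceType) (M : lmodType R)
    (f g : {linear {freeg X / R} -> M}) :
  (forall x, f << x >> = g << x >>) -> f =1 g.
Proof.
move=> fg D; rewrite -[D]freeg_sumE !raddf_sum; apply: eq_bigr => x _.
by rewrite /= freegZ1 !linearZ fg.
Qed.

Definition freeg_map (X Y : choiceType) (h : X -> Y) :
    {linear {freeg X / R} -> {freeg Y / R}} :=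
  fglift (fun x => << h x >> : {freeg Y / R}).

Lemma freeg_mapE (X Y : choiceType) (h : X -> Y) x :
  freeg_map h << x >> = << h x >>.
Proof. exact: fglift1. Qed.

(* The alternating sum of the N face maps f i. *)
Definition alt_bd (X Y : choiceType) N (f : 'I_N -> X -> Y) :
    {linear {freeg X / R} -> {freeg Y / R}} :=
  fglift (fun x => \sum_(i < N) (-1) ^+ i *: << f i x >> : {freeg Y / R}).

Lemma alt_bdE (X Y : choiceType) N (f : 'I_N -> X -> Y) x :
  alt_bd f << x >> = \sum_(i < N) (-1) ^+ i *: << f i x >>.
Proof. exact: fglift1. Qed.

Lemma alt_bd_alt_bd (X Y Z : choiceType) N
    (f : 'I_N.+1 -> X -> Y) (g : 'I_N -> Y -> Z) :
  (forall (i j : 'I_N) x, (i <= j)%N ->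
     g i (f (lift ord0 j) x) = g j (f (widen_ord (leqnSn N) i) x)) ->
  forall D, alt_bd g (alt_bd f D) = 0.
Proof.
move=> fgC D.
rewrite -[D]freeg_sumE !raddf_sum big1 // => x _.
rewrite /= freegZ1 !linearZ alt_bdE.
suff /= ->: alt_bd g (\sum_(j < N.+1) (-1) ^+ j *: << f j x >>) = 0.
  by rewrite scaler0.
rewrite linear_sum /=.
under eq_bigr => j _ do rewrite linearZ alt_bdE /= scaler_sumr
  (bigID (fun i : 'I_N => (i < j)%N)) /=.
rewrite big_split /= [X in X + _]big_ord_recl [X in _ + X]big_ord_recr /=.
rewrite [X in X + _ + _]big_pred0; last by move=> i; rewrite ltn0.
rewrite [X in _ + (_ + X)]big_pred0; last first.
  by move=> i; rewrite ltn_ord.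
rewrite add0r addr0.
under [X in _ + X]eq_bigr => j _ do rewrite big_mkcond /=.
under [X in X + _]eq_bigr => j _ do rewrite big_mkcond /=.
rewrite exchange_big -big_split /= big1 // => a _.
rewrite -big_split /= big1 // => b _.
rewrite -leqNgt /bump add1n ltnS; case: leqP => // ab; last by rewrite add0r.
rewrite !scalerA fgC // -scalerDl exprS mulN1r.
by rewrite mulNr -!exprD [(b + a)%N]addnC addNr scale0r.
Qed.

Lemma alt_bd_map (X X' Y Y' : choiceType) N
    (f : 'I_N -> X -> Y) (f' : 'I_N -> X' -> Y') (h : X -> X') (h' : Y -> Y') :
  (forall i x, f' i (h x) = h' (f i x)) ->
  forall D, alt_bd f' (freeg_map h D) = freeg_map h' (alt_bd f D).
Proof.
move=> fh; suff : alt_bd f' \o freeg_map h =1 freeg_map h' \o alt_bd f by [].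
apply: freeg_ext => x; rewrite /= freeg_mapE !alt_bdE linear_sum.
by apply: eq_bigr => i _; rewrite linearZ /= freeg_mapE fh.
Qed.

End FreeModules.

Section BarComplex.
Variables (R : nzRingType) (G : groupType).

Definition bar_face k (i : 'I_k.+2) (g : {ffun 'I_k.+1 -> G}) :
    {ffun 'I_k -> G} :=
  [ffun j : 'I_k =>
     let gj := g (widen_ord (leqnSn k) j) in
     let gj1 := g (lift ord0 j) in
     if (j.+1 < i)%N then gj
     else if j.+1 == i :> nat then (gj * gj1)%g else gj1].

Lemma bar_faceC k (i j : 'I_k.+2) (g : {ffun 'I_k.+2 -> G}) : (i <= j)%N ->
  bar_face i (bar_face (lift ord0 j) g) =
  bar_face j (bar_face (widen_ord (leqnSn _) i) g).
Proof.
move=> le_ij; apply/ffunP => p; rewrite !ffunE /=.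
have -> : widen_ord (leqnSn k.+1) (lift ord0 p) =
          lift ord0 (widen_ord (leqnSn k) p) by exact: val_inj.
rewrite /bump !add1n !ltnS !eqSS.
case: (ltngtP p.+1 i) => pi; case: (ltngtP p.+1 j) => pj;
  case: (ltngtP p j) => pj'; case: (ltngtP p.+2 i) => pi' //;
  by [lia | rewrite mulgA].
Qed.

(* The inhomogeneous bar complex: in degree k the free R-module on the symbols
   [g_0 | ... | g_(k-1)], with d = \sum_(0 <= i <= k) (-1)^i d_i, where d_0 and
   d_k drop the first and last entry and d_i merges g_(i-1) g_i otherwise. Its
   homology is H_*(G; R) with trivial coefficients. *)
Definition bar_d k :=
  alt_bd R (@bar_face k) : {additive {freeg _ / R} -> {freeg _ / R}}.

Lemma bar_dd k x : bar_d k (bar_d k.+1 x) = 0.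
Proof. by apply: alt_bd_alt_bd => i j g; exact: bar_faceC. Qed.

Definition bar_complex : chainComplex :=
  @ChainComplex (fun k => {freeg {ffun 'I_k -> G} / R}) bar_d bar_dd.

End BarComplex.

Section RelativeGroupHomology.
Variables (R : nzRingType) (H G : groupType) (f : {multiplicative H -> G}).

Definition bar_map k :=
  freeg_map R (fun h : {ffun 'I_k -> H} => [ffun i => f (h i)]) :
    {additive bar_complex R H k -> bar_complex R G k}.

Lemma bar_map_d k x :
  cc_d (bar_complex R G) k (bar_map k.+1 x) =
  bar_map k (cc_d (bar_complex R H) k x).
Proof.
apply: alt_bd_map => i h; apply/ffunP => j; rewrite !ffunE /=.
by case: ifP => // _; case: ifP => //; rewrite gmulfM.
Qed.

Definition bar_image k (x : bar_complex R G k) : Prop :=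
  exists y, x = bar_map k y.

Lemma bar_image_d k x :
  @bar_image k.+1 x -> gen_sub (@bar_image k) (cc_d (bar_complex R G) k x).
Proof.
move=> [y ->]; apply: gen_sub_in.
by exists (cc_d (bar_complex R H) k y); rewrite bar_map_d.
Qed.

(* For an embedding f of H in G, bar_map is injective in every degree, so that
   C_*(G) / f(C_*(H)) computes the relative homology H_*(G, H; R) and the long
   exact sequence is that of 0 -> C_*(H) -> C_*(G) -> C_*(G) / f(C_*(H)) -> 0. *)
Definition rel_bar_complex : chainComplex := quo_complex bar_image_d.

Definition rel_group_homology (i : int) : zmodType :=
  homology rel_bar_complex i.

End RelativeGroupHomology.

Section GeneralLinearGroup.
Variables (F : fieldType) (n : nat).

Record GL := MkGL { GL_mx : 'M[F]_n; GL_unit : GL_mx \in unitmx }.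

HB.instance Definition _ := [isSub for GL_mx].
HB.instance Definition _ := [Choice of GL by <:].

Definition GL_one : GL := MkGL (unitmx1 F n).

Lemma GL_mul_unit (g h : GL) : GL_mx g *m GL_mx h \in unitmx.
Proof. by rewrite unitmx_mul !GL_unit. Qed.

Definition GL_mul (g h : GL) : GL := MkGL (GL_mul_unit g h).

Lemma GL_inv_unit (g : GL) : invmx (GL_mx g) \in unitmx.
Proof. by rewrite unitmx_inv GL_unit. Qed.

Definition GL_inv (g : GL) : GL := MkGL (GL_inv_unit g).

Lemma GL_mulA : associative GL_mul.
Proof. by move=> g h k; apply: val_inj; rewrite /= mulmxA. Qed.

Lemma GL_mul1 : left_id GL_one GL_mul.
Proof. by move=> g; apply: val_inj; rewrite /= mul1mx. Qed.

Lemma GL_mulr1 : right_id GL_one GL_mul.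
Proof. by move=> g; apply: val_inj; rewrite /= mulmx1. Qed.

Lemma GL_mulV : left_inverse GL_one GL_inv GL_mul.
Proof. by move=> g; apply: val_inj; rewrite /= mulVmx ?GL_unit. Qed.

Lemma GL_mulrV : right_inverse GL_one GL_inv GL_mul.
Proof. by move=> g; apply: val_inj; rewrite /= mulmxV ?GL_unit. Qed.

HB.instance Definition _ :=
  isGroup.Build GL GL_mulA GL_mul1 GL_mulr1 GL_mulV GL_mulrV.

End GeneralLinearGroup.

Section GLInclusion.
Variables (F : fieldType) (n : nat).

(* g |-> diag(g, 1) *)
Definition GL_incl_mx (A : 'M[F]_n) : 'M[F]_n.+1 :=
  castmx (addn1 n, addn1 n) (block_mx A 0 0 1%:M).

Lemma GL_incl_unit (g : GL F n) : GL_incl_mx (GL_mx g) \in unitmx.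
Proof.
rewrite /GL_incl_mx; case: _ / (addn1 n).
by rewrite castmx_id unitmxE det_ublock det1 mulr1 -unitmxE GL_unit.
Qed.

Definition GL_incl (g : GL F n) : GL F n.+1 := MkGL (GL_incl_unit g).

Lemma GL_incl_mulfM : {morph GL_incl : g h / (g * h)%g}.
Proof.
move=> g h; apply: val_inj => /=; rewrite /GL_incl_mx.
case: _ / (addn1 n); rewrite !castmx_id mulmx_block.
by rewrite !mulmx0 !mul0mx !addr0 add0r mulmx1.
Qed.

Lemma GL_incl_inj : injective GL_incl.
Proof.
move=> g h /(congr1 (@GL_mx _ _)) /=; rewrite /GL_incl_mx.
by case: _ / (addn1 n); rewrite !castmx_id => /eq_block_mx[/val_inj].
Qed.

HB.instance Definition _ :=
  isMultiplicative.Build (GL F n) (GL F n.+1) GL_incl GL_incl_mulfM.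

End GLInclusion.

Lemma lift_perm_onto k (s : 'S_k.+1) (j : 'I_k.+1) :
  exists t : 'S_k, s = lift_perm j (s j) t.
Proof.
pose f p := odflt p (unlift (s j) (s (lift j p))).
have fK p : lift (s j) (f p) = s (lift j p).
  rewrite /f; case: unliftP => [//|/perm_inj /eqP].
  by rewrite eq_sym (negPf (neq_lift _ _)).
have f_inj : injective f.
  move=> p q fpq; apply: (@lift_inj _ j); apply: (@perm_inj _ s).
  by rewrite -!fK fpq.
exists (perm f_inj); apply/permP => q.
case: (unliftP j q) => [p ->|->]; last by rewrite lift_perm_id.
by rewrite lift_perm_lift permE fK.
Qed.

Section GeneralPosition.
Variables (F : fieldType) (n : nat).

(* Subsets of the tuple are subsets of its index set, so that repeated columns
   count as dependent. *)
Definition gen_pos k (X : 'M[F]_(n, k)) : bool :=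
  [forall S : {set 'I_k},
     (#|S| == minn n k) ==> free [seq col j X | j <- enum S]].

Lemma gen_posP k (X : 'M[F]_(n, k)) :
  reflect (forall s : seq 'I_k, uniq s -> (size s <= minn n k)%N ->
             free [seq col j X | j <- s])
          (gen_pos X).
Proof.
apply: (iffP forallP) => [gX s us les|gX S]; last first.
  by apply/implyP => /eqP cS; apply: gX; rewrite ?enum_uniq // -cardE cS.
pose t := take (minn n k - size s) (enum (~: [set x in s])).
have ust : uniq (s ++ t).
  rewrite cat_uniq us take_uniq ?enum_uniq // andbT.
  apply/hasPn => x /mem_take; rewrite mem_enum !inE.
  exact.
have szst : size (s ++ t) = minn n k.
  rewrite size_cat size_takel ?subnKC // -cardE cardsCs setCK card_ord.
  by rewrite leq_sub // ?geq_minr // cardsE; move/card_uniqP: us => ->.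
have := gX [set x in s ++ t].
rewrite cardsE; move/card_uniqP: (ust) => ->; rewrite szst eqxx /=.
have perm_st : perm_eq (enum [set x in s ++ t]) (s ++ t).
  by apply: uniq_perm => // [|x]; rewrite ?enum_uniq // mem_enum inE.
rewrite (perm_free (perm_map _ perm_st)) map_cat.
exact: catl_free.
Qed.

Record genPosTuple k := GenPosTuple {
  gp_mx : 'M[F]_(n, k);
  gp_gen_pos : gen_pos gp_mx
}.

HB.instance Definition _ k := [isSub for @gp_mx k].
HB.instance Definition _ k := [Choice of genPosTuple k by <:].

Lemma gen_pos_face k (i : 'I_k.+1) (X : genPosTuple k.+1) :
  gen_pos (col' i (gp_mx X)).
Proof.
apply/gen_posP => s us les.
have : free [seq col j (gp_mx X) | j <- [seq lift i p | p <- s]].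
  have/gen_posP := gp_gen_pos X; apply.
    by rewrite map_inj_uniq //; exact: lift_inj.
  rewrite size_map; apply: leq_trans les _.
  by rewrite leq_min geq_minl (leq_trans (geq_minr _ _) (leqnSn k)).
rewrite -map_comp; congr (free _); apply: eq_map => p /=.
by apply/colP => r; rewrite !mxE.
Qed.

Definition gp_face k (i : 'I_k.+1) (X : genPosTuple k.+1) : genPosTuple k :=
  GenPosTuple (gen_pos_face i X).

Lemma gp_faceC k (i j : 'I_k.+1) (X : genPosTuple k.+2) : (i <= j)%N ->
  gp_face i (gp_face (lift ord0 j) X) =
  gp_face j (gp_face (widen_ord (leqnSn _) i) X).
Proof.
move=> le_ij; apply/val_inj/matrixP => r p; rewrite /= !mxE; congr (gp_mx X r _).
by apply: val_inj; rewrite /= /bump; lia.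
Qed.

Lemma gen_pos_perm k (s : 'S_k) (X : genPosTuple k) :
  gen_pos (col_perm s (gp_mx X)).
Proof.
apply/gen_posP => t ut let_.
have : free [seq col j (gp_mx X) | j <- [seq s p | p <- t]].
  have/gen_posP := gp_gen_pos X; apply; last by rewrite size_map.
  by rewrite map_inj_uniq //; exact: perm_inj.
rewrite -map_comp; congr (free _); apply: eq_map => p /=.
by apply/colP => r; rewrite !mxE.
Qed.

(* Column j of gp_perm s X is column s j of X, so that gp_perm s^-1 X is the
   tuple [X_(s^-1 1), ..., X_(s^-1 k)]. *)
Definition gp_perm k (s : 'S_k) (X : genPosTuple k) : genPosTuple k :=
  GenPosTuple (gen_pos_perm s X).

Lemma gen_pos_mul k (g : GL F n) (X : genPosTuple k) :
  gen_pos (GL_mx g *m gp_mx X).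
Proof.
apply/gen_posP => s us les.
have := elimT (gen_posP _) (gp_gen_pos X) s us les.
rewrite -[[seq _ | _ <- s]](in_tupleE (map _ s)) => /freeP free_sX.
rewrite -[[seq _ | _ <- s]](in_tupleE (map _ s)); apply/freeP.
rewrite /= !size_map => c.
have -> : \sum_(i < size s) c i *: [seq col j (GL_mx g *m gp_mx X) | j <- s]`_i =
  GL_mx g *m \sum_(i < size s) c i *: [seq col j (gp_mx X) | j <- s]`_i.
  rewrite mulmx_sumr; apply: eq_bigr => i _; rewrite -scalemxAr.
  congr (_ *: _); case: s i {us les free_sX c} => [[]//|x0 s] i.
  by rewrite !(nth_map x0) // colE -mulmxA -colE.
move=> /(congr1 (mulmx (invmx (GL_mx g)))); rewrite mulKmx ?GL_unit // mulmx0.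
move: free_sX; rewrite /= size_map; exact.
Qed.

Definition gp_mul k (g : GL F n) (X : genPosTuple k) : genPosTuple k :=
  GenPosTuple (gen_pos_mul g X).

Definition gp_d k :=
  alt_bd int (@gp_face k) : {additive {freeg _ / int} -> {freeg _ / int}}.

Lemma gp_dd k x : gp_d k (gp_d k.+1 x) = 0.
Proof. by apply: alt_bd_alt_bd => i j X; exact: gp_faceC. Qed.

Definition gp_complex : chainComplex :=
  @ChainComplex (fun k => {freeg (genPosTuple k) / int}) gp_d gp_dd.

Definition gp_act (g : GL F n) k :=
  freeg_map int (@gp_mul k g) : {additive gp_complex k -> gp_complex k}.

Lemma gp_act1 k x : gp_act 1%g k x = x.
Proof.
suff : gp_act 1%g k =1 idfun by [].
apply: freeg_ext => X; rewrite freeg_mapE; congr << _ >>.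
by apply: val_inj; rewrite /= mul1mx.
Qed.

Lemma gp_actM g h k x : gp_act (g * h)%g k x = gp_act g k (gp_act h k x).
Proof.
suff : gp_act (g * h)%g k =1 gp_act g k \o gp_act h k by [].
apply: freeg_ext => X; rewrite /= !freeg_mapE; congr << _ >>.
by apply: val_inj; rewrite /= mulmxA.
Qed.

Lemma gp_actd g k x :
  gp_act g k (cc_d gp_complex k x) = cc_d gp_complex k (gp_act g k.+1 x).
Proof.
apply/esym; apply: alt_bd_map => i X; apply: val_inj => /=.
by apply/matrixP => r c; rewrite !mxE; apply: eq_bigr => l _; rewrite !mxE.
Qed.

(* In degree 0 the only tuple is the empty one, so that A_0 is Z with the
   trivial action, and d_1 maps every [X_1] to 1. *)
Definition gp_gComplex : gComplex (GL F n) :=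
  @GComplex _ gp_complex gp_act gp_act1 gp_actM gp_actd.

Definition sign_rel k (x : gp_gComplex k) : Prop :=
  exists (X : genPosTuple k) (s : 'S_k),
    x = << X >> - (-1) ^+ s *: << gp_perm s^-1 X >>.

Lemma sign_rel_act g k x :
  @sign_rel k x -> gen_sub (@sign_rel k) (gc_act gp_gComplex g k x).
Proof.
move=> [X [s ->]]; apply: gen_sub_in; exists (gp_mul g X), s.
rewrite -[LHS]/(freeg_map int (gp_mul g) (_ - _ *: << _ >>)).
rewrite linearB linearZ !freeg_mapE.
congr (_ - _ *: << _ >>); apply: val_inj => /=.
by apply/matrixP => r c; rewrite !mxE; apply: eq_bigr => l _; rewrite !mxE.
Qed.

Lemma sign_rel_d k x :
  @sign_rel k.+1 x -> gen_sub (@sign_rel k) (cc_d gp_gComplex k x).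
Proof.
move=> [X [s ->]].
rewrite -[cc_d _ _ _]/(alt_bd int (@gp_face k) (_ - _ *: << _ >>)).
rewrite linearB linearZ !alt_bdE (reindex_inj (@perm_inj _ s^-1)) /=.
rewrite scaler_sumr -sumrB; apply/gen_predP/rpred_sum => j _.
have [t def_t] := lift_perm_onto s^-1 j.
have -> : gp_face j (gp_perm s^-1 X) = gp_perm t (gp_face (s^-1 j)%g X).
  apply/val_inj/matrixP => r c; rewrite /= !mxE; congr (gp_mx X r _).
  by rewrite {1}def_t lift_perm_lift.
have sgn_s : (-1) ^+ s * (-1) ^+ j = (-1) ^+ (s^-1 j)%g * (-1) ^+ t :> int.
  rewrite -odd_permV [X in (-1) ^+ (X : 'S__)]def_t odd_lift_perm.
  by rewrite !signr_addb !signr_odd mulrC !mulrA -expr2 sqrr_sign mul1r.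
rewrite scalerA sgn_s -scalerA -scalerBr -signr_odd scaler_sign.
suff gY : << gp_face (s^-1 j)%g X >> -
    (-1) ^+ t *: << gp_perm t (gp_face (s^-1 j)%g X) >> \in gen_pred (@sign_rel k).
  by case: odd; rewrite ?rpredN.
apply/gen_predP/gen_sub_in; exists (gp_face (s^-1 j)%g X), t^-1%g.
by rewrite odd_permV invgK.
Qed.

Definition unordered_gp_gComplex : gComplex (GL F n) :=
  quo_gComplex sign_rel_d sign_rel_act.

End GeneralPosition.

(* Main.v *)
Require Import Defs.
From HB Require Import structures.
From mathcomp.multinomials Require Import freeg.
From mathcomp Require Import all_boot all_order all_algebra all_fingroup zify ring.
From mathcomp Require Import boolp classical_sets cardinality.

Set Implicit Arguments.
Unset Strict Implicit.
Unset Printing Implicit Defensive.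

Import GRing.Theory.
Local Open Scope ring_scope.

(** Let N = n + 1 and G = GL_N(F), and work over the rational numbers.  Let
E(k, p) be spanned by the pairs of a word of p elements of G and a k-tuple of
vectors in general position, modulo the diagonal action of G and the
sign-twisted permutations of the tuple.  Its two differentials delete a letter
of the word (wd) or a vector of the tuple (dh).  For k <= 1 one also divides by
the words in GL_n(F), paired with the last basis vector if k = 1 and with the
empty tuple if k = 0.

Words of length p are bar symbols of degree p - 1.  So column k = 0 computes the
homology of G relative to GL_n(F), with a shift by one (rel_bar_corr), while row
p = 0 is the rational complex of coinvariants, from which the degrees k <= 1
have been removed; this does not change its homology, because there the complex
of coinvariants is the identity of the integers followed by the zero map.  The
theorem is an instance of the balancing of a bicomplex: if the rows p >= 1 and
the columns k >= 1 are exact, then column 0 and row 0 have the same homology.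
The tensor product with the rational numbers is exact, so that rational
coefficients may be introduced after taking homology (high_corr).

The rows p >= 1 are exact (row_exact) because G permutes nonempty words freely,
which reduces the question to the complex of tuples itself; there a cycle is
contracted by prepending a vector in general position with respect to the
finitely many tuples that occur in it, and such a vector exists because F is
infinite.

The columns are treated according to the size of k.  If k >= N, then G acts
freely on tuples and the column is contractible (long_column).  If 2 <= k <= N,
the stabilizer of a tuple is an affine group, whose homology is that of its
linear part GL_(N-k)(F); the linear part commutes with the swap of two vectors
of the tuple, so the swap acts trivially on homology, whereas the sign relations
make it act by -1 (short_column).  If k = 1, the stabilizer of a vector has the
homology of GL_n(F), and this is what the column divides out
(pointed_column).

What remains is the fact on affine groups, affine_collapse: over an infinite
field, the translation part does not contribute to homology.  Let phi_c be the
endomorphism that multiplies translations by the scalar c.  For c <> 0 it is an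
inner automorphism and acts trivially on homology.  In degree m, phi_c is
moreover a polynomial function of c of degree at most m: its difference of order
m + 1 for increments c_0, ..., c_m vanishes (unmask_cycle).  If all nonempty
partial sums of the c_i are nonzero, then all terms of the difference at 0 are
identities except phi_0, and it follows that phi_0 acts as the identity too.
*)

(** * Free modules and generated subgroups *)

Section FreeModuleInduction.
Variables (R : nzRingType) (X : choiceType).

Lemma freeg_ind (P : {freeg X / R} -> Prop) :
  P 0 -> (forall c x u, P u -> P (c *: << x >> + u)) -> forall u, P u.
Proof.
move=> P0 PD u; rewrite -[u]freeg_sumE; elim: (freeg.dom u) => [|x s IHs].
  by rewrite big_nil.
by rewrite big_cons freegZ1; apply: PD.
Qed.

Lemma alt_bd_sum (Y : choiceType) N (f : 'I_N -> X -> Y) (u : {freeg X / R}) :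
  alt_bd R f u = \sum_(i < N) (-1) ^+ i *: freeg_map R (f i) u.
Proof.
elim/freeg_ind: u => [|c x u IHu].
  by rewrite raddf0 big1 // => i _; rewrite raddf0 scaler0.
rewrite linearD linearZ /= IHu alt_bdE scaler_sumr -big_split /=.
apply: eq_bigr => i _; rewrite linearD linearZ /= freeg_mapE scalerDr.
by congr (_ + _); rewrite !scalerA (commr_sign c i).
Qed.

Lemma freeg_map_comp (Y Z : choiceType) (f : X -> Y) (g : Y -> Z) u :
  freeg_map R g (freeg_map R f u) = freeg_map R (g \o f) u.
Proof.
suff : freeg_map R g \o freeg_map R f =1 freeg_map R (g \o f) by move=> /(_ u).
by apply: freeg_ext => x; rewrite /= !freeg_mapE.
Qed.

Lemma eq_freeg_map (Y : choiceType) (f g : X -> Y) :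
  f =1 g -> freeg_map R f =1 freeg_map R g.
Proof. by move=> fg; apply: freeg_ext => x; rewrite !freeg_mapE fg. Qed.

Lemma freeg_map_id (u : {freeg X / R}) : freeg_map R id u = u.
Proof.
suff : freeg_map R (@id X) =1 idfun by move=> /(_ u).
by apply: freeg_ext => x; rewrite freeg_mapE.
Qed.

End FreeModuleInduction.

Lemma freegP (R : nzRingType) (X : choiceType) (u v : {freeg X / R}) :
  (forall x, coeff x u = coeff x v) -> u = v.
Proof. by move=> uv; apply/eqP/freeg_eqP. Qed.

Lemma freeg_ext_dom (R : nzRingType) (X : choiceType) (M : lmodType R)
    (f g : {linear {freeg X / R} -> M}) z :
  (forall x, x \in freeg.dom z -> f << x >> = g << x >>) -> f z = g z.
Proof.
move=> fg; rewrite -[z]freeg_sumE !raddf_sum; apply: eq_big_seq => x /fg fgx.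
by rewrite /= freegZ1 !linearZ /= fgx.
Qed.

Lemma subrACA (M : zmodType) (a b c d : M) :
  a - b - (c - d) = a - c - (b - d).
Proof. by rewrite !opprB !addrA (ACl (1*4*3*2)). Qed.

Section GeneratedSubgroupTheory.
Variables (M : zmodType) (S : M -> Prop).

Lemma gen_subN x : gen_sub S x -> gen_sub S (- x).
Proof. by move=> Sx; rewrite -sub0r; apply: gen_subB => //; apply: gen_sub0. Qed.

Lemma gen_subD x y : gen_sub S x -> gen_sub S y -> gen_sub S (x + y).
Proof. by move=> Sx Sy; rewrite -[y]opprK; apply/gen_subB/gen_subN. Qed.

Lemma gen_sub_sum (I : Type) (r : seq I) (P : pred I) (f : I -> M) :
  (forall i, P i -> gen_sub S (f i)) -> gen_sub S (\sum_(i <- r | P i) f i).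
Proof. by apply: big_ind => [|x y]; [apply: gen_sub0 | apply: gen_subD]. Qed.

Lemma gen_subC x y : gen_sub S (x - y) -> gen_sub S (y - x).
Proof. by move/gen_subN; rewrite opprB. Qed.

Lemma gen_sub_trans y x z :
  gen_sub S (x - y) -> gen_sub S (y - z) -> gen_sub S (x - z).
Proof. by move=> xy yz; rewrite -(subrKA y x (- z)) ; apply: gen_subD. Qed.

Lemma gen_subW (T : M -> Prop) x :
  (forall y, S y -> gen_sub T y) -> gen_sub S x -> gen_sub T x.
Proof.
move=> ST; elim=> [|y /ST //|y z _ Ty _ Tz]; first exact: gen_sub0.
exact: gen_subB.
Qed.

End GeneratedSubgroupTheory.

Lemma gen_subZ (R : nzRingType) (M : lmodType R) (S : M -> Prop) c x :
  (forall y, S y -> S (c *: y)) -> gen_sub S x -> gen_sub S (c *: x).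
Proof.
move=> SZ; apply: (@gen_sub_map _ _ S S ( *:%R c)) => y Sy.
exact/gen_sub_in/SZ.
Qed.

Lemma gen_subK (A : zmodType) (Q : A -> Prop) x y :
  gen_sub Q (x - y) -> gen_sub Q x -> gen_sub Q y.
Proof. by move=> xy Qx; rewrite -[y](subKr x); apply: gen_subB. Qed.

Lemma gen_subMz (A : zmodType) (S : A -> Prop) x (z : int) :
  gen_sub S x -> gen_sub S (x *~ z).
Proof.
move=> Sx; have Sn n : gen_sub S (x *+ n).
  elim: n => [|n IHn]; first by rewrite mulr0n; apply: gen_sub0.
  by rewrite mulrS; apply: gen_subD.
case: z => n; first exact: Sn.
by rewrite NegzE mulrNz; apply/gen_subN/(Sn n.+1).
Qed.

Lemma gen_sub_split (M : zmodType) (A B : M -> Prop) z :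
  gen_sub (fun x => A x \/ B x) z ->
  exists a b, [/\ gen_sub A a, gen_sub B b & z = a + b].
Proof.
elim=> [|x [Ax|Bx]|x y _ [a [b [Aa Bb ->]]] _ [a' [b' [Aa' Bb' ->]]]].
- by exists 0, 0; split; rewrite ?addr0 //; apply: gen_sub0.
- by exists x, 0; split; rewrite ?addr0 //; [apply: gen_sub_in | apply: gen_sub0].
- by exists 0, x; split; rewrite ?add0r //; [apply: gen_sub0 | apply: gen_sub_in].
exists (a - a'), (b - b'); split; try exact: gen_subB.
by rewrite opprD addrACA.
Qed.

(** * Chains of words *)

Section WordComplex.

Variables (X Y : choiceType).
Notation W := {freeg (seq X * Y) / rat}.

Definition del (i : nat) (w : seq X) : seq X := take i w ++ drop i.+1 w.

(** The word x_0 ... x_(p-1) is the simplex with these vertices, so that a word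
complex is augmented and contractible; the bar complex of a group is the word
complex of the group modulo left translation, with a shift by one of the
degree.  The second component y of a generator is a coefficient. *)
Definition wd0 (w : seq X) (y : Y) : W :=
  \sum_(i < size w) (-1) ^+ i *: << (del i w, y) >>.

Definition wd : W -> W := fglift (fun wy => wd0 wy.1 wy.2).

HB.instance Definition _ :=
  GRing.Linear.copy wd (fglift (fun wy => wd0 wy.1 wy.2)).

Lemma wdE w y : wd << (w, y) >> = wd0 w y.
Proof. exact: fglift1. Qed.

Definition wcons (s : Y -> X) : W -> W :=
  freeg_map rat (fun wy => (s wy.2 :: wy.1, wy.2)).

HB.instance Definition _ s := GRing.Linear.copy (wcons s)
  (freeg_map rat (fun wy => (s wy.2 :: wy.1, wy.2))).

Lemma wconsE s w y : wcons s << (w, y) >> = << (s y :: w, y) >>.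
Proof. exact: freeg_mapE. Qed.

(** This recursion makes the first letter an apex and drives all the
homotopies below: a map defined by recursion on words is compared with the
differential through it, without indices. *)
Lemma wd0_cons s w y : wd0 (s y :: w) y = << (w, y) >> - wcons s (wd0 w y).
Proof.
rewrite /wd0 big_ord_recl /= /del /= drop0 scale1r; congr (_ + _).
rewrite linear_sum -sumrN; apply: eq_bigr => i _.
by rewrite linearZ /= wconsE exprS mulN1r scaleNr.
Qed.

Lemma wd_cons s u : wd (wcons s u) = u - wcons s (wd u).
Proof.
suff : wd \o wcons s =1 idfun \- (wcons s \o wd) by move=> /(_ u).
by apply: freeg_ext => -[w y]; rewrite /= wconsE !wdE (wd0_cons s).
Qed.

Lemma wd_nil y : wd << ([::], y) >> = 0.
Proof. by rewrite wdE /wd0 big_ord0. Qed.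

Lemma wd_wd u : wd (wd u) = 0.
Proof.
suff : wd \o wd =1 \0 by move=> /(_ u).
apply: freeg_ext => -[w y] /=.
elim: w => [|x w IHw]; first by rewrite wd_nil raddf0.
rewrite -[<< _ >>](wconsE (fun=> x)).
by rewrite wd_cons linearB /= wd_cons IHw raddf0 subr0 subrr.
Qed.

End WordComplex.

Section WordMaps.
Variables (X Y X' Y' : choiceType).

Definition wmap (f : Y -> X -> X') (t : Y -> Y') :
    {freeg (seq X * Y) / rat} -> {freeg (seq X' * Y') / rat} :=
  freeg_map rat (fun wy => (map (f wy.2) wy.1, t wy.2)).

HB.instance Definition _ f t := GRing.Linear.copy (wmap f t)
  (freeg_map rat (fun wy => (map (f wy.2) wy.1, t wy.2))).

Lemma wmapE f t w y : wmap f t << (w, y) >> = << (map (f y) w, t y) >>.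
Proof. exact: freeg_mapE. Qed.

Lemma wd_wmap f t u : wd (wmap f t u) = wmap f t (wd u).
Proof.
suff : @wd X' Y' \o wmap f t =1 wmap f t \o @wd X Y by move=> /(_ u).
apply: freeg_ext => -[w y] /=.
rewrite wmapE !wdE /wd0 linear_sum size_map; apply: eq_bigr => i _.
by rewrite linearZ /= wmapE /del map_cat map_take map_drop.
Qed.

Lemma wmap_wcons f t s s' u : (forall y, f y (s y) = s' (t y)) ->
  wmap f t (wcons s u) = wcons s' (wmap f t u).
Proof.
move=> fs; rewrite /wmap /wcons !freeg_map_comp.
by apply: eq_freeg_map => -[w y] /=; rewrite fs.
Qed.

End WordMaps.

Lemma wmap_comp (X Y X1 Y1 X2 Y2 : choiceType) (f : Y -> X -> X1) t
    (f' : Y1 -> X1 -> X2) (t' : Y1 -> Y2) u :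
  wmap f' t' (wmap f t u) = wmap (fun y => f' (t y) \o f y) (t' \o t) u.
Proof.
rewrite /wmap freeg_map_comp; apply: eq_freeg_map => -[w y] /=.
by rewrite -map_comp.
Qed.

Lemma eq_wmap (X Y X' Y' : choiceType) (f g : Y -> X -> X') (t r : Y -> Y') u :
  (forall y, f y =1 g y) -> t =1 r -> wmap f t u = wmap g r u.
Proof.
move=> fg tr; apply: eq_freeg_map => -[w y] /=.
by rewrite tr (eq_map (fg y)).
Qed.

Lemma wmap_id (X Y : choiceType) (u : {freeg (seq X * Y) / rat}) :
  wmap (fun=> id) id u = u.
Proof.
rewrite -[RHS]freeg_map_id; apply: eq_freeg_map => -[w y] /=.
by rewrite map_id.
Qed.

Section Prism.
Variables (X Y : choiceType) (g : X -> X).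
Notation W := {freeg (seq X * Y) / rat}.

(** The prism x_0 ... x_i (g x_i) ... (g x_(p-1)), with alternating signs. *)
Fixpoint prism0 (w : seq X) (y : Y) : W :=
  if w is x :: w' then
    << (x :: g x :: map g w', y) >> - wcons (fun=> x) (prism0 w' y)
  else 0.

Definition prism : W -> W := fglift (fun wy => prism0 wy.1 wy.2).

HB.instance Definition _ :=
  GRing.Linear.copy prism (fglift (fun wy => prism0 wy.1 wy.2)).

Lemma prismE w y : prism << (w, y) >> = prism0 w y.
Proof. exact: fglift1. Qed.

Lemma prism_cons x u :
  prism (wcons (fun=> x) u) =
  wcons (fun=> x) (wcons (fun=> g x) (wmap (fun=> g) id u)) -
  wcons (fun=> x) (prism u).
Proof.
suff : prism \o wcons (fun=> x) =1
    (wcons (fun=> x) \o (wcons (fun=> g x) \o wmap (fun=> g) id)) \-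
    (wcons (fun=> x) \o prism) by move=> /(_ u).
by apply: freeg_ext => -[w y]; rewrite /= wconsE wmapE !wconsE !prismE.
Qed.

Lemma wd_prism u : wd (prism u) + prism (wd u) = wmap (fun=> g) id u - u.
Proof.
suff : (@wd X Y \o prism) \+ (prism \o @wd X Y) =1
    wmap (fun=> g) id \- idfun by move=> /(_ u).
apply: freeg_ext => -[w y] /=.
elim: w => [|x w IHw]; first by rewrite wd_nil prismE wmapE !raddf0 addr0 subrr.
rewrite -[<< _ >>](wconsE (fun=> x)); move: << _ >> IHw => v IHv.
rewrite prism_cons wd_cons !linearB /= prism_cons !wd_cons wd_wmap.
rewrite (@wmap_wcons _ _ _ _ (fun=> g) id _ (fun=> g x)) //.
have /(canRL (addrK _)) -> := IHv.
rewrite !linearB /= !opprK !addrA (ACl (1*6*2*5*3*9*4*8*7*10)) /=.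
by rewrite !(subrK, addrK).
Qed.

End Prism.

Section LetterChains.
Variables (X Y : choiceType) (H : X -> Prop) (y : Y).

Definition letter_rel (z : {freeg (seq X * Y) / rat}) : Prop :=
  exists (c : rat) (w : seq X),
    (forall g, g \in w -> H g) /\ z = c *: << (w, y) >>.

Lemma wd_letter_rel z : gen_sub letter_rel z -> gen_sub letter_rel (wd z).
Proof.
apply: gen_sub_map => _ [c [w [wH ->]]] /=; rewrite linearZ /= wdE scaler_sumr.
apply: gen_sub_sum => i _; rewrite scalerA.
apply: gen_sub_in; exists (c * (-1) ^+ i), (del i w); split=> // g.
by rewrite /del mem_cat => /orP[/mem_take|/mem_drop]; apply: wH.
Qed.

End LetterChains.

(** * Boundaries modulo a diagonal action *)

Section Boundaries.
Variables (X Y : choiceType).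
Notation W := {freeg (seq X * Y) / rat}.

(** In the quotient by the subgroup generated by S, these are the
boundaries. *)
Definition bdry (S : W -> Prop) : W -> Prop :=
  gen_sub (fun z => S z \/ exists y, z = wd y).

Lemma bdry_ex S z : bdry S z -> exists y, gen_sub S (z - wd y).
Proof.
elim=> [|x [Sx|[y ->]]|x y _ [x' Sx] _ [y' Sy]].
- by exists 0; rewrite raddf0 subr0; apply: gen_sub0.
- by exists 0; rewrite raddf0 subr0; apply: gen_sub_in.
- by exists y; rewrite subrr; apply: gen_sub0.
exists (x' - y'); rewrite linearB /= opprB addrA (ACl (1*4*(3*2))) /=.
by rewrite -[_ - y]opprB; apply: gen_subB.
Qed.

Lemma bdry_sub S z : gen_sub S z -> bdry S z.
Proof. by apply: gen_subW => x Sx; apply: gen_sub_in; left. Qed.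

Lemma bdry_wd S z : bdry S (wd z).
Proof. by apply: gen_sub_in; right; exists z. Qed.

End Boundaries.

Section BoundaryMap.
Variables (X Y X' Y' : choiceType).
Variables (S : {freeg (seq X * Y) / rat} -> Prop).
Variables (S' : {freeg (seq X' * Y') / rat} -> Prop).
Variable f : {additive {freeg (seq X * Y) / rat} -> {freeg (seq X' * Y') / rat}}.

Lemma bdry_map : (forall z, wd (f z) = f (wd z)) ->
  (forall z, S z -> gen_sub S' (f z)) -> forall z, bdry S z -> bdry S' (f z).
Proof.
move=> fd fS; apply: gen_sub_map => z [/fS|[y ->]]; first exact: bdry_sub.
by rewrite -fd; apply: bdry_wd.
Qed.

End BoundaryMap.

Section DiagonalAction.
Variables (X Y : choiceType) (P : Type).
Variables (a : P -> X -> X) (b : P -> Y -> Y).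
Notation W := {freeg (seq X * Y) / rat}.

(** Modulo these relations, chains on the letters P paired with Y compute the
homology of P with coefficients in the permutation module of Y.  Only the
translation maps of P on X and Y enter, so P need not carry a group
structure. *)
Definition diag_rel (z : W) : Prop :=
  exists p u, z = u - wmap (fun=> a p) (b p) u.

Lemma diag_relE p u : gen_sub diag_rel (u - wmap (fun=> a p) (b p) u).
Proof. by apply: gen_sub_in; exists p, u. Qed.

Lemma wd_diag_rel z : gen_sub diag_rel z -> gen_sub diag_rel (wd z).
Proof.
apply: gen_sub_map => _ [p [u ->]].
by rewrite raddfB /= wd_wmap; apply: diag_relE.
Qed.

End DiagonalAction.

Section DiagonalMap.
Variables (X Y X' Y' : choiceType) (P P' : Type).
Variables (a : P -> X -> X) (b : P -> Y -> Y).
Variables (a' : P' -> X' -> X') (b' : P' -> Y' -> Y').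

Lemma diag_rel_map (f : {additive _ -> _}) (r : P -> P') :
  (forall p u, f (wmap (fun=> a p) (b p) u) =
               wmap (fun=> a' (r p)) (b' (r p)) (f u)) ->
  forall z, gen_sub (diag_rel a b) z -> gen_sub (diag_rel a' b') (f z).
Proof.
move=> fr; apply: gen_sub_map => _ [p [u ->]].
by rewrite raddfB fr; apply: diag_relE.
Qed.

End DiagonalMap.

Lemma prism0_map (X X' Y Y' : choiceType) (g : X -> X) (g' : X' -> X') f
    (t : Y -> Y') w y : (forall x, g' (f x) = f (g x)) ->
  prism0 g' (map f w) (t y) = wmap (fun=> f) t (prism0 g w y).
Proof.
move=> fg; elim: w => [|x w IHw] /=; first by rewrite raddf0.
rewrite linearB /= wmapE (@wmap_wcons _ _ _ _ (fun=> f) t _ (fun=> f x)) //=.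
rewrite -IHw fg; congr (<< (_ :: _ :: _, _) >> - _).
by rewrite -!map_comp; apply: eq_map.
Qed.

Lemma prism_map (X X' Y Y' : choiceType) (g : X -> X) (g' : X' -> X') f
    (t : Y -> Y') u : (forall x, g' (f x) = f (g x)) ->
  prism g' (wmap (fun=> f) t u) = wmap (fun=> f) t (prism g u).
Proof.
move=> fg.
suff : prism g' \o wmap (fun=> f) t =1 wmap (fun=> f) t \o prism g.
  by move=> /(_ u).
by apply: freeg_ext => -[w y]; rewrite /= wmapE !prismE (prism0_map _ _ _ fg).
Qed.

(** Equivariant letter maps are homotopic through equivariant prisms, so they
agree on the homology of the quotient. *)
Lemma prism_bdry (X Y : choiceType) (P : Type) (a : P -> X -> X) (b : P -> Y -> Y)
    (g : X -> X) z : (forall p x, g (a p x) = a p (g x)) ->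
  gen_sub (diag_rel a b) (wd z) ->
  bdry (diag_rel a b) (wmap (fun=> g) id z - z).
Proof.
move=> ga dz; rewrite -wd_prism; apply: gen_subD; first exact: bdry_wd.
apply: bdry_sub; apply: (diag_rel_map _ (r := id)) dz => p u /=.
exact: prism_map.
Qed.

(** * Restarting a word at its first letter *)

Section Restart.
Variables (X Y : choiceType) (u : X -> X -> X).
Notation W := {freeg (seq X * Y) / rat}.

Definition restart0 (w : seq X) (y : Y) : W :=
  << (if w is x :: _ then map (u x) w else [::], y) >>.

Definition restart_htpy0 (w : seq X) (y : Y) : W :=
  if w is x :: _ then prism0 (u x) w y else 0.

(** Let u a be a family of letter maps indexed by letters.  Letting a be the
first letter of each word gives the map restart, and the prisms from the
identity to u a give a homotopy restart_htpy; the latter is not a homotopy from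
the identity to restart, because deleting the first letter changes a.
The resulting defect consumes the first letter of the word and inserts a step
from x to u a x at some later place. *)
Definition restart_err0 (w : seq X) (y : Y) : W :=
  if w is x :: w' then prism0 (u x) w' y - restart_htpy0 w' y else 0.

Definition restart : W -> W := fglift (fun wy => restart0 wy.1 wy.2).
Definition restart_htpy : W -> W :=
  fglift (fun wy => restart_htpy0 wy.1 wy.2).
Definition restart_err : W -> W := fglift (fun wy => restart_err0 wy.1 wy.2).

HB.instance Definition _ :=
  GRing.Linear.copy restart (fglift (fun wy => restart0 wy.1 wy.2)).
HB.instance Definition _ :=
  GRing.Linear.copy restart_htpy (fglift (fun wy => restart_htpy0 wy.1 wy.2)).
HB.instance Definition _ :=
  GRing.Linear.copy restart_err (fglift (fun wy => restart_err0 wy.1 wy.2)).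

Lemma restartE w y : restart << (w, y) >> = restart0 w y.
Proof. exact: fglift1. Qed.
Lemma restart_htpyE w y : restart_htpy << (w, y) >> = restart_htpy0 w y.
Proof. exact: fglift1. Qed.
Lemma restart_errE w y : restart_err << (w, y) >> = restart_err0 w y.
Proof. exact: fglift1. Qed.

Lemma restart_htpy_cons x v :
  restart_htpy (wcons (fun=> x) v) = prism (u x) (wcons (fun=> x) v).
Proof.
suff : restart_htpy \o wcons (fun=> x) =1 prism (u x) \o wcons (fun=> x).
  by move=> /(_ v).
by apply: freeg_ext => -[w y]; rewrite /= wconsE restart_htpyE prismE.
Qed.

Lemma wd_restart_htpy v :
  wd (restart_htpy v) + restart_htpy (wd v) = restart v - v - restart_err v.
Proof.
suff : (@wd X Y \o restart_htpy) \+ (restart_htpy \o @wd X Y) =1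
    restart \- idfun \- restart_err by move=> /(_ v).
apply: freeg_ext => -[[|x w] y] /=.
  by rewrite wd_nil restartE restart_htpyE restart_errE /= !raddf0 /restart0 subrr ?oppr0 ?subr0 ?addr0.
have -> : restart << (x :: w, y) >> = wmap (fun=> u x) id << (x :: w, y) >>.
  by rewrite restartE wmapE.
rewrite -wd_prism restart_htpyE restart_errE prismE /=.
rewrite -[<< (x :: w, y) >>](wconsE (fun=> x)) wd_cons !linearB /=.
rewrite restart_htpy_cons restart_htpyE prismE ?opprB ?opprK.
by rewrite -[RHS]addrA; congr (_ + _); rewrite addrACA subrr add0r addrC.
Qed.

Lemma restart_htpy_map f v : (forall x y, u (f x) (f y) = f (u x y)) ->
  restart_htpy (wmap (fun=> f) id v) = wmap (fun=> f) id (restart_htpy v).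
Proof.
move=> uf.
suff : restart_htpy \o wmap (fun=> f) id =1 wmap (fun=> f) id \o restart_htpy.
  by move=> /(_ v).
apply: freeg_ext => -[[|x w] y] /=; rewrite wmapE !restart_htpyE /= ?raddf0 //.
by apply: (prism0_map (@id Y) (x :: w) y); apply: uf.
Qed.

End Restart.

Section Steps.
Variables (X Y : choiceType).
Notation W := {freeg (seq X * Y) / rat}.

(** The span of the generators whose word satisfies Q. *)
Definition spanned (Q : seq X -> Prop) : W -> Prop :=
  gen_sub (fun z => exists c w y, Q w /\ z = c *: << (w, y) >>).

Lemma spanned1 (Q : seq X -> Prop) w y : Q w -> spanned Q << (w, y) >>.
Proof.
by move=> Qw; apply: gen_sub_in; exists 1, w, y; rewrite scale1r.
Qed.

Lemma spanned_lin (Q : seq X -> Prop) (S : W -> Prop) (f : {linear W -> W}) :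
  (forall c x, S x -> S (c *: x)) ->
  (forall w y, Q w -> gen_sub S (f << (w, y) >>)) ->
  forall z, spanned Q z -> gen_sub S (f z).
Proof.
move=> SZ fQ; apply: gen_sub_map => _ [c [w [y [Qw ->]]]].
by rewrite /= linearZ /=; apply: gen_subZ (SZ c) (fQ _ _ Qw).
Qed.

Variable e : rel X.

(** The number of steps of a word that change the class of its letters
modulo e. *)
Fixpoint nsteps (w : seq X) : nat :=
  if w is x :: w' then
    ((if w' is x' :: _ then ~~ e x x' else false) + nsteps w')%N
  else 0%N.

End Steps.

(** In the application e and e' compare the coordinates of two letters from
the j-th, respectively the next one, on, and u a replaces the j-th coordinate by
the one of a.  Then the inserted step from x to u a x is invisible to e', while
the step that is consumed was visible to e, since otherwise the two prisms of
the defect cancel; hence each defect lowers the number of visible steps. *)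
Section RestartSteps.
Variables (X Y : choiceType) (u : X -> X -> X) (e e' : rel X).
Hypothesis eu : forall x y, e x y -> u x =1 u y.
Hypothesis e'u : forall a x, e' x (u a x).
Hypothesis e'uu : forall a x y, e' x y -> e' (u a x) (u a y).
Hypothesis ee' : forall x y, e x y -> e' x y.
Notation W := {freeg (seq X * Y) / rat}.

Lemma nsteps_sub w : (nsteps e' w <= nsteps e w)%N.
Proof.
elim: w => //= x [|x' w] IHw //=; apply: leq_add => //.
by case: (boolP (e' x x')) => //= /negP ne; case: (boolP (e x x')) => // /ee'.
Qed.

Lemma nsteps_map a w : (nsteps e' (map (u a) w) <= nsteps e' w)%N.
Proof.
elim: w => //= x [|x' w] IHw //=; apply: leq_add => //.
by case: (boolP (e' x x')) => [/(e'uu a) -> //|_]; case: (~~ _).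
Qed.

Lemma nsteps_prism a w (y : Y) :
  spanned (fun v => (nsteps e' v <= nsteps e' w)%N /\
             forall x, (nsteps e' (x :: v) <= nsteps e' (x :: w))%N)
          (prism0 (u a) w y).
Proof.
elim: w => [|x w IHw] /=; first exact: gen_sub0.
have le1 : (nsteps e' [:: x, u a x & map (u a) w] <= nsteps e' (x :: w))%N.
  by rewrite /= e'u; apply: (nsteps_map a (x :: w)).
apply: gen_subB.
  by apply: spanned1; split=> [|x0] /=; rewrite ?leq_add2l.
apply: spanned_lin IHw => [c _ [d [v [z [Qv ->]]]]|v z [_ lev]].
  by exists (c * d), v, z; rewrite scalerA.
have := lev x => le2; rewrite /= wconsE.
by apply: spanned1; split=> [//|x0] /=; rewrite leq_add2l.
Qed.

Lemma restart_err_eq0 x x' w (y : Y) :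
  e x x' -> restart_err u << ([:: x, x' & w], y) >> = 0.
Proof.
move=> exx'; rewrite restart_errE /=; apply/eqP; rewrite subr_eq0; apply/eqP.
have eqp : prism0 (u x) w y = prism0 (u x') w y.
  elim: w => //= z w ->; rewrite (eu exx'); congr (<< (_ :: _ :: _, _) >> - _).
  by apply: eq_map; apply: (eu exx').
by rewrite eqp (eu exx') (eq_map (eu exx')).
Qed.

Lemma restart_err_small w (y : Y) :
  (size w <= 1)%N -> restart_err u << (w, y) >> = 0.
Proof. by case: w => [|x [|//]]; rewrite restart_errE //= subrr. Qed.

Lemma restart_err_steps0 w (y : Y) :
  nsteps e w = 0%N -> restart_err u << (w, y) >> = 0.
Proof.
case: w => [|x [|x' w]]; try by rewrite restart_err_small.
by rewrite /=; case: (boolP (e x x')) => // /restart_err_eq0.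
Qed.

Lemma restart_err_steps r w (y : Y) : (nsteps e w <= r.+1)%N ->
  spanned (fun v => (nsteps e' v <= r)%N) (restart_err u << (w, y) >>).
Proof.
case: w => [|x [|x' w]] lew; try by rewrite restart_err_small //; apply: gen_sub0.
have [exx'|nexx'] := boolP (e x x').
  by rewrite restart_err_eq0 //; apply: gen_sub0.
have lew' : (nsteps e' (x' :: w) <= r)%N.
  apply: leq_trans (nsteps_sub _) _; rewrite -ltnS; apply: leq_trans lew.
  by rewrite [leqRHS]/= nexx'.
have sp a : spanned (fun v => (nsteps e' v <= r)%N) (prism0 (u a) (x' :: w) y).
  apply: gen_subW (nsteps_prism a (x' :: w) y) => _ [c [v [z [[lev _] ->]]]].
  by apply: gen_sub_in; exists c, v, z; split=> //; apply: leq_trans lew'.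
by rewrite restart_errE; apply: gen_subB (sp x) (sp x').
Qed.

End RestartSteps.

(** * Homology of affine groups *)

Section AffineHomology.
Variables (F : fieldType) (k l : nat).
Notation V := 'M[F]_(k, l).
(** The affine group of translations V extended by GL_l, acting on the right
of V.  The pair (b, h) stands for the block matrix with diagonal blocks h, 1 and
lower left block b h: in these coordinates h does not interfere with the
translation part of the left factor. *)
Definition affine : choiceType := (V * GL F l)%type.
(** Sequences of translations over a common linear part: the fibre product
over GL_l of countably many copies of the affine group. *)
Definition multi_affine : choiceType := ((nat -> V) * GL F l)%type.

Definition aff_mul (p x : affine) : affine :=
  (p.1 + x.1 *m invmx (GL_mx p.2), (p.2 * x.2)%g).

Definition maff_mul (p x : multi_affine) : multi_affine :=
  (fun j => p.1 j + x.1 j *m invmx (GL_mx p.2), (p.2 * x.2)%g).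

Variable Y : choiceType.
Notation W := {freeg (seq affine * Y) / rat}.
Notation MW := {freeg (seq multi_affine * Y) / rat}.

Definition aff_rel : W -> Prop := diag_rel aff_mul (fun=> id).
Definition maff_rel : MW -> Prop := diag_rel maff_mul (fun=> id).

Definition aff_scale (c : F) (x : affine) : affine := (c *: x.1, x.2).

Lemma aff_scaleM c p x :
  aff_scale c (aff_mul p x) = aff_mul (aff_scale c p) (aff_scale c x).
Proof. by rewrite /aff_scale /aff_mul /= scalerDr scalemxAl. Qed.

Definition maff_mask (j : nat) (x : multi_affine) : multi_affine :=
  (fun i => if i == j then 0 else x.1 i, x.2).

Lemma maff_maskM j p x :
  maff_mask j (maff_mul p x) = maff_mul (maff_mask j p) (maff_mask j x).
Proof.
congr pair; apply/funext => i /=; case: eqP => // _.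
by rewrite mul0mx addr0.
Qed.

(** On coordinate j this is the translation that moves the origin to the
j-th coordinate of x0, after the j-th coordinate has been erased; so it agrees
with erasure up to a translation. *)
Definition maff_restart (j : nat) (x0 x : multi_affine) : multi_affine :=
  (fun i => if i == j then x0.1 j else x.1 i, x.2).

Lemma maff_restartM j p x y :
  maff_restart j (maff_mul p x) (maff_mul p y) =
  maff_mul p (maff_restart j x y).
Proof. by congr pair; apply/funext => i /=; case: eqP => // ->. Qed.

Definition agree_from (j : nat) : rel multi_affine :=
  fun x y => `[< forall i, (j <= i)%N -> x.1 i = y.1 i >].

Lemma restart_mask j (z : MW) :
  gen_sub maff_rel (restart (maff_restart j) z -
                    wmap (fun=> maff_mask j) id z).
Proof.
pose f : {linear MW -> MW} :=
  restart (maff_restart j) \- wmap (fun=> maff_mask j) id.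
rewrite -[_ - _]/(f z).
elim/freeg_ind: z => [|c [w y] z IHz]; first by rewrite linear0; apply: gen_sub0.
rewrite linearD linearZ; apply: gen_subD => //.
apply: gen_subZ => [_ [p [u ->]]|].
  by exists p, (c *: u); rewrite linearZ scalerBr.
rewrite /f /= restartE wmapE /restart0.
case: w => [|x w]; first by rewrite subrr; apply: gen_sub0.
(* The translation of coordinate j by that of the first letter. *)
pose p : multi_affine := (fun i => if i == j then x.1 j else 0, 1%g).
suff -> : map (maff_restart j x) (x :: w) =
          map (maff_mul p) (map (maff_mask j) (x :: w)).
  rewrite -opprB; apply/gen_subN; rewrite -[<< (map _ (map _ _), _) >>](wmapE (fun=> maff_mul p) id).
  exact: diag_relE.
rewrite -map_comp; apply: eq_map => {}w; congr pair; last by rewrite mul1g.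
apply/funext => i /=.
by rewrite invmx1 mulmx1; case: eqP => _; rewrite ?addr0 ?add0r.
Qed.

Lemma maff_mask_rel j z :
  gen_sub maff_rel z -> gen_sub maff_rel (wmap (fun=> maff_mask j) id z).
Proof.
apply: (diag_rel_map _ (r := maff_mask j)) => p u /=; rewrite !wmap_comp.
by apply: eq_wmap => // _ x; apply: maff_maskM.
Qed.

Lemma maff_mask_bdry j z :
  bdry maff_rel z -> bdry maff_rel (wmap (fun=> maff_mask j) id z).
Proof.
apply: bdry_map => [u|u Su]; first exact: wd_wmap.
exact/maff_mask_rel/gen_sub_in.
Qed.

Lemma restart_htpy_rel j z :
  gen_sub maff_rel z -> gen_sub maff_rel (restart_htpy (maff_restart j) z).
Proof.
apply: (diag_rel_map _ (r := id)) => p u /=; apply: restart_htpy_map => x y.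
exact: maff_restartM.
Qed.

(** Restarting coordinate j is, modulo translations, its erasure, so that the
defect of the restart is the failure of erasure to act trivially on
homology. *)
Lemma mask_htpy j z : gen_sub maff_rel (wd z) ->
  bdry maff_rel (z - wmap (fun=> maff_mask j) id z +
                restart_err (maff_restart j) z).
Proof.
move=> dz.
have : bdry maff_rel (- (restart (maff_restart j) z - z -
                        restart_err (maff_restart j) z)).
  apply: gen_subN; rewrite -wd_restart_htpy; apply: gen_subD (bdry_wd _ _) _.
  exact/bdry_sub/restart_htpy_rel.
move/(gen_subD (bdry_sub (restart_mask j z))); congr (bdry _ _).
by rewrite !opprB !addrA (ACl (4*2*3*1*5)) /= addrK.
Qed.

Lemma restart_err_cycle j z : gen_sub maff_rel (wd z) ->
  gen_sub maff_rel (wd (restart_err (maff_restart j) z)).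
Proof.
set u := maff_restart j; move=> dz.
have E t : restart_err u t = restart u t - t -
    (wd (restart_htpy u t) + restart_htpy u (wd t)).
  by rewrite wd_restart_htpy opprB addrC subrK.
rewrite E 2!linearB linearD /= wd_wd add0r.
have Hd := restart_htpy_rel j dz.
apply: gen_subB; last exact: wd_diag_rel.
apply: gen_subB => //.
have := wd_diag_rel (restart_mask j z).
rewrite linearB /= wd_wmap => /gen_subD/(_ (maff_mask_rel j dz)).
by rewrite subrK.
Qed.

(** The product of the operators 1 - erasure of coordinate i, for i from j to
j + r. *)
Fixpoint unmask (j r : nat) (z : MW) : MW :=
  let z' := z - wmap (fun=> maff_mask j) id z in
  if r is r'.+1 then unmask j.+1 r' z' else z'.

Lemma unmaskB j r z t : unmask j r (z - t) = unmask j r z - unmask j r t.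
Proof.
have E i x y : (x - y) - wmap (fun=> maff_mask i) id (x - y) =
    (x - wmap (fun=> maff_mask i) id x) - (y - wmap (fun=> maff_mask i) id y).
  by rewrite linearB /= !opprB addrA (ACl (1*4*(3*2))).
by elim: r j z t => [|r IHr] j z t /=; rewrite E ?IHr.
Qed.

Lemma unmask_bdry j r z : bdry maff_rel z -> bdry maff_rel (unmask j r z).
Proof.
elim: r j z => [|r IHr] j z zN /=; last apply: IHr;
  by apply: gen_subB => //; apply: maff_mask_bdry.
Qed.

(** Each factor is homotopic to a defect, and every defect uses up one of the
r steps of the words.  This says that the homology in degree r of the affine
group is a polynomial functor of degree at most r in the translations. *)
Lemma unmask_cycle j r z : gen_sub maff_rel (wd z) ->
  spanned (fun w => (nsteps (agree_from j) w <= r)%N) z ->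
  bdry maff_rel (unmask j r z).
Proof.
have eu i x y : agree_from i x y -> maff_restart i x =1 maff_restart i y.
  by move=> /asboolP e t; rewrite /maff_restart e.
have e'u i a x : agree_from i.+1 x (maff_restart i a x).
  by apply/asboolP => t it /=; case: eqP => // e; rewrite e ltnn in it.
have e'uu i a x y : agree_from i.+1 x y ->
    agree_from i.+1 (maff_restart i a x) (maff_restart i a y).
  by move=> /asboolP e; apply/asboolP => t it /=; rewrite e.
have ee' i x y : agree_from i x y -> agree_from i.+1 x y.
  by move=> /asboolP e; apply/asboolP => t it; apply/e/ltnW.
elim: r j z => [|r IHr] j z dz sz /=.
  have <- : z - wmap (fun=> maff_mask j) id z + restart_err (maff_restart j) z
          = z - wmap (fun=> maff_mask j) id z.
    suff -> : restart_err (maff_restart j) z = 0 by rewrite addr0.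
    elim: sz => [|_ [c [w [y [Qw ->]]]]|x y _ ex _ ey].
    - by rewrite raddf0.
    - rewrite linearZ /= (restart_err_steps0 (eu j)) ?scaler0 //.
      by apply/eqP; rewrite -leqn0.
    - by rewrite linearB /= ex ey subrr.
  exact: mask_htpy.
set T := restart_err (maff_restart j) z.
have -> : z - wmap (fun=> maff_mask j) id z =
          (z - wmap (fun=> maff_mask j) id z + T) - T by rewrite addrK.
rewrite unmaskB; apply: gen_subB; first exact/unmask_bdry/mask_htpy.
apply: IHr; first exact: restart_err_cycle.
apply: spanned_lin sz => [c _ [d [w [y [Qw ->]]]]|w y lew].
  by exists (c * d), w, y; rewrite scalerA.
exact: restart_err_steps (eu j) (e'u j) (e'uu j) (ee' j) _ _ _ lew.
Qed.

Definition set_at (T : Type) (v : nat -> T) (j : nat) (a : T) : nat -> T :=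
  fun i => if i == j then a else v i.

Definition aff_spread (v : nat -> F) (x : affine) : multi_affine :=
  (fun j => v j *: x.1, x.2).

Lemma aff_spreadM v p x :
  aff_spread v (aff_mul p x) = maff_mul (aff_spread v p) (aff_spread v x).
Proof.
by congr pair; apply/funext => i /=; rewrite scalerDr scalemxAl.
Qed.

Lemma mask_spread v j x :
  maff_mask j (aff_spread v x) = aff_spread (set_at v j 0) x.
Proof.
congr pair; apply/funext => i; rewrite /set_at /=.
by case: eqP; rewrite ?scale0r.
Qed.

Variable N : nat.

Definition maff_sum (x : multi_affine) : affine := (\sum_(j < N) x.1 j, x.2).

Lemma maff_sumM p x :
  maff_sum (maff_mul p x) = aff_mul (maff_sum p) (maff_sum x).
Proof. by congr pair; rewrite /= big_split mulmx_suml. Qed.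

Definition total (v : nat -> F) : F := \sum_(j < N) v j.

Lemma sum_spread v x : maff_sum (aff_spread v x) = aff_scale (total v) x.
Proof. by rewrite /maff_sum /= -scaler_suml. Qed.

Lemma maff_sum_bdry z :
  bdry maff_rel z -> bdry aff_rel (wmap (fun=> maff_sum) id z).
Proof.
apply: bdry_map => [u|_ [p [u ->]]]; first exact: wd_wmap.
rewrite /= linearB /= wmap_comp; set t := (X in _ - X).
have -> : t = wmap (fun=> aff_mul (maff_sum p)) id (wmap (fun=> maff_sum) id u).
  by rewrite wmap_comp; apply: eq_wmap => // _ x; apply: maff_sumM.
exact: diag_relE.
Qed.

Lemma total_set v j a : (j < N)%N ->
  total (set_at v j a) = a + total (set_at v j 0).
Proof.
move=> jN; rewrite /total (bigD1 (Ordinal jN)) // [in RHS](bigD1 (Ordinal jN)) //=.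
rewrite /set_at eqxx add0r.
by congr (_ + _); apply: eq_bigr => i; rewrite -val_eqE /= => /negPf ->.
Qed.

Lemma set_at_comm (v : nat -> F) i j a b : i != j ->
  set_at (set_at v j a) i b = set_at (set_at v i b) j a.
Proof.
move=> ij; apply/funext => t; rewrite /set_at.
by case: (eqVneq t i) => // ->; rewrite (negPf ij).
Qed.

(** Erasing any subset of the r + 1 coordinates from j on leaves a
sequence with nonzero total. *)
Fixpoint safe (j r : nat) (v : nat -> F) : Prop :=
  if r is r'.+1 then safe j.+1 r' v /\ safe j.+1 r' (set_at v j 0)
  else total v != 0 /\ total (set_at v j 0) != 0.

(** As for safe, except that erasing all of these coordinates leaves
total 0. *)
Fixpoint pivot (j r : nat) (v : nat -> F) : Prop :=
  if r is r'.+1 then safe j.+1 r' v /\ pivot j.+1 r' (set_at v j 0)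
  else total v != 0 /\ total (set_at v j 0) = 0.

Lemma safe_generic j r i v : (j < N)%N -> (j < i)%N ->
  exists bad : seq F, forall a, a \notin bad -> safe i r (set_at v j a).
Proof.
move=> jN; have tot w : exists b, forall a, a != b -> total (set_at w j a) != 0.
  exists (- total (set_at w j 0)) => a.
  by rewrite (total_set _ a) // addr_eq0.
elim: r i v => [|r IHr] i v ji /=.
  have [b1 h1] := tot v; have [b2 h2] := tot (set_at v i 0).
  exists [:: b1; b2] => a; rewrite !inE negb_or => /andP[/h1 ? /h2 ?].
  by rewrite set_at_comm // gtn_eqF.
have [b1 h1] := IHr i.+1 v (ltnW ji); have [b2 h2] := IHr i.+1 (set_at v i 0) (ltnW ji).
exists (b1 ++ b2) => a; rewrite mem_cat negb_or => /andP[/h1 ? /h2 ?].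
by rewrite set_at_comm // gtn_eqF.
Qed.

Hypothesis F_inf : forall s : seq F, exists a, a \notin s.

(** The coordinates are chosen one after the other; each only has to avoid
finitely many values, the opposites of the partial sums that already occur. *)
Lemma pivot_ex j r : (j + r < N)%N ->
  exists2 v, (forall i, (i < j)%N -> v i = 0) & pivot j r v.
Proof.
elim: r j => [|r IHr] j jN.
  rewrite addn0 in jN; exists (set_at (fun=> 0) j 1) => /= [i ij|].
    by rewrite /set_at ltn_eqF.
  have t0 : total (set_at (fun=> 0) j 0) = 0.
    by rewrite /total big1 // => i _; rewrite /set_at if_same.
  rewrite total_set // t0 addr0 oner_neq0; split=> //.
  rewrite -[RHS]t0; congr total; apply/funext => t.
  by rewrite /set_at; case: eqP.
have [|v' v'0 piv] := IHr j.+1; first by rewrite addSnnS.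
have jN' : (j < N)%N by apply: leq_ltn_trans jN; apply: leq_addr.
have [bad hbad] := @safe_generic j r j.+1 v' jN' (leqnn _).
have [a /hbad sa] := F_inf bad; exists (set_at v' j a) => /=.
  by move=> i ij; rewrite /set_at ltn_eqF // v'0 // ltnW.
split=> //; suff -> : set_at (set_at v' j a) j 0 = v' by [].
apply/funext => t; rewrite /set_at; case: eqP => // ->.
by rewrite v'0.
Qed.

Section Collapse.
Variable z : W.
Hypothesis dz : gen_sub aff_rel (wd z).

Let scaled c : W := wmap (fun=> aff_scale c) id z.

(** Scaling the translations by c is the composition of right multiplication
by the scalar matrix c, which commutes with left translations, and of a left
translation: it is an inner automorphism. *)
Lemma scale_bdry c : c != 0 -> bdry aff_rel (scaled c - z).
Proof.
move=> c0; have cU : (c%:M : 'M[F]_l) \in unitmx.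
  by rewrite unitmxE det_scalar unitfE expf_neq0.
have cVU : (c^-1%:M : 'M[F]_l) \in unitmx.
  by rewrite unitmxE det_scalar unitfE expf_neq0 // invr_eq0.
pose g (x : affine) : affine := (x.1, (x.2 * MkGL cU)%g).
have gM p x : g (aff_mul p x) = aff_mul p (g x).
  by rewrite /g /aff_mul /= mulgA.
have zg := prism_bdry gM dz.
pose p : affine := (0, MkGL cVU).
have pg : gen_sub aff_rel (wmap (fun=> g) id z -
    wmap (fun=> aff_mul p) id (wmap (fun=> g) id z)) by apply: diag_relE.
have -> : scaled c = wmap (fun=> aff_mul p) id (wmap (fun=> g) id z).
  rewrite wmap_comp; apply: eq_wmap => // _ [b h] /=.
  rewrite /aff_scale /aff_mul /g /= add0r; congr pair.
    have -> : invmx (c^-1%:M) = c%:M :> 'M[F]_l.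
      apply: (can_inj (mulKmx cVU)); rewrite mulmxV // -scalar_mxM.
      by rewrite mulVf.
    by rewrite mul_mx_scalar.
  apply: val_inj => /=; rewrite mul_scalar_mx mul_mx_scalar scalerA.
  by rewrite mulVf // scale1r.
by move/gen_subC/bdry_sub/gen_subD: pg => /(_ _ zg); rewrite addrA subrK.
Qed.

Let chain v : MW := wmap (fun=> aff_spread v) id z.

Lemma unmask_chain j r v : unmask j r.+1 (chain v) =
  unmask j.+1 r (chain v) - unmask j.+1 r (chain (set_at v j 0)).
Proof.
rewrite /= unmaskB; congr (_ - unmask _ _ _); rewrite wmap_comp.
by apply: eq_wmap => // _ x; apply: mask_spread.
Qed.

Lemma unmask_chain0 j v :
  unmask j 0 (chain v) = chain v - chain (set_at v j 0).
Proof.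
rewrite /=; congr (_ - _); rewrite wmap_comp.
by apply: eq_wmap => // _ x; apply: mask_spread.
Qed.

Lemma sum_chain v : wmap (fun=> maff_sum) id (chain v) = scaled (total v).
Proof.
by rewrite wmap_comp; apply: eq_wmap => // _ x; apply: sum_spread.
Qed.

Lemma safe_bdry j r v : safe j r v ->
  bdry aff_rel (wmap (fun=> maff_sum) id (unmask j r (chain v))).
Proof.
elim: r j v => [|r IHr] j v.
  move=> [t1 t2]; rewrite unmask_chain0 linearB /= !sum_chain.
  by apply: (gen_sub_trans (y := z)); last apply: gen_subC; apply: scale_bdry.
move=> [s1 s2]; rewrite unmask_chain linearB.
by apply: gen_subB; apply: IHr.
Qed.

(** Expanding the product of the operators 1 - erasure gives an alternating
sum of scalings, all of which act trivially on homology but the one by 0. *)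
Lemma pivot_bdry j r v : pivot j r v ->
  bdry aff_rel (wmap (fun=> maff_sum) id (unmask j r (chain v)) -
               (-1) ^+ r *: (z - scaled 0)).
Proof.
elim: r j v => [|r IHr] j v.
  move=> [t1 t2]; rewrite unmask_chain0 linearB /= !sum_chain t2.
  by rewrite scale1r opprB addrA subrK; apply: scale_bdry.
move=> [s1 s2]; rewrite unmask_chain linearB exprS mulN1r scaleNr opprK /=.
rewrite -addrA; apply: gen_subD; first exact: safe_bdry.
by rewrite addrC -opprB; apply/gen_subN/IHr.
Qed.

End Collapse.

End AffineHomology.

Lemma nsteps_size (X : choiceType) (e : rel X) w : (nsteps e w <= size w)%N.
Proof.
elim: w => //= x w IHw; rewrite -add1n; apply: leq_add => //.
by case: w {IHw} => // y w; apply: leq_b1.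
Qed.

Lemma spanned_size (X Y : choiceType) (z : {freeg (seq X * Y) / rat}) :
  exists r, spanned (fun w => (size w <= r)%N) z.
Proof.
elim/freeg_ind: z => [|c [w y] z [r zr]]; first by exists 0%N; apply: gen_sub0.
exists (maxn (size w) r); apply: gen_subD.
  by apply: gen_sub_in; exists c, w, y; rewrite leq_maxl.
apply: gen_subW zr => _ [d [v [t [vr ->]]]].
by apply: gen_sub_in; exists d, v, t; rewrite leq_max vr orbT.
Qed.

(** The homology of an affine group over an infinite field comes from its
linear part.  As a function of c, scaling the translations by c is polynomial
on homology, and it is constant for nonzero c; so it takes the same value at
0. *)
Theorem affine_collapse (F : fieldType) (k l : nat) (Y : choiceType)
    (z : {freeg (seq (affine F k l) * Y) / rat}) :
  (forall s : seq F, exists a, a \notin s) ->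
  gen_sub (@aff_rel F k l Y) (wd z) ->
  bdry (@aff_rel F k l Y) (z - wmap (fun=> aff_scale 0) id z).
Proof.
move=> F_inf dz; have [r zr] := spanned_size z.
have [v _ piv] := @pivot_ex F r.+1 F_inf 0 r (leqnn _).
have := pivot_bdry dz piv.
set t := wmap _ _ (unmask _ _ _) => tz.
have t0 : bdry (@aff_rel F k l Y) t.
  apply: maff_sum_bdry; apply: unmask_cycle.
    rewrite wd_wmap; apply: (diag_rel_map _ (r := aff_spread v)) dz => p u /=.
    rewrite !wmap_comp; apply: eq_wmap => // _ x; exact: aff_spreadM.
  apply: gen_sub_map zr => _ [c [w [y [wr ->]]]] /=.
  rewrite linearZ /= wmapE; apply: gen_sub_in; exists c, (map (aff_spread v) w), y.
  by rewrite (leq_trans (nsteps_size _ _)) // size_map.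
have := gen_subB t0 tz; rewrite opprB addrC subrK.
move/(gen_subZ (c := (-1) ^+ r)); rewrite scalerA -expr2 sqrr_sign scale1r.
apply=> y [[p [u ->]]|[u ->]]; last by right; exists ((-1) ^+ r *: u); rewrite linearZ.
by left; exists p, ((-1) ^+ r *: u); rewrite linearZ scalerBr.
Qed.

(** * General position *)

Section SparseKernel.
Variables (F : fieldType) (N k : nat).
Implicit Types (X : 'M[F]_(N, k)) (c : 'cV[F]_k).

Definition supp c : {set 'I_k} := [set j | c j 0 != 0].

Lemma mulmx_cols X c : X *m c = \sum_j c j 0 *: col j X.
Proof.
apply/colP => i; rewrite summxE mxE; apply: eq_bigr => j _.
by rewrite !mxE mulrC.
Qed.

Lemma free_cols X (s : seq 'I_k) : uniq s ->
  reflect (forall c, {subset supp c <= s} -> X *m c = 0 -> c = 0)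
          (free [seq col j X | j <- s]).
Proof.
move=> us; rewrite -[map _ _]in_tupleE; apply: (iffP freeP) => [fr c cs Xc|fr d].
  have {}fr : forall d : 'I_(size s) -> F,
    \sum_(i < size s) d i *: [seq col j X | j <- s]`_i = 0 -> forall i, d i = 0.
    by move: fr; rewrite /= size_map.
  apply/colP => j; rewrite mxE; apply/eqP/negPn/negP => cj0.
  have js : j \in s by apply: cs; rewrite inE.
  have idx : (index j s < size s)%N by rewrite index_mem.
  have /(_ _ (Ordinal idx)) := fr (fun i => c (nth j s i) 0).
  rewrite /= nth_index // => E; case/eqP: cj0; apply: E.
  rewrite -[RHS]Xc mulmx_cols.
  rewrite [in RHS](bigID (mem s)) /= [X in _ = _ + X]big1 => [|i nis]; last first.
    have : i \notin supp c by apply: contra nis => /cs.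
    by rewrite inE negbK => /eqP ->; rewrite scale0r.
  rewrite addr0 -big_uniq // (big_nth j) big_mkord; apply: eq_bigr => i _.
  by rewrite (nth_map j).
rewrite /=; move: d; rewrite size_map => d Xd i.
pose c : 'cV[F]_k := \col_j (if insub (index j s) is Some i then d i else 0).
have cE (p : 'I_(size s)) j0 : c (nth j0 s p) 0 = d p.
  rewrite mxE index_uniq //; case: insubP => [q _ qp|]; last by rewrite ltn_ord.
  by congr d; apply: val_inj.
have j0 : 'I_k by case: s i {us d Xd c cE fr} => [[]|].
suff c0 : c = 0 by rewrite -(cE i j0) c0 mxE.
apply: fr => [j|].
  rewrite inE mxE; case: insubP => [q qs _ _|]; last by rewrite eqxx.
  by rewrite -index_mem.
rewrite -[RHS]Xd mulmx_cols (bigID (mem s)) /= [X in _ + X]big1 => [|j nis].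
  rewrite addr0 -big_uniq // (big_nth j0) big_mkord; apply: eq_bigr => p _.
  by rewrite cE (nth_map j0).
rewrite mxE; case: insubP => [q qs _|]; last by rewrite scale0r.
by move: nis; rewrite -index_mem qs.
Qed.

(** In this form general position can be checked by linear algebra on
coefficient vectors, with no enumeration of subsets. *)
Lemma gen_pos_sparse X :
  reflect (forall c, (#|supp c| <= minn N k)%N -> X *m c = 0 -> c = 0)
          (gen_pos X).
Proof.
apply: (iffP (gen_posP X)) => [gX c cs Xc|gX s us ls].
  have := gX (enum (supp c)) (enum_uniq _).
  rewrite -cardE => /(_ cs) /(free_cols X (enum_uniq _)); apply=> // j.
  by rewrite mem_enum.
apply/free_cols => // c cs; apply: gX; apply: leq_trans ls.
by rewrite -(card_uniqP us); apply/subset_leq_card/fintype.subsetP.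
Qed.

End SparseKernel.

Lemma gen_pos_inj (F : fieldType) N k (X : 'M[F]_(N, k)) : (k <= N)%N ->
  reflect (forall c : 'cV_k, X *m c = 0 -> c = 0) (gen_pos X).
Proof.
move=> kN; apply: (iffP (gen_pos_sparse X)) => gX c; last by move=> _; apply: gX.
apply: gX; rewrite (minn_idPr kN).
by apply: leq_trans (max_card _) _; rewrite card_ord.
Qed.

Lemma ker0_unitmx (F : fieldType) N (A : 'M[F]_N) :
  (forall c : 'cV_N, A *m c = 0 -> c = 0) -> A \in unitmx.
Proof.
move=> Ainj; rewrite -unitmx_tr -row_free_unit -kermx_eq0.
apply/eqP/row_matrixP => i; rewrite row0; apply: (can_inj (@trmxK _ _ _)).
rewrite trmx0; apply: Ainj; rewrite -[A in A *m _]trmxK -trmx_mul -row_mul.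
by rewrite mulmx_ker row0 trmx0.
Qed.

Lemma colsub_ker0 (F : fieldType) N k m (X : 'M[F]_(N, k)) (f : 'I_m -> 'I_k)
    (c : 'cV_m) : gen_pos X -> injective f -> (m <= N)%N ->
  colsub f X *m c = 0 -> c = 0.
Proof.
move=> gX f_inj mN; rewrite -[X in colsub f X]mulmx1 -mulmx_colsub -mulmxA => Xd.
set d := _ *m c in Xd.
have dE i : d (f i) 0 = c i 0.
  rewrite mxE (bigD1 i) //= big1 => [|j ji]; first by rewrite !mxE eqxx mul1r addr0.
  by rewrite !mxE (inj_eq f_inj) eq_sym (negPf ji) mul0r.
have dsupp j : d j 0 != 0 -> j \in codom f.
  apply: contraR => nj; rewrite mxE big1 // => i _; rewrite !mxE.
  case: eqP => [e|]; last by rewrite mul0r.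
  by rewrite e codom_f in nj.
suff d0 : d = 0 by apply/colP => i; rewrite -dE d0 !mxE.
move/gen_pos_sparse: gX; apply=> //.
have le_supp : (#|supp d| <= m)%N.
  rewrite -[leqRHS](card_ord m) -(card_codom f_inj).
  by apply/subset_leq_card/fintype.subsetP => j; rewrite inE => /dsupp.
rewrite leq_min (leq_trans le_supp mN) /=.
by apply: leq_trans (max_card _) _; rewrite card_ord.
Qed.

Lemma leading_unit (F : fieldType) N k (Nk : (N <= k)%N)
    (X : genPosTuple F N k) : colsub (widen_ord Nk) (gp_mx X) \in unitmx.
Proof.
by apply: ker0_unitmx => c; apply: colsub_ker0 (gp_gen_pos X) _ _ => // i j [/val_inj].
Qed.

(** * Bar chains with coefficients in tuples *)

Section TupleChains.
Variables (F : fieldType) (N k : nat).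
Notation G := (GL F N).
Notation Y := (genPosTuple F N k).
Notation M := {freeg (seq G * Y) / rat}.

Lemma gp_mul1 (X : Y) : gp_mul 1%g X = X.
Proof. by apply: val_inj; rewrite /= mul1mx. Qed.

Lemma gp_mulM g h (X : Y) : gp_mul (g * h)%g X = gp_mul g (gp_mul h X).
Proof. by apply: val_inj; rewrite /= mulmxA. Qed.

Lemma gp_permM s t (X : Y) : gp_perm (s * t)%g X = gp_perm s (gp_perm t X).
Proof. by apply/val_inj/matrixP => i j; rewrite !mxE permM. Qed.

Lemma gp_perm_mul s g (X : Y) : gp_perm s (gp_mul g X) = gp_mul g (gp_perm s X).
Proof.
apply/val_inj/matrixP => i j; rewrite !mxE.
by apply: eq_bigr => t _; rewrite !mxE.
Qed.

Definition gl_act (g : G) : M -> M := wmap (fun=> mulg g) (gp_mul g).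
HB.instance Definition _ g :=
  GRing.Linear.copy (gl_act g) (wmap (fun=> mulg g) (@gp_mul F N k g)).

(** Permutes the vectors of a tuple, without the sign. *)
Definition col_act (s : 'S_k) : M -> M := wmap (fun=> id) (gp_perm s).
HB.instance Definition _ s :=
  GRing.Linear.copy (col_act s) (wmap (fun=> @id G) (@gp_perm F N k s)).

Definition gl_rel : M -> Prop := diag_rel (fun g => mulg g) (fun g => gp_mul g).

Definition sgn_rel (z : M) : Prop :=
  exists (s : 'S_k) u, z = u - (-1) ^+ s *: col_act s u.

Definition tuple_rel (z : M) : Prop := gl_rel z \/ sgn_rel z.

Lemma wd_col_act s u : wd (col_act s u) = col_act s (wd u).
Proof. exact: wd_wmap. Qed.

Lemma col_gl_act s g u : col_act s (gl_act g u) = gl_act g (col_act s u).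
Proof.
rewrite /col_act /gl_act !wmap_comp; apply: eq_wmap => // X.
exact: gp_perm_mul.
Qed.

Lemma col_actM s t u : col_act (s * t)%g u = col_act s (col_act t u).
Proof. by rewrite /col_act wmap_comp; apply: eq_wmap => // X; apply: gp_permM. Qed.

Lemma sgn_relZ c z : sgn_rel z -> sgn_rel (c *: z).
Proof.
move=> [s [u ->]]; exists s, (c *: u).
by rewrite scalerBr [col_act s (c *: u)]linearZ /= !scalerA mulrC.
Qed.

Lemma gl_relZ c z : gl_rel z -> gl_rel (c *: z).
Proof. by move=> [g [u ->]]; exists g, (c *: u); rewrite linearZ /= -scalerBr. Qed.

Lemma tuple_relZ c z : tuple_rel z -> tuple_rel (c *: z).
Proof. by move=> [/gl_relZ|/sgn_relZ] h; [left|right]. Qed.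

Lemma wd_tuple_rel z : gen_sub tuple_rel z -> gen_sub tuple_rel (wd z).
Proof.
apply: gen_sub_map => _ [[g [u ->]]|[s [u ->]]] /=.
  by apply: gen_sub_in; left; exists g, (wd u); rewrite linearB /= wd_wmap.
apply: gen_sub_in; right; exists s, (wd u).
by rewrite linearB /= linearZ /= wd_col_act.
Qed.

(** Antisymmetrization splits the projection to the unordered tuples, so that
cycles modulo the sign relations lift to cycles for the group action alone. *)
Definition antisym : M -> M := fun u =>
  (k`!%:R)^-1 *: \sum_(s : 'S_k) (-1) ^+ s *: col_act s u.

Lemma antisym_is_linear : linear antisym.
Proof.
move=> c u v; rewrite /antisym scalerA mulrC -scalerA -scalerDr; congr (_ *: _).
rewrite scaler_sumr -big_split /=; apply: eq_bigr => s _.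
by rewrite linearP scalerDr !scalerA mulrC.
Qed.
HB.instance Definition _ :=
  GRing.isLinear.Build rat M M *:%R antisym antisym_is_linear.

Lemma wd_antisym u : wd (antisym u) = antisym (wd u).
Proof.
rewrite /antisym linearZ /= linear_sum; congr (_ *: _).
by apply: eq_bigr => s _; rewrite linearZ /= wd_col_act.
Qed.

Lemma antisym_gl_act g u : antisym (gl_act g u) = gl_act g (antisym u).
Proof.
rewrite /antisym [gl_act g (_ *: _)]linearZ /=; congr (_ *: _).
by rewrite [RHS]linear_sum; apply: eq_bigr => s _; rewrite linearZ /= col_gl_act.
Qed.

Lemma antisym_col_act s u : antisym (col_act s u) = (-1) ^+ s *: antisym u.
Proof.
rewrite /antisym scalerA mulrC -scalerA; congr (_ *: _).
rewrite (reindex_inj (mulIg s^-1%g)) scaler_sumr; apply: eq_bigr => t _.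
rewrite scalerA -col_actM mulgKV odd_permM odd_permV signr_addb mulrC.
by [].
Qed.

Lemma antisym_rel z : gen_sub tuple_rel z -> gen_sub gl_rel (antisym z).
Proof.
apply: gen_sub_map => _ [[g [u ->]]|[s [u ->]]] /=; rewrite linearB /=.
  by rewrite antisym_gl_act; apply: diag_relE.
rewrite [antisym (_ *: _)]linearZ /= antisym_col_act scalerA -expr2 sqrr_sign scale1r subrr.
exact: gen_sub0.
Qed.

Lemma sub_antisym u : gen_sub tuple_rel (u - antisym u).
Proof.
have fact0 : (k`!%:R : rat) != 0 by rewrite Num.Theory.pnatr_eq0 -lt0n fact_gt0.
have -> : u - antisym u =
    (k`!%:R)^-1 *: \sum_(s : 'S_k) (u - (-1) ^+ s *: col_act s u).
  rewrite sumrB scalerBr; congr (_ - _).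
  by rewrite sumr_const card_Sn -scaler_nat scalerA mulVf ?scale1r.
apply: gen_subZ => [z|]; first exact: tuple_relZ.
by apply: gen_sub_sum => s _; apply: gen_sub_in; right; exists s, u.
Qed.

Lemma antisym_cycle z : gen_sub tuple_rel (wd z) ->
  (bdry tuple_rel (antisym z) -> bdry tuple_rel z) /\
  gen_sub gl_rel (wd (antisym z)).
Proof.
move=> dz; split; last by rewrite wd_antisym; apply: antisym_rel.
by move=> nz; rewrite -(subrK (antisym z) z); apply: gen_subD nz; apply/bdry_sub/sub_antisym.
Qed.

Lemma bdry_gl_rel z : bdry gl_rel z -> bdry tuple_rel z.
Proof.
by apply: gen_subW => u [gu|du]; apply: gen_sub_in; [left; left | right].
Qed.

(** Tuples of at least N vectors have an equivariant map to the group, the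
frame formed by the leading N vectors, and prepending it to words is an
equivariant contraction.  It does not respect the permutations, whence the
antisymmetrization. *)
Lemma long_column z : (N <= k)%N ->
  gen_sub tuple_rel (wd z) -> bdry tuple_rel z.
Proof.
move=> Nk /antisym_cycle[red da]; apply: red; apply: bdry_gl_rel.
pose lead X : G := MkGL (leading_unit Nk X).
have leadM g X : (g * lead X)%g = lead (gp_mul g X).
  by apply: val_inj; rewrite /= mulmx_colsub.
have -> : antisym z = wd (wcons lead (antisym z)) + wcons lead (wd (antisym z)).
  by rewrite wd_cons subrK.
apply: gen_subD; first exact: bdry_wd.
apply: bdry_sub; apply: (diag_rel_map _ (r := id)) da => g u /=.
by rewrite (@wmap_wcons _ _ _ _ _ _ _ lead).
Qed.

End TupleChains.

(** * The stabilizer of the standard tuple *)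

Section StandardStabilizer.
Variables (F : fieldType) (k l : nat).
Notation G := (GL F (l + k)).
Notation A := (affine F k l).
Notation Y := (genPosTuple F (l + k) k).

Lemma iota_unit (x : A) :
  block_mx (GL_mx x.2) 0 (x.1 *m GL_mx x.2) 1%:M \in unitmx.
Proof. by rewrite unitmxE det_lblock det1 mulr1 -unitmxE Defs.GL_unit. Qed.

Definition iota (x : A) : G := MkGL (iota_unit x).

Lemma iotaM p x : iota (aff_mul p x) = (iota p * iota x)%g.
Proof.
apply: val_inj; rewrite /= mulmx_block !mulmx0 !mul0mx !addr0 add0r mulmx1 mul1mx.
by rewrite mulmxDl !mulmxA mulmxKV ?Defs.GL_unit.
Qed.

Lemma iota_inj : injective iota.
Proof.
move=> [b h] [b' h'] /(congr1 (@GL_mx _ _)) /= /eq_block_mx[/val_inj <- _ + _].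
by move/(can_inj (mulmxK (Defs.GL_unit h))) => ->.
Qed.

Lemma std_gen_pos : gen_pos (col_mx 0 1%:M : 'M[F]_(l + k, k)).
Proof.
apply/gen_pos_inj => [|c]; first exact: leq_addl.
by rewrite mul_col_mx mul1mx mul0mx -col_mx0 => /eq_col_mx[].
Qed.

Definition std_tuple : Y := GenPosTuple std_gen_pos.
Notation E := std_tuple.

Lemma iota_std x : gp_mul (iota x) E = E.
Proof.
apply: val_inj; rewrite /= mul_block_col !mulmx0 mul0mx !add0r mul1mx.
by [].
Qed.

Lemma stab_std g : gp_mul g E = E -> exists x, iota x = g.
Proof.
move/(congr1 (@gp_mx _ _ _)); case: g => g gU /= gE.
move: gU gE; rewrite -[g]submxK mul_block_col !mulmx0 !mulmx1 !add0r => gU.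
move=> /eq_col_mx[ur dr]; rewrite ur dr in gU *.
have uU : ulsubmx g \in unitmx.
  by move: gU; rewrite !unitmxE det_lblock det1 mulr1.
exists (dlsubmx g *m invmx (ulsubmx g), MkGL uU); apply: val_inj => /=.
by rewrite mulmxKV // submxK -ur -dr submxK.
Qed.

(** Both tuples are brought to the same normal form by elimination, which
acts on rows and columns; the action on the side of the tuple is absorbed in a
block of the frame. *)
Lemma std_transitive (X : Y) : exists g, gp_mul g E = X.
Proof.
have free_tr (Z : Y) : row_free (gp_mx Z)^T.
  rewrite -kermx_eq0; apply/eqP/row_matrixP => i; rewrite row0.
  apply: (can_inj (@trmxK _ _ _)); rewrite trmx0.
  have /gen_pos_inj := gp_gen_pos Z; apply; first exact: leq_addl.
  by rewrite -[X in X *m _]trmxK -trmx_mul -row_mul mulmx_ker row0 trmx0.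
have eb (Z : Y) : (gp_mx Z)^T =
    col_ebase (gp_mx Z)^T *m pid_mx k *m row_ebase (gp_mx Z)^T.
  by rewrite -[LHS]mulmx_ebase (eqP (free_tr Z)).
set CX := col_ebase (gp_mx X)^T; set RX := row_ebase (gp_mx X)^T.
set CE := col_ebase (gp_mx E)^T; set RE := row_ebase (gp_mx E)^T.
pose D : 'M[F]_k := CX *m invmx CE.
pose g := (block_mx 1%:M 0 0 D *m invmx RE *m RX)^T.
have DU : D \in unitmx by rewrite unitmx_mul unitmx_inv !col_ebase_unit.
have gU : g \in unitmx.
  rewrite unitmx_tr !unitmx_mul unitmx_inv !row_ebase_unit !andbT.
  by rewrite unitmxE det_ublock det1 mul1r -unitmxE.
exists (MkGL gU); apply: val_inj; apply: (can_inj (@trmxK _ _ _)) => /=.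
rewrite trmx_mul trmxK (eb X) -/CX -/RX !mulmxA; congr (_ *m RX).
have ED : (col_mx 0 1%:M : 'M[F]_(l + k, k))^T *m block_mx 1%:M 0 0 D =
    D *m (gp_mx E)^T.
  rewrite /= tr_col_mx trmx0 trmx1 mul_row_block mul_mx_row.
  by rewrite !mulmx0 mul0mx !add0r mulmx1 mul1mx.
rewrite ED (eb E) -/CE -/RE /D !mulmxA mulmxK ?row_ebase_unit //.
by rewrite mulmxKV ?col_ebase_unit.
Qed.

(** The value 1 on the standard tuple makes the retraction to_aff restrict
to the identity on the stabilizer. *)
Definition frame (X : Y) : G :=
  if X == E then 1%g else projT1 (cid (std_transitive X)).

Lemma frameE X : gp_mul (frame X) E = X.
Proof.
rewrite /frame; case: eqP => [->|_]; first exact: gp_mul1.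
by case: cid.
Qed.

Lemma frame_std : frame E = 1%g.
Proof. by rewrite /frame eqxx. Qed.

Lemma frame_inv X : gp_mul (frame X)^-1%g X = E.
Proof. by rewrite -{2}(frameE X) -gp_mulM mulVg gp_mul1. Qed.

Lemma frame_coset g : exists x, iota x = (g * frame (gp_mul g^-1 E))%g.
Proof. by apply: stab_std; rewrite gp_mulM frameE -gp_mulM mulgV gp_mul1. Qed.

(** An equivariant retraction of the group onto the stabilizer of the standard
tuple: g lies in a unique coset, represented by the frame of g^-1 E. *)
Definition to_aff (g : G) : A := projT1 (cid (frame_coset g)).

Lemma to_affE g : iota (to_aff g) = (g * frame (gp_mul g^-1 E))%g.
Proof. by rewrite /to_aff; case: cid. Qed.

Lemma to_affM p g : to_aff (iota p * g)%g = aff_mul p (to_aff g).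
Proof.
apply: iota_inj; rewrite iotaM !to_affE mulgA invMg gp_mulM.
congr (_ * frame (gp_mul _ _))%g.
by rewrite -[in LHS](iota_std p) -gp_mulM mulVg gp_mul1.
Qed.

Lemma to_aff_iota x : to_aff (iota x) = x.
Proof.
apply: iota_inj; rewrite to_affE -[in gp_mul _ _](iota_std x) -gp_mulM.
by rewrite mulVg gp_mul1 frame_std mulg1.
Qed.

(** Retracts the group to the stabilizer and then kills the translation
part. *)
Definition levi (g : G) : G := iota (aff_scale 0 (to_aff g)).

Definition is_levi (g : G) : Prop := exists h, g = iota (0, h).

Lemma levi_is g : is_levi (levi g).
Proof. by exists (to_aff g).2; rewrite /levi /aff_scale scale0r. Qed.

Lemma levi_id g : is_levi g -> levi g = g.
Proof.
by move=> [h ->]; rewrite /levi to_aff_iota /aff_scale scaler0.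
Qed.

Lemma leviM p g : levi (iota p * g)%g = (iota (aff_scale 0 p) * levi g)%g.
Proof. by rewrite /levi to_affM aff_scaleM iotaM. Qed.

Notation WG := {freeg (seq G * unit) / rat}.
Notation M := {freeg (seq G * Y) / rat}.

Definition stab_rel : WG -> Prop :=
  diag_rel (fun p => mulg (iota p)) (fun=> id).

Lemma levi_stab_rel z :
  gen_sub stab_rel z -> gen_sub stab_rel (wmap (fun=> levi) id z).
Proof.
apply: (diag_rel_map _ (r := aff_scale 0)) => p u /=; rewrite !wmap_comp.
by apply: eq_wmap => // _ g; apply: leviM.
Qed.

Lemma levi_bdry (z : WG) : (forall s : seq F, exists a, a \notin s) ->
  gen_sub stab_rel (wd z) -> bdry stab_rel (z - wmap (fun=> levi) id z).
Proof.
move=> F_inf dz; pose z1 := wmap (fun=> to_aff) id z.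
apply: (gen_sub_trans (y := wmap (fun=> iota) id z1)).
  rewrite wmap_comp; apply: gen_subC; apply: prism_bdry dz => p g /=.
  by rewrite to_affM iotaM.
have dz1 : gen_sub (@aff_rel F k l unit) (wd z1).
  rewrite wd_wmap; apply: (diag_rel_map _ (r := id)) dz => p u /=.
  by rewrite !wmap_comp; apply: eq_wmap => // _ g; apply: to_affM.
have -> : wmap (fun=> levi) id z =
    wmap (fun=> iota) id (wmap (fun=> aff_scale 0) id z1).
  by rewrite !wmap_comp.
rewrite -linearB; apply: bdry_map (affine_collapse F_inf dz1) => u /=.
  exact: wd_wmap.
move=> ru; apply: (diag_rel_map _ (r := id)) (gen_sub_in ru) => p v /=.
by rewrite !wmap_comp; apply: eq_wmap => // _ x; apply: iotaM.
Qed.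

(** Together with at_std, Shapiro's lemma: chains with coefficients in the
transitive set of tuples are chains modulo the stabilizer. *)
Definition untwist : M -> WG := wmap (fun X => mulg (frame X)^-1%g) (fun=> tt).
HB.instance Definition _ := GRing.Linear.copy untwist
  (wmap (fun X => mulg (frame X)^-1%g) (fun=> tt)).

Definition at_std : WG -> M := wmap (fun=> id) (fun=> E).
HB.instance Definition _ := GRing.Linear.copy at_std
  (wmap (fun=> @id G) (fun _ : unit => E)).

Lemma untwist_rel z : gen_sub (@gl_rel F _ k) z -> gen_sub stab_rel (untwist z).
Proof.
apply: gen_sub_map => _ [g [u ->]] /=.
pose f : {linear M -> WG} := untwist \- (untwist \o @gl_act F _ k g).
rewrite linearB -[_ - _]/(f u).
elim/freeg_ind: u => [|c [w X] u IHu]; first by rewrite linear0; apply: gen_sub0.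
rewrite linearD linearZ; apply: gen_subD => //.
apply: gen_subZ => [_ [p [v ->]]|].
  by exists p, (c *: v); rewrite linearZ /= scalerBr.
have [|p ip] := @stab_std ((frame (gp_mul g X))^-1 * g * frame X)%g.
  by rewrite !gp_mulM frameE frame_inv.
rewrite /f /= /untwist /gl_act !wmapE.
suff -> : map (mulg (frame (gp_mul g X))^-1%g) (map (mulg g) w) =
          map (mulg (iota p)) (map (mulg (frame X)^-1%g) w).
  by rewrite -(wmapE (fun=> mulg (iota p)) id); apply: diag_relE.
by rewrite -!map_comp; apply: eq_map => x /=; rewrite ip !mulgA mulgK.
Qed.

Lemma at_std_rel z : gen_sub stab_rel z -> gen_sub (@gl_rel F _ k) (at_std z).
Proof.
apply: (diag_rel_map _ (r := iota)) => p u /=; rewrite /at_std !wmap_comp.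
by apply: eq_wmap => // x; rewrite /= iota_std.
Qed.

Lemma at_std_bdry z : bdry stab_rel z -> bdry (@gl_rel F _ k) (at_std z).
Proof.
apply: bdry_map => [u|u Su]; first exact: wd_wmap.
exact/at_std_rel/gen_sub_in.
Qed.

Lemma at_std_untwist z : gen_sub (@gl_rel F _ k) (z - at_std (untwist z)).
Proof.
pose f : {linear M -> M} := idfun \- (at_std \o untwist).
rewrite -[_ - _]/(f z).
elim/freeg_ind: z => [|c [w X] u IHu]; first by rewrite linear0; apply: gen_sub0.
rewrite linearD linearZ; apply: gen_subD => //.
apply: gen_subZ => [z|]; first exact: gl_relZ.
rewrite /f /= /untwist /at_std !wmapE map_id -(frame_inv X).
rewrite -(wmapE (fun=> mulg (frame X)^-1%g) (gp_mul (frame X)^-1%g) w X).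
exact: (@diag_relE _ _ _ (fun g => mulg g) (fun g => gp_mul g)).
Qed.

Lemma untwist_wd z : wd (untwist z) = untwist (wd z).
Proof. exact: wd_wmap. Qed.

Hypothesis F_inf : forall s : seq F, exists a, a \notin s.

Section Swap.
Variable s : 'S_k.

Lemma swap_unit : block_mx 1%:M 0 0 (col_perm s 1%:M) \in @unitmx F (l + k).
Proof.
rewrite unitmxE det_ublock det1 mul1r -unitmxE col_permE mul1mx.
by rewrite unitmx_perm.
Qed.

Definition swap : G := MkGL swap_unit.

Lemma swap_std : gp_mul swap E = gp_perm s E.
Proof.
apply: val_inj; rewrite /= mul_block_col !mulmx0 !mul0mx !add0r mulmx1.
by rewrite !col_permE mul_col_mx !mul0mx.
Qed.

Lemma swap_levi g : is_levi g -> (swap * g)%g = (g * swap)%g.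
Proof.
move=> [h ->]; apply: val_inj; rewrite /= !mulmx_block.
by rewrite !mul0mx !mulmx0 !mul1mx !mulmx1 !addr0 !add0r.
Qed.

(** On words in the Levi subgroup, the permutation of the standard tuple is
realized by an element that commutes with all letters; right multiplication by
it is homotopic to the identity. *)
Lemma swap_bdry (q : WG) :
  q = wmap (fun=> levi) id q -> gen_sub stab_rel (wd q) ->
  bdry (@gl_rel F _ k) (at_std q - col_act s (at_std q)).
Proof.
move=> ql dq.
apply: (gen_sub_trans (y := gl_act swap (at_std q))).
  exact/bdry_sub/diag_relE.
have -> : gl_act swap (at_std q) =
    col_act s (at_std (wmap (fun=> fun g => (g * swap)%g) id q)).
  rewrite ql /gl_act /col_act /at_std !wmap_comp.
  apply: eq_wmap => /= [y g|y]; last exact: swap_std.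
  exact/swap_levi/levi_is.
rewrite -!linearB /=; apply: (@bdry_map _ _ _ _ (@gl_rel F _ k)).
- exact: wd_col_act.
- move=> u gu; apply: (diag_rel_map _ (r := id)) (gen_sub_in gu) => g v.
  exact: col_gl_act.
apply: at_std_bdry; apply: prism_bdry dq => p g.
by rewrite mulgA.
Qed.

End Swap.

(** A transposition acts on the column by -1, because of the sign relations,
and trivially on its homology, because the homology is carried by words in the
Levi subgroup, which commute with the transposition. *)
Lemma short_column (z : M) : (1 < k)%N ->
  gen_sub (@tuple_rel F _ k) (wd z) -> bdry (@tuple_rel F _ k) z.
Proof.
move=> k1 /antisym_cycle[red da]; apply: red; set u := antisym z in da *.
pose q := wmap (fun=> levi) id (untwist u).
have dv : gen_sub stab_rel (wd (untwist u)).
  by rewrite untwist_wd; apply: untwist_rel.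
have dq : gen_sub stab_rel (wd q) by rewrite wd_wmap; apply: levi_stab_rel.
have uq : bdry (@gl_rel F _ k) (u - at_std q).
  apply: (gen_sub_trans (y := at_std (untwist u))).
    exact/bdry_sub/at_std_untwist.
  by rewrite -linearB; apply/at_std_bdry/levi_bdry.
pose s : 'S_k := tperm (Ordinal (ltnW k1)) (Ordinal k1).
have ql : q = wmap (fun=> levi) id q.
  rewrite /q wmap_comp; apply: eq_wmap => // _ g /=.
  by rewrite (levi_id (levi_is g)).
have sq := bdry_gl_rel (swap_bdry s ql dq).
have sgn : bdry (@tuple_rel F _ k) (at_std q + col_act s (at_std q)).
  apply/bdry_sub/gen_sub_in; right; exists s, (at_std q).
  by rewrite odd_tperm /= expr1 scaleN1r opprK.
rewrite -(subrK (at_std q) u); apply: gen_subD; first exact: bdry_gl_rel.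
(* The swap fixes the class of at_std q and also negates it. *)
have -> : at_std q = 2^-1 *: ((at_std q - col_act s (at_std q)) +
                            (at_std q + col_act s (at_std q))).
  by rewrite addrACA addNr addr0 -mulr2n -scaler_nat scalerA mulVf ?scale1r.
apply: gen_subZ (gen_subD sq sgn) => t [/tuple_relZ|[y ->]]; first by left.
by right; exists (2^-1 *: y); rewrite linearZ.
Qed.

Definition pointed_rel (z : M) : Prop := gl_rel z \/ letter_rel is_levi E z.

(** For k = 1 this says that GL_(N-1) and the stabilizer of a vector have the
same homology.  Surjectivity is the collapse of the translations, and
injectivity holds because the Levi subgroup is a retract of the stabilizer. *)
Lemma pointed_column z : gen_sub pointed_rel (wd z) -> bdry pointed_rel z.
Proof.
move=> dz; pose v := untwist z.
pose rho : {linear WG -> WG} := wmap (fun=> levi) id.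
have dv : gen_sub stab_rel (wd (v - rho v)).
  rewrite linearB /= wd_wmap untwist_wd.
  pose f : {linear WG -> WG} := idfun \- rho.
  rewrite -[_ - _]/((f \o untwist) (wd z)).
  apply: gen_sub_map dz => t [gt|[c [w [wl ->]]]] /=.
    rewrite /f /=; have st := untwist_rel (gen_sub_in gt).
    by apply: gen_subB => //; apply: levi_stab_rel.
  have e1 : untwist << (w, E) >> = << (w, tt) >>.
    rewrite /untwist wmapE frame_std invg1.
    by rewrite (eq_map (@mul1g _)) map_id.
  have e2 : rho << (w, tt) >> = << (w, tt) >>.
    rewrite /rho /= wmapE (_ : map levi w = w) //.
    by rewrite -[RHS]map_id; apply/eq_in_map => g /wl /levi_id.
  rewrite /f /= [untwist _]linearZ /= e1 [wmap _ _ _]linearZ /=.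
  by rewrite [wmap _ _ _]e2 subrr; apply: gen_sub0.
have rhoE t : gen_sub (letter_rel is_levi tt) (rho t).
  elim/freeg_ind: t => [|c [w []] t IHt]; first by rewrite linear0; apply: gen_sub0.
  rewrite linearD linearZ; apply: gen_subD => //.
  rewrite /rho /= wmapE; apply: gen_sub_in; exists c, (map levi w); split=> //.
  by move=> g /mapP[h _ ->]; apply: levi_is.
have leviE t : gen_sub (letter_rel is_levi tt) t -> gen_sub pointed_rel (at_std t).
  apply: gen_sub_map => _ [c [w [wl ->]]] /=.
  apply: gen_sub_in; right; exists c, w; split=> //.
  by rewrite linearZ /= /at_std wmapE map_id.
have gl_bdry t : bdry (@gl_rel F _ k) t -> bdry pointed_rel t.
  by apply: gen_subW => t' [gt|dt]; apply: gen_sub_in; [left; left | right].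
rewrite -(subrK (at_std v) z); apply: gen_subD.
  by apply: gl_bdry; apply/bdry_sub/at_std_untwist.
have -> : at_std v = at_std (v - rho v - rho (v - rho v)) +
    at_std (rho (v - rho v)) + at_std (rho v).
  by rewrite -2![in RHS]linearD /= !subrK.
apply: gen_subD; last by apply: bdry_sub; apply: leviE; apply: rhoE.
apply: gen_subD; last by apply: bdry_sub; apply: leviE; apply: rhoE.
by apply: gl_bdry; apply: at_std_bdry; apply: levi_bdry.
Qed.

End StandardStabilizer.

(** * The differential on tuples *)

Section Rationalize.
Variable X : choiceType.

Definition to_rat (u : {freeg X / int}) : {freeg X / rat} :=
  \sum_(x <- freeg.dom u) (coeff x u)%:~R *: << x >>.

Lemma coeff_to_rat x u : coeff x (to_rat u) = (coeff x u)%:~R.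
Proof.
rewrite /to_rat raddf_sum /=; under eq_bigr => y _ do rewrite coeffZ coeffU mul1r.
have [xu|xu] := boolP (x \in freeg.dom u).
  rewrite (bigD1_seq x) ?uniq_dom //= eqxx mulr1 big1 ?addr0 // => y /negPf ->.
  by rewrite mulr0.
rewrite big1_seq => [|y /= yu]; first by rewrite coeff_outdom.
by case: eqP => [yx|]; [rewrite -yx yu in xu | rewrite mulr0].
Qed.

Lemma to_rat_is_zmod_morphism : zmod_morphism to_rat.
Proof.
by move=> u v; apply: freegP => x; rewrite coeffB !coeff_to_rat coeffB rmorphB.
Qed.
HB.instance Definition _ :=
  GRing.isZmodMorphism.Build _ _ to_rat to_rat_is_zmod_morphism.

Lemma to_ratZ n u : to_rat (n *: u) = n%:~R *: to_rat u.
Proof.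
by apply: freegP => x; rewrite coeff_to_rat !coeffZ rmorphM coeff_to_rat.
Qed.

Lemma to_rat1 x : to_rat << x >> = << x >>.
Proof.
by apply: freegP => y; rewrite coeff_to_rat !coeffU !mul1r; case: eqP.
Qed.

Lemma to_rat_inj u : to_rat u = 0 -> u = 0.
Proof.
move=> u0; apply: freegP => x; have := coeff_to_rat x u.
rewrite u0 !coeff0 => /eqP; rewrite eq_sym intr_eq0.
by move/eqP.
Qed.

End Rationalize.

Lemma to_rat_alt_bd (X Z : choiceType) N (f : 'I_N -> X -> Z) u :
  to_rat (alt_bd int f u) = alt_bd rat f (to_rat u).
Proof.
elim/freeg_ind: u => [|c x u IHu]; first by rewrite !raddf0.
rewrite !raddfD /= IHu; congr (_ + _).
rewrite [alt_bd int f (_ *: _)]linearZ /= !to_ratZ [alt_bd rat f (_ *: _)]linearZ /=.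
rewrite to_rat1 !alt_bdE; congr (_ *: _); rewrite [LHS]raddf_sum; apply: eq_bigr => i _.
by rewrite /= to_ratZ to_rat1 rmorph_sign.
Qed.

Section Rows.
Variables (F : fieldType) (N : nat).
Notation G := (GL F N).
Notation Y k := (genPosTuple F N k).
Notation M k := {freeg (seq G * Y k) / rat}.

Definition tface k (i : 'I_k.+1) (wy : seq G * Y k.+1) : seq G * Y k :=
  (wy.1, gp_face i wy.2).

Definition dh k : M k.+1 -> M k := alt_bd rat (@tface k).
HB.instance Definition _ k := GRing.Linear.copy (@dh k) (alt_bd rat (@tface k)).

Lemma dhE k w X : dh << (w, X) >> =
  \sum_(i < k.+1) (-1) ^+ i *: << (w, gp_face i X) >>.
Proof. exact: alt_bdE. Qed.

Lemma dh_wmap k u :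
  dh u = \sum_(i < k.+1) (-1) ^+ i *: wmap (fun=> id) (gp_face i) u.
Proof.
rewrite /dh alt_bd_sum; apply: eq_bigr => i _; congr (_ *: _).
by apply: eq_freeg_map => -[w X] /=; rewrite map_id.
Qed.

Lemma dh_dh k (u : M k.+2) : dh (dh u) = 0.
Proof.
apply: alt_bd_alt_bd => i j [w X] le_ij; rewrite /tface /=; congr pair.
exact: gp_faceC.
Qed.

Lemma wd_dh k (u : M k.+1) : wd (dh u) = dh (wd u).
Proof.
rewrite !dh_wmap linear_sum; apply: eq_bigr => i _.
by rewrite linearZ /= wd_wmap.
Qed.

Lemma dh_gl_act k g (u : M k.+1) : dh (gl_act g u) = gl_act g (dh u).
Proof.
apply: alt_bd_map => i [w X] /=; congr pair; apply: val_inj => /=.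
by apply/matrixP => r c; rewrite !mxE; apply: eq_bigr => l _; rewrite !mxE.
Qed.

Definition at_word k (w : seq G) : {freeg (Y k) / rat} -> M k :=
  freeg_map rat (fun X => (w, X)).
HB.instance Definition _ k w := GRing.Linear.copy (@at_word k w)
  (freeg_map rat (fun X : Y k => (w, X))).

Lemma dh_at_word k w (u : {freeg (Y k.+1) / rat}) :
  dh (at_word w u) = at_word w (alt_bd rat (@gp_face F N k) u).
Proof. exact: alt_bd_map. Qed.

(** The integral case is part of the construction of the unordered complex;
each word carries a copy of that complex with rational coefficients. *)
Lemma dh_sgn_rel k (z : M k.+1) :
  gen_sub (@sgn_rel F N k.+1) z -> gen_sub (@sgn_rel F N k) (dh z).
Proof.
apply: gen_sub_map => _ [s [u ->]] /=.
pose f : {linear M k.+1 -> M k} := @dh k \o (idfun \- (( *:%R ((-1) ^+ s)) \o col_act s)).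
rewrite -[dh _]/(f u).
elim/freeg_ind: u => [|c [w X] u IHu]; first by rewrite linear0; apply: gen_sub0.
rewrite linearD linearZ; apply: gen_subD => //.
apply: gen_subZ => [z'|]; first exact: sgn_relZ.
rewrite /f /= /col_act wmapE map_id.
pose j m : {additive {freeg (Y m) / int} -> M m} := @at_word m w \o @to_rat (Y m).
have jE m (Z : Y m) (t : 'S_m) : j m (<< Z >> - (-1) ^+ t *: << gp_perm t Z >>) =
    << (w, Z) >> - (-1) ^+ t *: << (w, gp_perm t Z) >>.
  rewrite /j /= !raddfB /= to_ratZ !to_rat1 rmorph_sign linearZ /=.
  by rewrite /at_word !freeg_mapE.
have jd m (v : {freeg (Y m.+1) / int}) : dh (j m.+1 v) = j m (gp_d F N m v).
  by rewrite /j /= dh_at_word -to_rat_alt_bd.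
rewrite -jE jd; apply: (gen_sub_map (S := @sign_rel F N k)) => [_ [Z [t ->]]|].
  rewrite -(odd_permV t) jE; apply: gen_sub_in; exists t^-1%g, << (w, Z) >>.
  by rewrite /col_act wmapE map_id.
apply: sign_rel_d; exists X, s^-1%g.
by rewrite odd_permV invgK.
Qed.

Lemma dh_tuple_rel k (z : M k.+1) :
  gen_sub (@tuple_rel F N k.+1) z -> gen_sub (@tuple_rel F N k) (dh z).
Proof.
apply: gen_sub_map => t [[g [u ->]]|st] /=.
  by rewrite linearB /= dh_gl_act; apply: gen_sub_in; left; exists g, (dh u).
have := dh_sgn_rel (gen_sub_in st); apply: gen_subW => t' ht.
by apply: gen_sub_in; right.
Qed.

(** The translate with first letter 1.  Words of positive length are permuted
freely by the group, so this is a section of the projection to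
coinvariants; the empty word has no first letter and is sent to 0. *)
Definition normalize0 k (w : seq G) (X : Y k) : M k :=
  if w is x :: _ then << (map (mulg x^-1%g) w, gp_mul x^-1%g X) >> else 0.
Definition normalize k : M k -> M k :=
  fglift (fun wy => normalize0 wy.1 wy.2).
HB.instance Definition _ k := GRing.Linear.copy (@normalize k)
  (fglift (fun wy => normalize0 wy.1 wy.2)).

Lemma normalizeE k w (X : Y k) : normalize << (w, X) >> = normalize0 w X.
Proof. exact: fglift1. Qed.

Definition length_part k (p : nat) : M k -> M k :=
  fglift (fun wy => if size wy.1 == p then << wy >> else 0 : M k).
HB.instance Definition _ k p := GRing.Linear.copy (@length_part k p)
  (fglift (fun wy => if size wy.1 == p then << wy >> else 0 : M k)).

Lemma length_partE k p w (X : Y k) :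
  length_part p << (w, X) >> = if size w == p then << (w, X) >> else 0.
Proof. exact: fglift1. Qed.

Lemma length_part_wmap k p k' f (t : Y k -> Y k') u :
  length_part p (wmap f t u) = wmap f t (length_part p u).
Proof.
suff : @length_part k' p \o wmap f t =1 wmap f t \o @length_part k p.
  by move=> /(_ u).
apply: freeg_ext => -[w X] /=; rewrite wmapE !length_partE size_map.
by case: ifP => _; rewrite ?wmapE ?raddf0.
Qed.

Lemma length_part_idem k p (u : M k) :
  length_part p (length_part p u) = length_part p u.
Proof.
suff : @length_part k p \o @length_part k p =1 @length_part k p.
  by move=> /(_ u).
apply: freeg_ext => -[w X] /=; rewrite !length_partE.
by case: ifP => wp; rewrite ?length_partE ?wp ?raddf0.
Qed.

Lemma length_part_disj k p q (u : M k) : p != q ->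
  length_part p (length_part q u) = 0.
Proof.
move=> pq; suff : @length_part k p \o @length_part k q =1 \0.
  by move=> /(_ u).
apply: freeg_ext => -[w X] /=; rewrite length_partE.
case: ifP => [/eqP wq|_]; last by rewrite raddf0.
by rewrite length_partE wq eq_sym (negPf pq).
Qed.

Lemma length_part_wd k p (u : M k) :
  length_part p (wd u) = wd (length_part p.+1 u).
Proof.
suff : @length_part k p \o @wd _ _ =1 @wd _ _ \o @length_part k p.+1.
  by move=> /(_ u).
apply: freeg_ext => -[w X] /=; rewrite length_partE wdE /wd0 linear_sum.
have sz (i : 'I_(size w)) : size (del i w) = (size w).-1.
  have iw := ltn_ord i; rewrite /del size_cat size_take size_drop iw.
  lia.
case: ifP => [/eqP wp|wp].
  rewrite wdE; apply: eq_bigr => i _.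
  have wp' : (size w).-1 == p by apply/eqP; lia.
  by rewrite linearZ /= length_partE sz wp'.
rewrite raddf0 big1 // => i _; rewrite linearZ /= length_partE sz.
suff -> : ((size w).-1 == p) = false by rewrite scaler0.
by have iw := ltn_ord i; apply/eqP => e; case/eqP: wp; lia.
Qed.

Lemma length_part_dh k p (u : M k.+1) :
  length_part p (dh u) = dh (length_part p u).
Proof.
rewrite !dh_wmap linear_sum; apply: eq_bigr => i _.
by rewrite linearZ /= length_part_wmap.
Qed.

Lemma length_part_rel k p (z : M k) :
  gen_sub (@tuple_rel F N k) z -> gen_sub (@tuple_rel F N k) (length_part p z).
Proof.
apply: gen_sub_map => _ [[g [u ->]]|[s [u ->]]] /=; apply: gen_sub_in.
  by left; exists g, (length_part p u); rewrite linearB /= length_part_wmap.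
right; exists s, (length_part p u).
by rewrite linearB /= linearZ /= /col_act length_part_wmap.
Qed.

Lemma normalize_rel k (z : M k) :
  gen_sub (@gl_rel F N k) (z - length_part 0 z - normalize z).
Proof.
pose f : {linear M k -> M k} := idfun \- length_part 0 \- @normalize k.
rewrite -[_ - _]/(f z).
elim/freeg_ind: z => [|c [w X] u IHu]; first by rewrite linear0; apply: gen_sub0.
rewrite linearD linearZ; apply: gen_subD => //.
apply: gen_subZ => [z|]; first exact: gl_relZ.
rewrite /f /=; case: w => [|x w].
  by rewrite length_partE normalizeE subrr subr0; apply: gen_sub0.
have -> : length_part 0 << (x :: w, X) >> = 0 by rewrite length_partE.
rewrite subr0 normalizeE /normalize0.
rewrite -(wmapE (fun=> mulg x^-1%g) (gp_mul x^-1%g) (x :: w) X).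
exact: (@diag_relE _ _ _ (fun g => mulg g) (fun g => gp_mul g)).
Qed.

Lemma normalize_dh k (u : M k.+1) : normalize (dh u) = dh (normalize u).
Proof.
suff : @normalize k \o @dh k =1 @dh k \o @normalize k.+1 by move=> /(_ u).
apply: freeg_ext => -[w X] /=; rewrite normalizeE dhE linear_sum.
case: w => [|x w] /=.
  rewrite raddf0 big1 // => i _.
  by rewrite linearZ /= normalizeE scaler0.
rewrite dhE; apply: eq_bigr => i _; rewrite linearZ /= normalizeE /=.
congr (_ *: << (_, _) >>); apply: val_inj => /=.
by apply/matrixP => r c; rewrite !mxE; apply: eq_bigr => l _; rewrite !mxE.
Qed.

Lemma normalize_gl_act k g (u : M k) : normalize (gl_act g u) = normalize u.
Proof.
suff : @normalize k \o gl_act g =1 @normalize k by move=> /(_ u).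
apply: freeg_ext => -[w X] /=; rewrite /gl_act wmapE !normalizeE.
case: w => //= x w; rewrite -gp_mulM invMg mulgKV -map_comp.
rewrite mulgA mulgKV; congr << (_ :: _, _) >>.
by apply: eq_map => y /=; rewrite mulgA mulgKV.
Qed.

Lemma normalize_col_act k s (u : M k) :
  normalize (col_act s u) = col_act s (normalize u).
Proof.
suff : @normalize k \o col_act s =1 col_act s \o @normalize k by move=> /(_ u).
apply: freeg_ext => -[w X] /=; rewrite /col_act wmapE map_id !normalizeE.
case: w => [|x w] /=; first by rewrite raddf0.
by rewrite wmapE map_id gp_perm_mul.
Qed.

Lemma normalize_tuple_rel k (z : M k) : gen_sub (@tuple_rel F N k) z ->
  gen_sub (@sgn_rel F N k) (normalize z).
Proof.
apply: gen_sub_map => _ [[g [u ->]]|[s [u ->]]] /=; rewrite linearB /=.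
  by rewrite normalize_gl_act subrr; apply: gen_sub0.
by rewrite linearZ /= normalize_col_act; apply: gen_sub_in; exists s, (normalize u).
Qed.

End Rows.

(** * Generic vectors and the rows *)

Section GenericVector.
Variable F : fieldType.
Hypothesis F_inf : forall s : seq F, exists a, a \notin s.

Lemma uniq_seq_ex n : exists2 s : seq F, uniq s & size s = n.
Proof.
elim: n => [|n [s us ss]]; first by exists [::].
by have [a as_] := F_inf s; exists (a :: s); rewrite /= ?as_ ?us ?ss.
Qed.

Lemma nonroot_ex (p : {poly F}) : p != 0 -> exists t, p.[t] != 0.
Proof.
move=> p0; have [s us ss] := uniq_seq_ex (size p).
have [/allP rs|/allPn[t _ nt]] := boolP (all (root p) s); last by exists t.
by have := max_poly_roots p0 (introT allP rs) us; rewrite ss ltnn.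
Qed.

Definition moment N (t : F) : 'cV[F]_N := \col_i t ^+ i.

Lemma moment_rVpoly N (a : 'rV[F]_N) t : (a *m moment N t) 0 0 = (rVpoly a).[t].
Proof.
rewrite mxE horner_poly; apply: eq_bigr => i _.
by rewrite mxE insubT // => lt_i; congr (a _ _ * _); apply: val_inj.
Qed.

(** Fewer than N vectors span a proper subspace. *)
Lemma annihilator_ex N k (X : 'M[F]_(N, k)) (S : {set 'I_k}) : (#|S| < N)%N ->
  exists2 a : 'rV_N, a != 0 & forall j, j \in S -> a *m col j X = 0.
Proof.
move=> SN; pose B : 'M_(N, #|S|) := colsub (fun i => enum_val i) X.
have kB : kermx B != 0.
  rewrite kermx_eq0 /row_free neq_ltn (leq_ltn_trans _ SN) //.
  exact: rank_leq_col.
exists (nz_row (kermx B)); first by rewrite nz_row_eq0.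
move=> j jS; have := mulmx_ker B; have /submxP[D ->] := nz_row_sub (kermx B).
move=> kB0; rewrite -mulmxA (_ : kermx B *m col j X = 0) ?mulmx0 //.
rewrite (_ : col j X = col (enum_rank_in jS j) B).
  by rewrite !colE mulmxA kB0 mul0mx.
by apply/colP => i; rewrite !mxE enum_rankK_in.
Qed.

Definition vcons N k (v : 'cV[F]_N) (X : 'M[F]_(N, k)) : 'M_(N, k.+1) :=
  \matrix_(i, j) (if unlift ord0 j is Some j' then X i j' else v i 0).

Lemma vcons_mul N k v (X : 'M[F]_(N, k)) (c : 'cV_k.+1) :
  vcons v X *m c = c ord0 0 *: v + X *m \col_j c (lift ord0 j) 0.
Proof.
apply/colP => i; rewrite !mxE big_ord_recl !mxE unlift_none mulrC.
by congr (_ + _); apply: eq_bigr => j _; rewrite !mxE liftK.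
Qed.

(** A sparse relation that involves v would put v in the span of fewer than N
of the other vectors. *)
Lemma vcons_gen_pos N k v (X : 'M[F]_(N, k)) : gen_pos X ->
  (forall S : {set 'I_k}, (#|S| < N)%N -> exists2 a : 'rV_N,
     forall j, j \in S -> a *m col j X = 0 & a *m v != 0) ->
  gen_pos (vcons v X).
Proof.
move=> gX gv; apply/gen_pos_sparse => c cs; rewrite vcons_mul.
set c' := \col_j _ => vc.
have le_c' : (#|supp c'| <= #|supp c :\ ord0|)%N.
  rewrite -(card_imset _ (@lift_inj _ ord0)); apply: subset_leq_card.
  apply/fintype.subsetP => _ /imsetP[j jc ->].
  by move: jc; rewrite !inE mxE => ->; rewrite andbT eq_sym neq_lift.
have c0 : c ord0 0 = 0.
  apply/eqP/negPn/negP => c0; move: le_c'; have := cardsD1 ord0 (supp c).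
  rewrite inE c0 /= add1n => csE; rewrite -ltnS -csE => lt_c'.
  have [|a aS /negP av] := gv (supp c').
    by apply: leq_trans lt_c' _; apply: leq_trans cs _; apply: geq_minl.
  apply: av; have /(congr1 (mulmx a)) := vc.
  rewrite mulmxDr mulmx0 -scalemxAr [X in _ + X](_ : _ = 0) ?addr0.
    by move/eqP; rewrite scaler_eq0 (negPf c0).
  rewrite [Z in a *m Z]mulmx_cols mulmx_sumr big1 // => j _; rewrite -scalemxAr.
  have [/aS ->|] := boolP (j \in supp c'); first by rewrite scaler0.
  by rewrite inE negbK => /eqP ->; rewrite scale0r.
have c'0 : c' = 0.
  move/gen_pos_sparse: gX; apply; last by rewrite c0 scale0r add0r in vc.
  rewrite leq_min (leq_trans (leq_trans le_c' (subset_leq_card (subD1set _ _)))).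
    by rewrite /= (leq_trans (max_card _)) // card_ord.
  by apply: leq_trans cs _; apply: geq_minl.
apply/colP => i; rewrite [RHS]mxE; case: (unliftP ord0 i) => [j|] -> //.
by have /colP/(_ j) := c'0; rewrite !mxE.
Qed.

(** A linear form becomes a nonzero polynomial on the moment curve, and over
an infinite field finitely many nonzero polynomials have a common
nonroot. *)
Lemma generic_vector_ex N k (Xs : seq (genPosTuple F N k)) :
  exists v, forall X, X \in Xs -> gen_pos (vcons v (gp_mx X)).
Proof.
pose a X (S : {set 'I_k}) : 'rV_N := if pselect (#|S| < N)%N is left SN
  then s2val (cid2 (@annihilator_ex N k (gp_mx X) S SN)) else 0.
have a0 X (S : {set 'I_k}) : (#|S| < N)%N -> a X S != 0.
  by rewrite /a; case: pselect => // SN _; case: cid2.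
have aS X (S : {set 'I_k}) j : j \in S -> a X S *m col j (gp_mx X) = 0.
  rewrite /a; case: pselect => [SN|_] jS; last by rewrite mul0mx.
  by case: cid2 => b _ /=; apply.
pose p := \prod_(X <- Xs) \prod_(S : {set 'I_k} | (#|S| < N)%N) rVpoly (a X S).
have [|t pt] := @nonroot_ex p.
  rewrite prodf_seq_neq0; apply/allP => X _ /=.
  apply/prodf_neq0 => S SN; have aXS := a0 X S SN.
  by apply: contra aXS => /eqP e; rewrite -[a X S]rVpolyK e linear0.
exists (moment N t) => X Xs_X; apply: vcons_gen_pos (gp_gen_pos X) _ => S SN.
exists (a X S) => [j|]; first exact: aS.
apply: contra pt => /eqP/rowP/(_ 0); rewrite moment_rVpoly mxE => e.
rewrite /p horner_prod; rewrite prodf_seq_eq0; apply/hasP; exists X => //=.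
by rewrite horner_prod (bigD1 S) //= e mul0r.
Qed.

End GenericVector.

Section Cone.
Variables (F : fieldType) (N : nat) (v : 'cV[F]_N).
Notation G := (GL F N).
Notation Y k := (genPosTuple F N k).
Notation M k := {freeg (seq G * Y k) / rat}.

Definition vgood k (X : Y k) : bool := gen_pos (vcons v (gp_mx X)).

(** Tuples that v does not extend are sent to 0, so that the cone is defined
on all chains and still respects the sign relations. *)
Definition cone0 k (w : seq G) (X : Y k) : M k.+1 :=
  if pselect (vgood X) is left gX then << (w, GenPosTuple gX) >> else 0.
Definition cone k : M k -> M k.+1 := fglift (fun wy => cone0 wy.1 wy.2).
HB.instance Definition _ k := GRing.Linear.copy (@cone k)
  (fglift (fun wy => cone0 wy.1 wy.2)).

Lemma coneE k w (X : Y k) (gX : vgood X) :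
  cone << (w, X) >> = << (w, GenPosTuple gX : Y k.+1) >>.
Proof.
rewrite /cone fglift1 /cone0 /=; case: pselect => // gX'.
by congr << (_, _) >>; apply: val_inj.
Qed.

Lemma cone_bad k w (X : Y k) : ~~ vgood X -> cone << (w, X) >> = 0.
Proof.
by rewrite /cone fglift1 /cone0 /= => /negP bX; case: pselect.
Qed.

Lemma face0_vcons k (X : Y k) (gX : vgood X) :
  gp_face ord0 (GenPosTuple gX : Y k.+1) = X.
Proof.
by apply/val_inj/matrixP => i j; rewrite /= !mxE (liftK ord0).
Qed.

Lemma faceS_vcons k (i : 'I_k.+1) (X : Y k.+1) (gX : vgood X) :
  exists gX' : vgood (gp_face i X),
    gp_face (lift ord0 i) (GenPosTuple gX : Y k.+2) = GenPosTuple gX'.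
Proof.
have E : col' (lift ord0 i) (vcons v (gp_mx X)) = vcons v (gp_mx (gp_face i X)).
  apply/matrixP => r c; rewrite !mxE; case: (unliftP ord0 c) => [c'|] ->.
    rewrite (_ : lift (lift ord0 i) (lift ord0 c') = lift ord0 (lift i c')).
      by rewrite liftK mxE.
    by apply: val_inj; rewrite /= /bump; lia.
  rewrite (_ : lift (lift ord0 i) ord0 = ord0) ?unlift_none //.
  exact: val_inj.
have gX' : vgood (gp_face i X).
  by rewrite /vgood -E; apply: (gen_pos_face (lift ord0 i) (GenPosTuple gX)).
by exists gX'; apply: val_inj; apply: E.
Qed.

Definition all_good k (z : M k) : Prop :=
  forall wy, wy \in freeg.dom z -> vgood wy.2.

Lemma dh_cone0 (z : M 0) : all_good z -> dh (cone z) = z.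
Proof.
move=> gz; apply: (@freeg_ext_dom _ _ _ (@dh F N 0 \o @cone 0) idfun).
by move=> [w X] /gz gX; rewrite /= coneE dhE big_ord1 scale1r face0_vcons.
Qed.

Lemma dh_cone k (z : M k.+1) : all_good z -> dh (cone z) = z - cone (dh z).
Proof.
move=> gz; apply: (@freeg_ext_dom _ _ _ (@dh F N k.+1 \o @cone k.+1)
  (idfun \- (@cone k \o @dh F N k))) => -[w X] /gz gX /=.
rewrite coneE dhE big_ord_recl scale1r face0_vcons; congr (_ + _).
rewrite dhE linear_sum -sumrN; apply: eq_bigr => i _.
have [gX' ->] := faceS_vcons i gX.
by rewrite linearZ /= coneE exprS mulN1r scaleNr.
Qed.

Lemma cone_col_act k (s : 'S_k) (u : M k) :
  cone (col_act s u) = col_act (lift_perm ord0 ord0 s) (cone u).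
Proof.
suff : @cone k \o col_act s =1 col_act (lift_perm ord0 ord0 s) \o @cone k.
  by move=> /(_ u).
apply: freeg_ext => -[w X] /=; rewrite /col_act wmapE map_id.
have E (t : 'S_k) (Z : Y k) : vcons v (gp_mx (gp_perm t Z)) =
    col_perm (lift_perm ord0 ord0 t) (vcons v (gp_mx Z)).
  apply/matrixP => r c; rewrite !mxE; case: (unliftP ord0 c) => [c'|] ->.
    by rewrite lift_perm_lift liftK mxE.
  by rewrite lift_perm_id unlift_none.
have gP (t : 'S_k) (Z : Y k) : vgood Z -> vgood (gp_perm t Z).
  move=> gZ; rewrite /vgood E.
  exact: (gen_pos_perm (lift_perm ord0 ord0 t) (GenPosTuple gZ)).
have [gX|bX] := boolP (vgood X).
  rewrite !coneE ?gP // => gX'; rewrite wmapE map_id; congr << (_, _) >>.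
  by apply: val_inj; rewrite /= E.
rewrite !cone_bad ?raddf0 //; apply: contra bX => /(gP s^-1%g).
rewrite -gp_permM mulVg (_ : gp_perm 1%g X = X) //.
by apply/val_inj/matrixP => r c; rewrite mxE perm1.
Qed.

Lemma cone_sgn_rel k (z : M k) :
  gen_sub (@sgn_rel F N k) z -> gen_sub (@sgn_rel F N k.+1) (cone z).
Proof.
apply: gen_sub_map => _ [s [u ->]] /=; rewrite linearB /= linearZ /= cone_col_act.
apply: gen_sub_in; exists (lift_perm ord0 ord0 s), (cone u).
by rewrite odd_lift_perm.
Qed.

End Cone.

Section RowExactness.
Variables (F : fieldType) (N : nat).
Hypothesis F_inf : forall s : seq F, exists a, a \notin s.
Notation G := (GL F N).
Notation Y k := (genPosTuple F N k).
Notation M k := {freeg (seq G * Y k) / rat}.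

Lemma good_vector_ex k (z : M k) : exists v, all_good v z.
Proof.
have [v gv] := @generic_vector_ex F F_inf N k [seq wy.2 | wy <- freeg.dom z].
by exists v => wy wz; apply/gv/map_f.
Qed.

Lemma sgn_tuple_rel k (z : M k) :
  gen_sub (@sgn_rel F N k) z -> gen_sub (@tuple_rel F N k) z.
Proof. by apply: gen_subW => t st; apply: gen_sub_in; right. Qed.

Lemma gl_tuple_rel k (z : M k) :
  gen_sub (@gl_rel F N k) z -> gen_sub (@tuple_rel F N k) z.
Proof. by apply: gen_subW => t st; apply: gen_sub_in; left. Qed.

Lemma sub_normalize k (z : M k) : length_part 0 z = 0 ->
  gen_sub (@tuple_rel F N k) (z - normalize z).
Proof. by move=> z0; have := gl_tuple_rel (normalize_rel z); rewrite z0 subr0. Qed.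

Lemma row_exact0 (z : M 0) : length_part 0 z = 0 ->
  exists y, gen_sub (@tuple_rel F N 0) (z - dh y).
Proof.
move=> z0; have [v gv] := good_vector_ex (normalize z).
by exists (cone v (normalize z)); rewrite dh_cone0 //; apply: sub_normalize.
Qed.

(** Once words are normalized, only the sign relations are left in each
word, and the cone on a vector that is generic for the tuples of z
contracts. *)
Lemma row_exact k (z : M k.+1) : length_part 0 z = 0 ->
  gen_sub (@tuple_rel F N k) (dh z) ->
  exists y, gen_sub (@tuple_rel F N k.+1) (z - dh y).
Proof.
move=> z0 dz; have [v gv] := good_vector_ex (normalize z).
exists (cone v (normalize z)); rewrite dh_cone // opprB addrCA addrC.
apply: gen_subD; first exact: sub_normalize.
apply/sgn_tuple_rel/cone_sgn_rel.
by rewrite -normalize_dh; apply: normalize_tuple_rel.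
Qed.

End RowExactness.

(** * The rows and columns of the bicomplex *)

Section FullRelations.
Variables (F : fieldType) (N : nat).
Notation G := (GL F N).
Notation Y k := (genPosTuple F N k).
Notation M k := {freeg (seq G * Y k) / rat}.
Variables (H : G -> Prop) (e : Y 1).

(** These relations are the chains of a subgroup H, with the coefficient
fixed by H: they turn column 0 into the relative complex of H, and column 1 into
an acyclic complex if H has the homology of the stabilizer of e. *)
Definition base_rel k : M k -> Prop :=
  match k return M k -> Prop with
  | 0 => letter_rel H (gp_face ord0 e)
  | 1 => letter_rel H e
  | _ => fun=> False
  end.

Definition full_rel k (z : M k) : Prop := tuple_rel z \/ base_rel z.

Lemma full_tuple k (z : M k) :
  gen_sub (@tuple_rel F N k) z -> gen_sub (@full_rel k) z.
Proof. by apply: gen_subW => t zt; apply: gen_sub_in; left. Qed.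

Lemma full_base k (z : M k) :
  gen_sub (@base_rel k) z -> gen_sub (@full_rel k) z.
Proof. by apply: gen_subW => t zt; apply: gen_sub_in; right. Qed.

Lemma tuple_full k (z : M k.+2) :
  gen_sub (@full_rel k.+2) z -> gen_sub (@tuple_rel F N k.+2) z.
Proof. by apply: gen_subW => t [zt|[]]; apply: gen_sub_in. Qed.

Lemma dh_letter_rel (z : M 1) :
  gen_sub (letter_rel H e) z ->
  gen_sub (letter_rel H (gp_face ord0 e)) (dh z).
Proof.
apply: gen_sub_map => _ [c [w [wH ->]]] /=; apply: gen_sub_in; exists c, w.
by split=> //; rewrite linearZ /= dhE big_ord1 scale1r.
Qed.

Lemma dh_full k (z : M k.+1) :
  gen_sub (@full_rel k.+1) z -> gen_sub (@full_rel k) (dh z).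
Proof.
apply: gen_sub_map => t [tt|bt] /=; first exact/full_tuple/dh_tuple_rel/gen_sub_in.
apply: full_base; case: k t bt {z} => [|k] //= t bt.
by apply: dh_letter_rel; apply: gen_sub_in.
Qed.

Lemma wd_full k (z : M k) :
  gen_sub (@full_rel k) z -> gen_sub (@full_rel k) (wd z).
Proof.
apply: gen_sub_map => t [tt|bt] /=; first exact/full_tuple/wd_tuple_rel/gen_sub_in.
apply: full_base; case: k t bt {z} => [|[|k]] //= t bt;
  by apply: wd_letter_rel; apply: gen_sub_in.
Qed.

Lemma length_part_letter k (y : Y k) p (z : M k) :
  gen_sub (letter_rel H y) z -> gen_sub (letter_rel H y) (length_part p z).
Proof.
apply: gen_sub_map => _ [c [w [wH ->]]] /=; rewrite linearZ /= length_partE.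
case: ifP => _; last by rewrite scaler0; apply: gen_sub0.
by apply: gen_sub_in; exists c, w.
Qed.

Lemma length_part_full k p (z : M k) :
  gen_sub (@full_rel k) z -> gen_sub (@full_rel k) (length_part p z).
Proof.
apply: gen_sub_map => t [tt|bt] /=.
  exact/full_tuple/length_part_rel/gen_sub_in.
apply: full_base; case: k t bt {z} => [|[|k]] //= t bt;
  by apply: length_part_letter; apply: gen_sub_in.
Qed.

Hypothesis F_inf : forall s : seq F, exists a, a \notin s.
Hypothesis He : forall g, H g -> gp_mul g e = e.

Lemma full_row0 (z : M 0) : length_part 0 z = 0 ->
  exists y, gen_sub (@full_rel 0) (z - dh y).
Proof. by move/(row_exact0 F_inf) => [y zy]; exists y; apply: full_tuple. Qed.

Lemma lift_base (t : M 0) : gen_sub (@full_rel 0) t ->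
  exists2 h, gen_sub (letter_rel H e) h & gen_sub (@tuple_rel F N 0) (t - dh h).
Proof.
elim=> [|x [tx|[c [w [wH ->]]]]|x y _ [h hh xh] _ [h' hh' yh']].
- by exists 0; [|rewrite [dh 0]raddf0 subr0]; apply: gen_sub0.
- exists 0; first exact: gen_sub0.
  by rewrite [dh 0]raddf0 subr0; apply: gen_sub_in.
- exists (c *: << (w, e) >>); first by apply: gen_sub_in; exists c, w.
  rewrite linearZ /= dhE big_ord1 scale1r subrr; exact: gen_sub0.
exists (h - h'); first exact: gen_subB.
rewrite linearB /= opprB addrA (ACl (1*4*(3*2))) /= -[_ - y]opprB.
exact: gen_subB.
Qed.

Lemma full_row1 (z : M 1) : length_part 0 z = 0 -> gen_sub (@full_rel 0) (dh z) ->
  exists y, gen_sub (@full_rel 1) (z - dh y).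
Proof.
move=> z0 /lift_base[h hh dzh]; pose h' := h - length_part 0 h.
have hh' : gen_sub (letter_rel H e) h'.
  by apply: gen_subB => //; apply: length_part_letter.
have zh0 : length_part 0 (z - h') = 0.
  have h'0 : length_part 0 h' = 0 by rewrite linearB /= length_part_idem subrr.
  by rewrite linearB /= z0 h'0 subrr.
have dzh' : gen_sub (@tuple_rel F N 0) (dh (z - h')).
  have -> : dh (z - h') = (dh z - dh h) - length_part 0 (dh z - dh h).
    have dz0 : length_part 0 (dh z) = 0 by rewrite length_part_dh z0 raddf0.
    rewrite [dh (z - h')]linearB /= [dh h']linearB /= -length_part_dh.
    rewrite [length_part 0 (_ - _)]linearB /= dz0 sub0r opprK opprB.
    by rewrite addrA addrAC.
  by apply: gen_subB => //; apply: length_part_rel.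
have [y zy] := row_exact F_inf zh0 dzh'; exists y.
have -> : z - dh y = (z - h' - dh y) + h' by rewrite addrAC subrK.
by apply: gen_subD; [apply: full_tuple | apply: full_base].
Qed.

Lemma sgn_rel_small k (z : M k) : (k <= 1)%N -> gen_sub (@sgn_rel F N k) z -> z = 0.
Proof.
move=> k1; elim=> [|_ [s [u ->]]|x y _ -> _ ->] //; last by rewrite subrr.
have -> : s = 1%g.
  apply/permP => i; rewrite perm1; apply: val_inj => /=.
  by have := ltn_ord (s i); have := ltn_ord i; lia.
rewrite odd_perm1 expr0 scale1r /col_act -[X in X - _]wmap_id.
apply/eqP; rewrite subr_eq0; apply/eqP/eq_wmap => // X.
by apply/val_inj/matrixP => i j; rewrite /= !mxE perm1.
Qed.

Lemma normalize_base (h : M 1) : gen_sub (letter_rel H e) h ->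
  normalize h = wmap (fun=> id) (fun=> e) (normalize (dh h)).
Proof.
elim=> [|_ [c [w [wH ->]]]|x y _ ex _ ey].
- by rewrite !raddf0.
- rewrite [dh _]linearZ /= dhE big_ord1 scale1r !linearZ /= !normalizeE; congr (_ *: _).
  case: w wH => [|x w] wH /=; first by rewrite raddf0.
  rewrite wmapE map_id -[in LHS](He (wH x (mem_head _ _))).
  by rewrite -gp_mulM mulVg gp_mul1.
by rewrite !linearB /= ex ey.
Qed.

(** The relations added in degree 1 do not meet the image of degree 2: on
normalized words they are determined by their image in degree 0, which
vanishes. *)
Lemma full_row2 (z : M 2) : length_part 0 z = 0 -> gen_sub (@full_rel 1) (dh z) ->
  exists y, gen_sub (@full_rel 2) (z - dh y).
Proof.
move=> z0 /gen_sub_split[a [h [ta hh dzE]]].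
(* The part h of the boundary of z vanishes once it is normalized. *)
have h0 : normalize h = 0.
  rewrite normalize_base // (_ : normalize (dh h) = 0) ?raddf0 //.
  apply: (@sgn_rel_small 0) => //; apply: normalize_tuple_rel.
  have -> : dh h = - dh a.
    by apply/eqP; rewrite -addr_eq0 addrC -linearD /= -dzE dh_dh.
  exact/gen_subN/dh_tuple_rel.
have dz : gen_sub (@tuple_rel F N 1) (dh z).
  have -> : dh z = (a - length_part 0 a) + (h - length_part 0 h).
    by rewrite addrACA -opprD -linearD /= -dzE length_part_dh z0 raddf0 subr0.
  apply: gen_subD; first by apply: gen_subB => //; apply: length_part_rel.
  by have := gl_tuple_rel (normalize_rel h); rewrite h0 subr0.
by have [y zy] := row_exact F_inf z0 dz; exists y; apply: full_tuple.
Qed.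

Lemma full_rowS k (z : M k.+1) : length_part 0 z = 0 ->
  gen_sub (@full_rel k) (dh z) -> exists y, gen_sub (@full_rel k.+1) (z - dh y).
Proof.
case: k z => [|[|k]] z; [exact: full_row1 | exact: full_row2 |].
move=> z0 /tuple_full dz; have [y zy] := row_exact F_inf z0 dz.
by exists y; apply: full_tuple.
Qed.

End FullRelations.

Section Columns.
Variable F : fieldType.
Hypothesis F_inf : forall s : seq F, exists a, a \notin s.

Lemma tuple_column N k (z : {freeg (seq (GL F N) * genPosTuple F N k.+2) / rat}) :
  gen_sub (@tuple_rel F N k.+2) (wd z) -> bdry (@tuple_rel F N k.+2) z.
Proof.
have [/long_column|/ltnW kN] := leqP N k.+2; first exact.
have E : N = (N - k.+2 + k.+2)%N by rewrite subnK.
by move: (N - k.+2)%N E => l E; move: z; rewrite E => z; apply: short_column.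
Qed.

End Columns.

(** * Isomorphisms of subquotients and the balancing of a bicomplex *)

Section Correspondence.

(** An additive relation R that induces an isomorphism from Z/B onto
Z'/B'.  Relations, unlike maps, compose and invert without choices; so a
zigzag of lifts yields an isomorphism. *)
Definition corr (A A' : zmodType) (Z B : A -> Prop) (Z' B' : A' -> Prop) : Prop :=
  exists R : A -> A' -> Prop,
  [/\ forall a b a' b', R a a' -> R b b' -> R (a - b) (a' - b'),
      forall a a', R a a' -> Z a /\ Z' a',
      forall a, Z a -> exists a', R a a',
      forall a', Z' a' -> exists a, R a a' &
      forall a a', R a a' -> (B a <-> B' a')].

Definition all_of (A : zmodType) (x : A) := True.
Definition zero_of (A : zmodType) (x : A) := x = 0.

Lemma corr_sym (A A' : zmodType) (Z B : A -> Prop) (Z' B' : A' -> Prop) :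
  corr Z B Z' B' -> corr Z' B' Z B.
Proof.
move=> [R [Rsub RZ RT RT' RB]]; exists (fun a' a => R a a').
split=> // [a a' b b'|a' a /RZ[]|a' a /RB[]]; [exact: Rsub | by [] | by split].
Qed.

Lemma corr_trans (A1 A2 A3 : zmodType) (Z1 B1 : A1 -> Prop)
    (Z2 B2 : A2 -> Prop) (Z3 B3 : A3 -> Prop) :
  corr Z1 B1 Z2 B2 -> corr Z2 B2 Z3 B3 -> corr Z1 B1 Z3 B3.
Proof.
move=> [R [Rsub RZ RT RT' RB]] [T [Tsub TZ TT TT' TB]].
exists (fun a c => exists2 b, R a b & T b c); split.
- move=> a b a' b' [x ax xa'] [y by_ yb']; exists (x - y).
    exact: Rsub.
  exact: Tsub.
- by move=> a c [b /RZ[? _] /TZ[_ ?]].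
- move=> a /RT[b ab]; have [_ /TT[c bc]] := RZ _ _ ab.
  by exists c; exists b.
- move=> c /TT'[b bc]; have [/RT'[a ab] _] := TZ _ _ bc.
  by exists a; exists b.
- by move=> a c [b /RB h1 /TB h2]; rewrite h1 h2.
Qed.

Lemma corr_iso (A A' : zmodType) :
  corr (@all_of A) (@zero_of A) (@all_of A') (@zero_of A') -> zmod_isomorphic A A'.
Proof.
move=> [R [Rsub RZ RT RT' RB]].
have R_fun a b b' : R a b -> R a b' -> b = b'.
  move=> ab ab'; apply/eqP; rewrite -subr_eq0; apply/eqP.
  by have /RB[+ _] := Rsub _ _ _ _ ab ab'; apply; rewrite /zero_of subrr.
have R_inj a a' b : R a b -> R a' b -> a = a'.
  move=> ab a'b; apply/eqP; rewrite -subr_eq0; apply/eqP.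
  by have /RB[_] := Rsub _ _ _ _ ab a'b; apply; rewrite /zero_of subrr.
pose f a := projT1 (cid (RT a I)); pose g b := projT1 (cid (RT' b I)).
have fR a : R a (f a) by rewrite /f; case: cid.
have gR b : R (g b) b by rewrite /g; case: cid.
have f_add : zmod_morphism f.
  by move=> x y; apply: R_fun (fR _) _; apply: Rsub.
pose fA : {additive A -> A'} := HB.pack f (GRing.isZmodMorphism.Build _ _ f f_add).
exists fA; exists g => [a|b] /=; first exact: R_inj (gR _) (fR a).
exact: R_fun (fR _) (gR b).
Qed.

Lemma corr_ext (A A' : zmodType) (Z B B1 : A -> Prop) (Z' B' B1' : A' -> Prop) :
  (forall x, Z x -> B x <-> B1 x) -> (forall x, Z' x -> B' x <-> B1' x) ->
  corr Z B Z' B' -> corr Z B1 Z' B1'.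
Proof.
move=> BE BE' [R [Rsub RZ RT RT' RB]]; exists R; split=> // a a' aa'.
by have [/BE <- /BE' <-] := RZ _ _ aa'; apply: RB.
Qed.

Lemma corr_refl (A : zmodType) (Z B : A -> Prop) :
  (forall x y, Z x -> Z y -> Z (x - y)) -> corr Z B Z B.
Proof.
move=> Zsub; exists (fun x y => x = y /\ Z x); split.
- by move=> a b _ _ [<- Za] [<- Zb]; split=> //; apply: Zsub.
- by move=> a _ [<-].
- by move=> a Za; exists a.
- by move=> a Za; exists a.
- by move=> a _ [<-].
Qed.

(** Passage from a subquotient of A' to one of A by lifting along f. *)
Lemma corr_lift (A A' : zmodType) (f : {additive A -> A'}) (Z B : A -> Prop)
    (Z' B' : A' -> Prop) :
  (forall x y, Z' x -> Z' y -> Z' (x - y)) ->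
  (forall y, exists x, y = f x) ->
  (forall x, Z x <-> Z' (f x)) -> (forall x, Z x -> B x <-> B' (f x)) ->
  corr Z B Z' B'.
Proof.
move=> Zsub f_surj ZE BE; exists (fun x y => y = f x /\ Z x); split.
- move=> a b _ _ [-> Za] [-> Zb]; rewrite raddfB; split=> //.
  by apply/ZE; rewrite raddfB; apply: Zsub; apply/ZE.
- by move=> a _ [-> Za]; split=> //; apply/ZE.
- by move=> a Za; exists (f a).
- by move=> a' Za'; have [x e] := f_surj a'; exists x; rewrite ZE -e.
- by move=> a _ [-> /BE].
Qed.

Lemma homology_corr (C : chainComplex) k :
  corr (fun x : C k => x \in @cycle_pred C k) (fun x => exists y, x = cc_d C k y)
       (@all_of (homology_nat C k)) (@zero_of (homology_nat C k)).
Proof.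
pose S := fun z : cycles C k => exists y : C k.+1, cycle_val z = cc_d C k y.
have genS z : gen_sub S z -> S z.
  elim=> [|//|x y _ [x' xE] _ [y' yE]]; first by exists 0; rewrite raddf0.
  by exists (x' - y'); rewrite raddfB -xE -yE.
apply: (@corr_trans _ _ _ _ _ (@all_of (cycles C k)) S); last first.
  apply: (@corr_lift _ _ (quo_pi S)) => // [y|z _]; first exact: quo_piP.
  rewrite /zero_of -(raddf0 (quo_pi S)); split=> [Sz|/quo_pi_eq].
    by apply/quo_pi_eq; rewrite subr0; apply: gen_sub_in.
  by rewrite subr0 => /genS.
apply: corr_sym.
exists (fun (z : cycles C k) x => x = cycle_val z); split=> //.
- by move=> a b _ _ -> ->.
- by move=> z _ ->; split=> //; case: z.
- by move=> z _; exists (cycle_val z).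
- by move=> x Zx; exists (Cycle Zx).
- by move=> z _ ->.
Qed.

Lemma zero_iso (A B : zmodType) :
  (forall x : A, x = 0) -> (forall x : B, x = 0) -> zmod_isomorphic A B.
Proof.
move=> A0 B0; apply: corr_iso; exists (fun _ _ => True); split=> //.
- by exists 0.
- by exists 0.
- by move=> a b _; rewrite /zero_of (A0 a) (B0 b).
Qed.

Lemma corr_natmul (A A' : zmodType) (R : A -> A' -> Prop) a a' n :
  (forall a b a' b', R a a' -> R b b' -> R (a - b) (a' - b')) ->
  R a a' -> R (a *+ n) (a' *+ n).
Proof.
move=> Rsub aa'; have R0 : R 0 0 by have := Rsub _ _ _ _ aa' aa'; rewrite !subrr.
elim: n => [|n IHn]; first by rewrite !mulr0n.
have := Rsub _ _ _ _ IHn (Rsub _ _ _ _ R0 aa').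
by rewrite !sub0r !opprK -!mulrSr.
Qed.

End Correspondence.

(** In this section the rows are exact in the positive degrees p, the
columns are exact for k >= 1, and everything is meant modulo the subgroups
generated by S; lp k p projects to the component of degree p. *)
Section Balancing.
Variables (M : nat -> zmodType) (S : forall k, M k -> Prop).
Variables (dh : forall k, {additive M k.+1 -> M k}).
Variables (dv : forall k, {additive M k -> M k}).
Variables (lp : forall k, nat -> {additive M k -> M k}).
Notation N k := (gen_sub (@S k)).
Hypothesis dh_N : forall k x, N k.+1 x -> N k (dh k x).
Hypothesis dv_N : forall k x, N k x -> N k (dv k x).
Hypothesis lp_N : forall k p x, N k x -> N k (lp k p x).
Hypothesis dh_dh : forall k x, dh k (dh k.+1 x) = 0.
Hypothesis dv_dv : forall k x, dv k (dv k x) = 0.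
Hypothesis dv_dh : forall k x, dv k (dh k x) = dh k (dv k.+1 x).
Hypothesis lp_dv : forall k p x, lp k p (dv k x) = dv k (lp k p.+1 x).
Hypothesis dv_lp0 : forall k x, dv k (lp k 0 x) = 0.
Hypothesis lp_dh : forall k p x, lp k p (dh k x) = dh k (lp k.+1 p x).
Hypothesis lp_idem : forall k p x, lp k p (lp k p x) = lp k p x.
Hypothesis lp0S : forall k p x, lp k 0 (lp k p.+1 x) = 0.
Hypothesis row0 : forall x, lp 0 0 x = 0 -> exists y, N 0 (x - dh 0 y).
Hypothesis rowS : forall k x, lp k.+1 0 x = 0 -> N k (dh k x) ->
  exists y, N k.+1 (x - dh k.+1 y).
Hypothesis column : forall k x, N k.+1 (dv k.+1 x) ->
  exists y, N k.+1 (x - dv k.+1 y).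

Definition row_cycle k : M k -> Prop :=
  match k with 0 => fun=> True | k'.+1 => fun x => N k' (dh k' x) end.

Definition bicycle k p (x : M k) : Prop :=
  [/\ lp k p x = x, N k (dv k x) & row_cycle x].

Definition biboundary k (x : M k) : Prop :=
  exists w : M k.+1, N k (x - dv k (dh k w)).

Lemma row_cycleB k (x y : M k) : row_cycle x -> row_cycle y -> row_cycle (x - y).
Proof. by case: k x y => //= k x y; rewrite raddfB; apply: gen_subB. Qed.

Lemma row_exact_at k (x : M k) : lp k 0 x = 0 -> row_cycle x ->
  exists y, N k (x - dh k y).
Proof. by case: k x => [|k] x x0 dx; [apply: row0 | apply: rowS]. Qed.

Lemma dh_row_cycle k (x : M k.+1) : row_cycle (dh k x).
Proof. by case: k x => //= k x; rewrite dh_dh; apply: gen_sub0. Qed.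

(** One step of the diagram chase: y lies on the antidiagonal above, its
horizontal boundary is x and its vertical boundary is x'.  On each
antidiagonal the cycles for both differentials are taken modulo the images of
the composite of both, which makes the step symmetric. *)
Lemma zigzag k p :
  corr (@bicycle k p.+1) (@biboundary k) (@bicycle k.+1 p) (@biboundary k.+1).
Proof.
exists (fun x x' => [/\ bicycle p.+1 x, bicycle p x' & exists y,
  [/\ lp k.+1 p.+1 y = y, N k (x - dh k y) & N k.+1 (x' - dv k.+1 y)]]); split.
- move=> a b a' b' [[la va ha] [la' va' ha'] [y [ly ya ya']]].
  move=> [[lb vb hb] [lb' vb' hb'] [z [lz zb zb']]]; split.
  + by split; rewrite ?raddfB ?la ?lb //; [apply: gen_subB | apply: row_cycleB].
  + split; rewrite ?raddfB ?la' ?lb' //; first exact: gen_subB.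
    by apply: (@row_cycleB k.+1).
  + exists (y - z); rewrite raddfB ly lz; split=> //.
      by rewrite [dh k _]raddfB subrACA; apply: gen_subB.
    by rewrite [dv _ _]raddfB subrACA; apply: gen_subB.
- by move=> a a' [].
- move=> x [lx vx hx].
  have [|y0 xy0] := @row_exact_at k x _ hx; first by rewrite -lx lp0S.
  pose y := lp k.+1 p.+1 y0.
  have xy : N k (x - dh k y).
    by have := lp_N p.+1 xy0; rewrite raddfB lx lp_dh.
  exists (dv k.+1 y); split=> //; last first.
    by exists y; rewrite lp_idem subrr; split=> //; apply: gen_sub0.
  split; rewrite ?lp_dv ?lp_idem ?dv_dv //; first exact: gen_sub0.
  rewrite /= -dv_dh; apply: gen_subK vx.
  by rewrite -raddfB; apply: dv_N.
- move=> x' [lx vx hx]; have [y0 xy0] := column vx.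
  pose y := lp k.+1 p.+1 y0.
  have xy : N k.+1 (x' - dv k.+1 y).
    by have := lp_N p xy0; rewrite raddfB lx lp_dv.
  exists (dh k y); split=> //; last first.
    by exists y; rewrite lp_idem subrr; split=> //; apply: gen_sub0.
  split; rewrite ?lp_dh ?lp_idem //; last exact: dh_row_cycle.
  rewrite dv_dh; apply: gen_subK hx.
  by rewrite -raddfB; apply: dh_N.
- move=> x x' [[lx _ _] [lx' _ _] [y [ly xy xy']]]; split=> [[w0 xw0]|[w xw]].
    pose w := lp k.+1 p.+2 w0.
    have xw : N k (x - dv k (dh k w)).
      by have := lp_N p.+1 xw0; rewrite raddfB lx lp_dv lp_dh.
    have yw0 : lp k.+1 0 (y - dv k.+1 w) = 0.
      by rewrite raddfB -ly lp0S /w -lp_dv lp0S subrr.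
    have [|u yu] := @rowS k _ yw0.
      rewrite raddfB -dv_dh; apply: gen_sub_trans (gen_subC xy) xw.
    exists u; apply: gen_sub_trans xy' _.
    by have := dv_N yu; rewrite !raddfB /= dv_dv subr0.
  have [|u yu] := @column k (y - dh k.+1 w).
    by rewrite raddfB; apply: gen_sub_trans (gen_subC xy') xw.
  exists u; apply: gen_sub_trans xy _.
  by have := dh_N yu; rewrite !raddfB /= dh_dh subr0 dv_dh.
Qed.

Lemma zigzags m j : (j <= m)%N ->
  corr (@bicycle 0 m) (@biboundary 0) (@bicycle j (m - j)) (@biboundary j).
Proof.
elim: j => [|j IHj] jm.
  rewrite subn0; apply: corr_refl => x y [lx vx _] [ly vy _].
  by split; rewrite ?raddfB ?lx ?ly //; apply: gen_subB.
apply: corr_trans (IHj (ltnW jm)) _.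
by rewrite -[(m - j)%N]prednK ?subn_gt0 // -subnS; apply: zigzag.
Qed.

(** At the two ends of the antidiagonal the composite of the differentials
has the same image as one of them, because the other one is onto there. *)
Theorem balancing m :
  corr (@bicycle 0 m) (fun x => exists w, N 0 (x - dv 0 w))
       (@bicycle m 0) (fun x => exists w, N m (x - dh m w)).
Proof.
have := @zigzags m m (leqnn m); rewrite subnn; apply: corr_ext.
  move=> x [lx vx _]; split=> [[w xw]|[w0 xw0]]; first by exists (dh 0 w).
  pose w := lp 0 m.+1 w0.
  have xw : N 0 (x - dv 0 w) by have := lp_N m xw0; rewrite raddfB lx lp_dv.
  have [|y wy] := @row0 w; first by rewrite lp0S.
  by exists y; apply: gen_sub_trans xw _; rewrite -raddfB; apply: dv_N.
move=> x [lx vx hx]; split=> [[w xw]|[w0 xw0]].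
  by exists (dv m.+1 w); rewrite -dv_dh.
pose w := lp m.+1 0 w0.
have xw : N m (x - dh m w) by have := lp_N 0 xw0; rewrite raddfB lx lp_dh.
have [|y wy] := @column m w; first by rewrite dv_lp0; apply: gen_sub0.
by exists y; apply: gen_sub_trans xw _; rewrite dv_dh -raddfB; apply: dh_N.
Qed.

End Balancing.

(** * The bar complex as a column *)

Section BarComparison.
Variables (F : fieldType) (n : nat).
Notation G := (GL F n.+1).
Notation Y k := (genPosTuple F n.+1 k).
Notation M k := {freeg (seq G * Y k) / rat}.
Notation bar := (bar_complex rat G).
Notation rel := (rel_bar_complex rat (@GL_incl F n)).
Notation image := (@bar_image rat _ _ (@GL_incl F n)).

Definition incl_letter (g : G) : Prop := exists h, g = GL_incl h.

Variable e : Y 1.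
Notation y0 := (gp_face ord0 e).
Notation full := (gen_sub (@full_rel F n.+1 incl_letter e 0)).

Lemma empty_tuple (X X' : Y 0) : X = X'.
Proof. by apply/val_inj/matrixP => i []. Qed.

Definition steps q (w : seq G) : {ffun 'I_q -> G} :=
  [ffun i : 'I_q => ((nth 1 w i)^-1 * nth 1 w i.+1)%g].

Lemma nth_del i j (w : seq G) : (i < size w)%N ->
  nth 1%g (del i w) j = nth 1%g w (bump i j).
Proof.
move=> iw; rewrite /del nth_cat size_take iw /bump; case: (ltnP j i) => ji.
  by rewrite nth_take.
by rewrite nth_drop; congr nth; lia.
Qed.

Lemma steps_del q (i : 'I_q.+2) (w : seq G) : size w = q.+2 ->
  steps q (del i w) = bar_face i (steps q.+1 w).
Proof.
move=> sw; apply/ffunP => j; rewrite !ffunE !nth_del ?sw //=.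
have bE t : bump i t = (if (i <= t)%N then t.+1 else t).
  by rewrite /bump; case: leqP.
rewrite !bE -ltnS /bump leq0n add1n; case: ltngtP => _ //.
by rewrite mulgA mulgK.
Qed.

(** The inhomogeneous symbol of a word.  Words of length q + 1 are bar symbols
of degree q. *)
Definition to_bar q : M 0 -> bar q :=
  fglift (fun wy => if size wy.1 == q.+1 then << steps q wy.1 >> else 0 : bar q).
HB.instance Definition _ q := GRing.Linear.copy (to_bar q)
  (fglift (fun wy => if size wy.1 == q.+1 then << steps q wy.1 >> else 0 : bar q)).

Lemma to_barE q w X : to_bar q << (w, X) >> =
  if size w == q.+1 then << steps q w >> else 0.
Proof. exact: fglift1. Qed.

Lemma to_bar_wd q u : to_bar q (wd u) = bar_d rat G q (to_bar q.+1 u).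
Proof.
suff : to_bar q \o @wd _ _ =1 alt_bd rat (@bar_face G q) \o to_bar q.+1.
  by move=> /(_ u).
apply: freeg_ext => -[w X] /=; rewrite to_barE wdE /wd0 linear_sum.
have sz (i : 'I_(size w)) : size (del i w) = (size w).-1.
  have iw := ltn_ord i; rewrite /del size_cat size_take size_drop iw; lia.
case: eqP => [sw|nsw]; last first.
  rewrite raddf0 big1 // => i _; rewrite linearZ /= to_barE sz.
  suff /negPf -> : (size w).-1 != q.+1 by rewrite scaler0.
  by have iw := ltn_ord i; apply/eqP; lia.
rewrite alt_bdE.
rewrite -(big_mkord xpredT (fun i => to_bar q ((-1) ^+ i *: << (del i w, X) >>))).
rewrite sw big_mkord; apply: eq_bigr => i _; rewrite linearZ /= to_barE.
have sw_i : size (del i w) = q.+1.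
  have iw : (i < size w)%N by rewrite sw.
  by rewrite /del size_cat size_take size_drop iw; have := ltn_ord i; lia.
by rewrite sw_i eqxx (steps_del _ sw).
Qed.

Lemma to_bar_gl_act q g u : to_bar q (gl_act g u) = to_bar q u.
Proof.
suff : to_bar q \o gl_act g =1 to_bar q by move=> /(_ u).
apply: freeg_ext => -[w X] /=; rewrite /gl_act wmapE !to_barE size_map.
case: eqP => // sw; congr << _ >>; apply/ffunP => i; rewrite !ffunE.
by rewrite !(nth_map 1%g) ?sw ?ltnS ?ltn_ord ?(ltnW (ltn_ord i)) // invMg mulgA mulgKV.
Qed.

Lemma bar_image_letters q (f : {ffun 'I_q -> G}) (c : rat) :
  (forall i, incl_letter (f i)) -> gen_sub (@image q) (c *: << f >>).
Proof.
move=> fH; pose h := [ffun i => projT1 (cid (fH i))].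
apply: gen_sub_in; exists (c *: << h >>).
rewrite -[RHS]/(freeg_map rat (fun h : {ffun 'I_q -> GL F n} =>
  [ffun i => GL_incl (h i)]) (c *: << h >>)) linearZ freeg_mapE.
congr (_ *: << _ >>); apply/ffunP => i; rewrite !ffunE; by case: cid.
Qed.

Lemma to_bar_full q u : full u -> gen_sub (@image q) (to_bar q u).
Proof.
apply: gen_sub_map => t [[[g [v ->]]|st]|[c [w [wH ->]]]] /=.
- by rewrite linearB /= to_bar_gl_act subrr; apply: gen_sub0.
- by rewrite (sgn_rel_small _ (gen_sub_in st)) // raddf0; apply: gen_sub0.
rewrite linearZ /= to_barE; case: eqP => [sw|_]; last first.
  by rewrite scaler0; apply: gen_sub0.
apply: bar_image_letters => i; rewrite ffunE.
have [a aE] : incl_letter (nth 1%g w i).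
  by apply/wH/mem_nth; rewrite sw ltnW // ltnS ltn_ord.
have [b bE] : incl_letter (nth 1%g w i.+1).
  by apply/wH/mem_nth; rewrite sw ltnS ltn_ord.
exists (a^-1 * b)%g; rewrite aE bE; apply: (mulgI (GL_incl a)).
by rewrite mulKVg -GL_incl_mulfM mulKVg.
Qed.

Fixpoint partial_prod q (f : {ffun 'I_q -> G}) (i : nat) : G :=
  if i is j.+1 then
    (partial_prod f j * (if insub j is Some j' then f j' else 1))%g
  else 1%g.

(** The homogeneous word with first letter 1: a section of to_bar. *)
Definition of_bar q : bar q -> M 0 :=
  freeg_map rat (fun f : {ffun 'I_q -> G} => (mkseq (partial_prod f) q.+1, y0)).
HB.instance Definition _ q := GRing.Linear.copy (@of_bar q)
  (freeg_map rat (fun f : {ffun 'I_q -> G} => (mkseq (partial_prod f) q.+1, y0))).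

Lemma of_barE q (f : {ffun 'I_q -> G}) :
  of_bar << f >> = << (mkseq (partial_prod f) q.+1, y0) >>.
Proof. exact: freeg_mapE. Qed.

Lemma of_barK q (b : bar q) : to_bar q (of_bar b) = b.
Proof.
suff : to_bar q \o @of_bar q =1 idfun by move=> /(_ b).
apply: freeg_ext => f /=; rewrite of_barE to_barE size_mkseq eqxx; congr << _ >>.
apply/ffunP => i; rewrite ffunE !nth_mkseq ?ltnS ?(ltnW (ltn_ord i)) //=.
rewrite mulKg insubT // => ltiq; congr (f _); exact: val_inj.
Qed.

Lemma length_of_bar q (b : bar q) : length_part q.+1 (of_bar b) = of_bar b.
Proof.
suff : length_part q.+1 \o @of_bar q =1 @of_bar q by move=> /(_ b).
by apply: freeg_ext => f /=; rewrite of_barE length_partE size_mkseq eqxx.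
Qed.

Lemma partial_prod_steps q w i : size w = q.+1 -> (i <= q)%N ->
  partial_prod (steps q w) i = ((nth 1 w 0)^-1 * nth 1 w i)%g.
Proof.
move=> sw; elim: i => [|i IHi] iq /=; first by rewrite mulVg.
rewrite IHi ?(ltnW iq) // insubT ffunE /= mulgA.
by congr (_ * _)%g; rewrite mulgK.
Qed.

Lemma of_to_bar q x : length_part q.+1 x = x -> full (x - of_bar (to_bar q x)).
Proof.
move=> <-; pose f : {linear M 0 -> M 0} :=
  (idfun \- (@of_bar q \o to_bar q)) \o length_part q.+1.
rewrite -[_ - _]/(f x).
elim/freeg_ind: x => [|c [w X] x IHx]; first by rewrite linear0; apply: gen_sub0.
rewrite linearD linearZ; apply: gen_subD => //; apply: full_tuple.
apply: gen_subZ => [z|]; first exact: tuple_relZ.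
rewrite /f /= length_partE; case: eqP => [sw|_]; last first.
  by rewrite [to_bar q 0]raddf0 [of_bar 0]raddf0 subrr; apply: gen_sub0.
rewrite to_barE sw eqxx of_barE; apply: gl_tuple_rel.
pose g := (nth 1 w 0)^-1%g.
have <- : gl_act g << (w, X) >> =
    << (mkseq (partial_prod (steps q w)) q.+1, y0) >> :> M 0.
  rewrite /gl_act wmapE; congr << (_, _) >>; last exact: empty_tuple.
  apply: (@eq_from_nth _ 1%g); rewrite size_map ?size_mkseq // sw => i iq.
  by rewrite (nth_map 1%g) ?sw // nth_mkseq // partial_prod_steps.
exact: (@diag_relE _ _ _ (fun g => mulg g) (fun g => gp_mul g)).
Qed.

Lemma of_bar_image q (b : bar q) : gen_sub (@image q) b -> full (of_bar b).
Proof.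
apply: gen_sub_map => _ [y ->] /=; apply: full_base.
pose f : {linear bar_complex rat (GL F n) q -> M 0} := @of_bar q \o
  freeg_map rat (fun h : {ffun 'I_q -> GL F n} => [ffun i => GL_incl (h i)]).
rewrite -[of_bar _]/(f y).
elim/freeg_ind: y => [|c h y IHy]; first by rewrite linear0; apply: gen_sub0.
rewrite linearD linearZ; apply: gen_subD => //.
rewrite /f /= freeg_mapE of_barE; apply: gen_sub_in; eexists c, _; split=> //.
move=> _ /mapP[i _ ->]; elim: i => [|i [a IHi]] /=.
  by exists 1%g; apply: (mulgI (GL_incl 1%g)); rewrite -GL_incl_mulfM !mulg1.
rewrite IHi; case: insubP => [j _ _|_]; last by exists a; rewrite mulg1.
by exists (a * h j)%g; rewrite ffunE GL_incl_mulfM.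
Qed.

Lemma full_of_image q x : length_part q.+1 x = x ->
  gen_sub (@image q) (to_bar q x) -> full x.
Proof.
move=> lx /of_bar_image fx; rewrite -(subrK (of_bar (to_bar q x)) x).
by apply: gen_subD => //; apply: of_to_bar.
Qed.

Lemma full_length0 x : length_part 0 x = x -> full x.
Proof.
move=> <-; elim/freeg_ind: x => [|c [w X] x IHx].
  by rewrite linear0; apply: gen_sub0.
rewrite linearD linearZ; apply: gen_subD => //=; rewrite length_partE.
case: eqP => [/size0nil ->|_]; last by rewrite scaler0; apply: gen_sub0.
by apply: full_base; apply: gen_sub_in; exists c, [::]; rewrite (empty_tuple X y0).
Qed.

Lemma rel_bar_corr q :
  corr (fun x : M 0 => [/\ length_part q.+1 x = x, full (wd x) & True])
       (fun x => exists w, full (x - wd w))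
       (@all_of (homology_nat rel q)) (@zero_of (homology_nat rel q)).
Proof.
apply: corr_trans (homology_corr rel q).
pose f m : {additive M 0 -> rel m} := quo_pi (@image m) \o to_bar m.
have fd m x : f m (wd x) = cc_d rel m (f m.+1 x).
  rewrite /f /= to_bar_wd; apply: esym; exact: (quo_mapE (@bar_image_d rat _ _ (@GL_incl F n) m)).
have f0 m x : f m x = 0 <-> gen_sub (@image m) (to_bar m x).
  rewrite /f /= -(raddf0 (quo_pi (@image m))).
  by split=> [/quo_pi_eq|h]; [rewrite subr0 | apply/quo_pi_eq; rewrite subr0].
have f_surj m y : exists2 x, length_part m.+1 x = x & y = f m x.
  have [b ->] := quo_piP y; exists (of_bar b); first exact: length_of_bar.
  by rewrite /f /= of_barK.
have f_inj m x : length_part m.+1 x = x -> f m x = 0 -> full x.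
  by move=> lx /f0; apply: full_of_image.
have f_full m x : full x -> f m x = 0 by move=> fx; apply/f0/to_bar_full.
have cycleE x : length_part q.+1 x = x ->
    full (wd x) <-> f q x \in @cycle_pred rel q.
  case: q => [|q] lx.
    by split=> // _; apply: full_length0; rewrite length_part_wd lx.
  have -> : (f q.+1 x \in cycle_pred (k:=q.+1)) = (cc_d rel q (f q.+1 x) == 0) by [].
  rewrite -fd; split=> [dx|/eqP dx]; first by rewrite f_full.
  by apply: (f_inj q); rewrite // length_part_wd lx.
exists (fun x y => y = f q x /\ [/\ length_part q.+1 x = x, full (wd x) & True]).
split.
- move=> a b _ _ [-> [la va _]] [-> [lb vb _]]; split; first by rewrite raddfB.
  by split; rewrite ?linearB /= ?la ?lb //; apply: gen_subB.
- by move=> a _ [-> [la va _]]; split=> //; apply/cycleE.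
- by move=> a Za; exists (f q a).
- move=> y; have [x lx ->] := f_surj q y => /cycleE dx.
  by exists x; split=> //; split=> //; apply: dx.
move=> x _ [-> [lx vx _]]; split=> [[w /(f_full q)]|[y]].
  rewrite raddfB fd => /eqP; rewrite subr_eq0 => /eqP ->.
  by exists (f q.+1 w).
have [w lw ->] := f_surj q.+1 y; rewrite -fd => fx; exists w.
apply: (f_inj q); last by rewrite raddfB fx subrr.
by rewrite linearB /= lx length_part_wd lw.
Qed.

End BarComparison.

(** * Tensor products with the rational numbers *)

Section TensorRat.
Variable A : zmodType.
Notation T := (tensor A rat).

Definition tens (h : A) (q : rat) : T := quo_pi (@tensor_rel A rat) << (h, q) >>.

Lemma tensDl x y q : tens (x + y) q = tens x q + tens y q.
Proof.
rewrite /tens -raddfD; apply/quo_pi_eq/gen_sub_in; exact: tensor_relDl.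
Qed.

Lemma tensDr x p q : tens x (p + q) = tens x p + tens x q.
Proof.
rewrite /tens -raddfD; apply/quo_pi_eq/gen_sub_in; exact: tensor_relDr.
Qed.

Lemma tens0l q : tens 0 q = 0.
Proof. by apply: (addIr (tens 0 q)); rewrite -tensDl !add0r. Qed.

Lemma tens0r h : tens h 0 = 0.
Proof. by apply: (addIr (tens h 0)); rewrite -tensDr !add0r. Qed.

Lemma tensNl x q : tens (- x) q = - tens x q.
Proof. by apply: (addIr (tens x q)); rewrite -tensDl !addNr tens0l. Qed.

Lemma tensBl x y q : tens (x - y) q = tens x q - tens y q.
Proof. by rewrite tensDl tensNl. Qed.

Lemma tensMn h n q : tens (h *+ n) q = tens h (q *+ n).
Proof.
elim: n => [|n IHn]; first by rewrite !mulr0n tens0l tens0r.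
by rewrite !mulrS tensDl tensDr IHn.
Qed.

Lemma tensMz h (z : int) q : tens (h *~ z) q = tens h (q *~ z).
Proof.
case: z => n; first exact: tensMn.
rewrite !NegzE !mulrNz tensNl -[_ *~ _]/(h *+ n.+1) tensMn.
apply: (addIr (tens h (q *+ n.+1))); rewrite addNr -tensDr.
by rewrite -[_ *~ _]/(q *+ n.+1) addNr tens0r.
Qed.

Lemma tensMzl h (z : int) q : tens (h *~ z) q = tens h q *~ z.
Proof.
have tn n : tens (h *+ n) q = tens h q *+ n.
  by elim: n => [|n IHn]; rewrite ?mulr0n ?tens0l // !mulrS tensDl IHn.
by case: z => n; rewrite ?NegzE ?mulrNz ?tensNl -?[_ *~ _]/(_ *+ _) tn.
Qed.

Lemma natq0 n : (0 < n)%N -> (n%:R : rat) != 0.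
Proof. by rewrite Num.Theory.pnatr_eq0 lt0n. Qed.

(** Puts tensors over a common denominator. *)
Lemma tens_frac h m n : (0 < m)%N -> (0 < n)%N ->
  tens h m%:R^-1 = tens (h *+ n) (n * m)%:R^-1.
Proof.
move=> m0 n0; rewrite tensMn; congr tens; rewrite -[RHS]mulr_natl natrM invfM mulrA.
by rewrite divff ?natq0 // mul1r.
Qed.

Lemma tensorP (t : T) : exists h n, (0 < n)%N /\ t = tens h n%:R^-1.
Proof.
have [u ->] := quo_piP t; elim/freeg_ind: u => [|c [h q] u [h' [n [n0 IHu]]]].
  by exists 0, 1%N; rewrite tens0l raddf0.
pose m := `|denq q|%N.
have m0 : (0 < m)%N by rewrite absz_gt0 denq_neq0.
have qE : q = (m%:R^-1) *~ numq q.
  have mE : m%:R = (denq q)%:~R :> rat by rewrite pmulrn absz_denq.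
  by rewrite -mulrzl mE divq_num_den.
exists (h *~ (c * numq q) *+ n + h' *+ m), (n * m)%N; split.
  by rewrite muln_gt0 n0.
have e2 : tens (h' *+ m) (n * m)%:R^-1 = tens h' n%:R^-1.
  by rewrite mulnC -tens_frac.
rewrite tensDl -tens_frac // e2 raddfD /= IHu; congr (_ + _).
have -> : c *: << (h, q) >> = << (h, q) >> *~ c :> {freeg (A * rat)%type / int}.
  by rewrite -scaler_int intz.
rewrite raddfMz /= -/(tens h q) {1}qE -tensMz [c * _]mulrC mulrzA.
by rewrite !tensMzl.
Qed.

(** Total extension by 0 of the identification of the integral rational
numbers with the integers. *)
Definition int_part (r : rat) : int := if denq r == 1 then numq r else 0.

(** The map h (x) q |-> (k q) h is not defined on the whole tensor product,
but it is compatible with each relation once k is a multiple of the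
denominators in it. *)
Definition clear_den (k : nat) : {freeg (A * rat)%type / int} -> ssrint.zmodule A :=
  fglift (fun x => (x.1 *~ int_part (x.2 *+ k) : ssrint.zmodule A)).
HB.instance Definition _ k := GRing.Additive.copy (clear_den k)
  (fglift (fun x => (x.1 *~ int_part (x.2 *+ k) : ssrint.zmodule A))).

Lemma int_partK (z : int) : int_part z%:~R = z.
Proof. by rewrite /int_part denq_int numq_int. Qed.

Lemma int_ratP (q : rat) k : (`|denq q| %| k)%N -> exists z : int, q *+ k = z%:~R.
Proof.
move=> /dvdnP[m ->]; exists (numq q * m).
have dE : `|denq q|%:R = (denq q)%:~R :> rat by rewrite pmulrn absz_denq.
by rewrite -mulr_natr natrM dE rmorphM /= numqE -pmulrn mulrCA mulrC.
Qed.

Lemma clear_den_rel u : gen_sub (@tensor_rel A rat) u ->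
  exists2 D, (0 < D)%N & forall k, (D %| k)%N -> clear_den k u = 0.
Proof.
elim=> [|_ [x y b|x a b]|x y _ [D D0 xD] _ [D' D'0 yD]].
- by exists 1%N => // k _; rewrite raddf0.
- exists 1%N => // k _; rewrite raddfB raddfD /= /clear_den !fglift1 /= mulrzDl.
  by rewrite subrr.
- exists (`|denq a| * `|denq b|)%N; first by rewrite muln_gt0 !absz_gt0 !denq_neq0.
  move=> k Dk; rewrite raddfB raddfD /= /clear_den !fglift1 /= mulrnDl.
  have [za ->] := @int_ratP a k (dvdn_trans (dvdn_mulr _ (dvdnn _)) Dk).
  have [zb ->] := @int_ratP b k (dvdn_trans (dvdn_mull _ (dvdnn _)) Dk).
  by rewrite -rmorphD !int_partK mulrzDr subrr.
exists (D * D')%N => [|k Dk]; first by rewrite muln_gt0 D0.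
rewrite raddfB /= xD ?yD ?subrr //.
  exact: dvdn_trans (dvdn_mull _ (dvdnn _)) Dk.
exact: dvdn_trans (dvdn_mulr _ (dvdnn _)) Dk.
Qed.

(** Flatness of the rational numbers. *)
Lemma tens_eq0 h n : (0 < n)%N ->
  tens h n%:R^-1 = 0 <-> exists2 k, (0 < k)%N & h *+ k = 0.
Proof.
move=> n0; split=> [|[k k0 hk]]; last by rewrite (@tens_frac _ _ k) // hk tens0l.
rewrite -(raddf0 (quo_pi (@tensor_rel A rat))) => /quo_pi_eq.
rewrite subr0 => /clear_den_rel[D D0 /(_ (n * D)%N (dvdn_mull _ (dvdnn _)))].
have -> : clear_den (n * D) << (h, n%:R^-1) >> = h *+ D.
  rewrite /clear_den fglift1 /= mulrnA -[_ *+ n]mulr_natr mulVf ?natq0 //.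
  by rewrite [1 *+ D]pmulrn int_partK.
by exists D.
Qed.

End TensorRat.

(** * The complex of coinvariants as a row *)

Section CoinvariantComparison.
Variables (F : fieldType) (N : nat).
Notation G := (GL F N).
Notation Y k := (genPosTuple F N k).
Notation M k := {freeg (seq G * Y k) / rat}.
Notation P k := {freeg (Y k) / int}.
Notation C := (coinvariants (unordered_gp_gComplex F N)).

Definition to_coinv k : P k -> C k := fun x =>
  quo_pi (@coinv_rel _ (unordered_gp_gComplex F N) k)
    (quo_pi (@sign_rel F N k) x).

Lemma to_coinv_is_zmod_morphism k : zmod_morphism (@to_coinv k).
Proof. by move=> x y; rewrite /to_coinv !raddfB. Qed.
HB.instance Definition _ k :=
  GRing.isZmodMorphism.Build (P k) (C k) (@to_coinv k)
    (@to_coinv_is_zmod_morphism k).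

Lemma to_coinvP k (c : C k) : exists x, c = to_coinv x.
Proof.
have [y ->] := quo_piP c; have [x ->] := quo_piP y.
by exists x.
Qed.

Lemma to_coinv_d k (x : P k.+1) : cc_d C k (to_coinv x) = to_coinv (gp_d F N k x).
Proof.
rewrite /to_coinv -[cc_d C k _]/(quo_map _ _ _).
rewrite (quo_mapE (@coinv_rel_d _ (unordered_gp_gComplex F N) k)).
by congr quo_pi; apply: (quo_mapE (@sign_rel_d F N k)).
Qed.

(** An integral chain of tuples, as a rational chain on the empty word. *)
Definition to_chain k : P k -> M k := @at_word F N k [::] \o @to_rat (Y k).
HB.instance Definition _ k := GRing.Additive.copy (@to_chain k)
  (@at_word F N k [::] \o @to_rat (Y k)).

Lemma to_chain1 k (X : Y k) : to_chain << X >> = << ([::], X) >>.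
Proof. by rewrite /to_chain /= to_rat1 /at_word freeg_mapE. Qed.

Lemma to_chain_d k (x : P k.+1) : to_chain (gp_d F N k x) = dh (to_chain x).
Proof. by rewrite /to_chain /= dh_at_word -to_rat_alt_bd. Qed.

Lemma to_chain_inj k (x : P k) : to_chain x = 0 -> x = 0.
Proof.
move=> x0; apply: to_rat_inj; rewrite -[to_rat x]freeg_map_id.
have <- : freeg_map rat snd (to_chain x) = freeg_map rat id (to_rat x).
  by rewrite /to_chain /= /at_word freeg_map_comp.
by rewrite x0 raddf0.
Qed.

Lemma to_chainZ k (c : int) (x : P k) : to_chain (c *: x) = c%:~R *: to_chain x.
Proof. by rewrite /to_chain /= to_ratZ linearZ. Qed.

Lemma gl_act_chain k g (x : P k) :
  gl_act g (to_chain x) = to_chain (gp_act g k x).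
Proof.
elim/freeg_ind: x => [|c X x IHx]; first by rewrite !raddf0.
rewrite !raddfD /= IHx; congr (_ + _).
rewrite /gp_act [freeg_map _ _ (_ *: _)]linearZ freeg_mapE /= !to_chainZ.
by rewrite linearZ /= !to_chain1 /gl_act wmapE.
Qed.

Definition perm_chain k (s : 'S_k) : {linear P k -> P k} :=
  freeg_map int (gp_perm s).

Lemma col_act_chain k (s : 'S_k) (x : P k) :
  col_act s (to_chain x) = to_chain (perm_chain s x).
Proof.
elim/freeg_ind: x => [|c X x IHx]; first by rewrite !raddf0.
rewrite !raddfD /= IHx; congr (_ + _).
rewrite /perm_chain [freeg_map _ _ (_ *: _)]linearZ freeg_mapE /= !to_chainZ.
by rewrite linearZ /= !to_chain1 /col_act wmapE.
Qed.

Lemma to_coinv_act k g (x : P k) : to_coinv (x - gp_act g k x) = 0.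
Proof.
rewrite raddfB; apply/eqP; rewrite subr_eq0 eq_sym; apply/eqP.
apply/quo_pi_eq/gen_sub_in; exists g, (quo_pi (@sign_rel F N k) x).
congr (_ - _); apply/esym.
exact: (quo_mapE (@sign_rel_act F N g k)).
Qed.

Lemma to_coinv_sign k (x : P k) : gen_sub (@sign_rel F N k) x -> to_coinv x = 0.
Proof.
move=> sx; rewrite -(raddf0 (@to_coinv k)) /to_coinv; congr quo_pi.
by apply/quo_pi_eq; rewrite subr0.
Qed.

Lemma to_coinv_perm k (s : 'S_k) (x : P k) :
  to_coinv (x - (-1) ^+ s *: perm_chain s x) = 0.
Proof.
apply: to_coinv_sign.
pose f : {linear P k -> P k} := idfun \- ( *:%R ((-1) ^+ s) \o perm_chain s).
rewrite -[_ - _]/(f x).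
elim/freeg_ind: x => [|c X x IHx]; first by rewrite linear0; apply: gen_sub0.
rewrite linearD; apply: gen_subD => //.
suff fX : gen_sub (@sign_rel F N k) (f << X >>).
  have -> : c *: << X >> = << X >> *~ c :> P k by rewrite -scaler_int intz.
  rewrite raddfMz.
  exact: gen_subMz.
apply: gen_sub_in; exists X, s^-1%g.
by rewrite odd_permV invgK /f /= /perm_chain freeg_mapE.
Qed.

(** With tuple_rel_coinv, row 0 of the bicomplex is the rationalization of
the complex of coinvariants. *)
Lemma to_coinv_eq0 k (x : P k) : to_coinv x = 0 ->
  gen_sub (@tuple_rel F N k) (to_chain x).
Proof.
rewrite -(raddf0 (@to_coinv k)) => /quo_pi_eq; rewrite raddf0 subr0 => xr.
have lift_rel (u : P k) : gen_sub (@sign_rel F N k) u ->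
    gen_sub (@tuple_rel F N k) (to_chain u).
  apply: gen_sub_map => _ [X [s ->]]; apply: gen_sub_in; right.
  exists s^-1%g, << ([::], X) >>; rewrite odd_permV raddfB /= to_chainZ !to_chain1.
  by rewrite rmorph_sign /col_act wmapE.
suff H : forall q, gen_sub (@coinv_rel _ (unordered_gp_gComplex F N) k) q ->
    exists2 u, q = quo_pi (@sign_rel F N k) u &
               gen_sub (@tuple_rel F N k) (to_chain u).
  have [u /quo_pi_eq/lift_rel xu ru] := H _ xr.
  by rewrite -(subrK u x) raddfD; apply: gen_subD.
move=> q; elim=> [|_ [g [m ->]]|_ _ _ [u -> ru] _ [v -> rv]].
- by exists 0; rewrite ?raddf0 //; apply: gen_sub0.
- have [u ->] := quo_piP m; exists (gp_act g k u - u).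
    by rewrite raddfB; congr (_ - _); apply: (quo_mapE (@sign_rel_act F N g k)).
  rewrite raddfB /= -gl_act_chain -opprB; apply/gen_subN/gen_sub_in; left.
  by exists g, (to_chain u).
by exists (u - v); rewrite raddfB //; apply: gen_subB.
Qed.

Lemma to_chain_len k (x : P k) : length_part 0 (to_chain x) = to_chain x.
Proof.
elim/freeg_ind: x => [|c X x IHx]; first by rewrite !raddf0.
rewrite !raddfD /= IHx to_chainZ linearZ /= to_chain1; congr (_ *: _ + _).
by rewrite length_partE.
Qed.

Lemma clear_denominators k (z : M k) :
  exists n x, (0 < n)%N /\ length_part 0 z *+ n = to_chain x.
Proof.
elim/freeg_ind: z => [|c [w X] z [n [x [n0 zx]]]].
  by exists 1%N, 0; rewrite !raddf0 mul0rn.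
case: w => [|g w]; last first.
  by exists n, x; rewrite linearD linearZ /= length_partE scaler0 add0r.
pose m := `|denq c|%N.
have m0 : (0 < m)%N by rewrite absz_gt0 denq_neq0.
have mE : m%:R = (denq c)%:~R :> rat by rewrite pmulrn absz_denq.
exists (m * n)%N, ((numq c *+ n) *: << X >> + x *+ m); split.
  by rewrite muln_gt0 m0.
rewrite linearD linearZ /= length_partE /= raddfD raddfMn /= -zx to_chainZ to_chain1.
rewrite mulrnDl; congr (_ + _); last by rewrite mulnC mulrnA.
rewrite rmorphMn /= numqE -mE -scaler_nat scalerA; congr (_ *: _).
by rewrite natrM -[_ *+ n]mulr_natr; ring.
Qed.

Lemma tuple_rel_coinv k (x : P k) : gen_sub (@tuple_rel F N k) (to_chain x) ->
  exists2 n, (0 < n)%N & to_coinv (x *+ n) = 0.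
Proof.
suff H t : gen_sub (@tuple_rel F N k) t -> exists n u,
    [/\ (0 < n)%N, length_part 0 t *+ n = to_chain u & to_coinv u = 0].
  move=> /H[n [u [n0 xu u0]]]; exists n => //.
  suff -> : x *+ n = u by [].
  apply/eqP; rewrite -subr_eq0; apply/eqP/to_chain_inj.
  by rewrite raddfB raddfMn /= -xu to_chain_len subrr.
elim=> [|_ [[g [z ->]]|[s [z ->]]]|y z _ [n [u [n0 yu u0]]] _ [m [v [m0 zv v0]]]].
- by exists 1%N, 0; rewrite !raddf0 mul0rn.
- have [n [u [n0 zu]]] := clear_denominators z.
  exists n, (u - gp_act g k u); rewrite to_coinv_act; split=> //.
  rewrite [RHS]raddfB /= -gl_act_chain -zu linearB /= length_part_wmap.
  by rewrite [gl_act g (_ *+ _)]linearMn mulrnBl.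
- have [n [u [n0 zu]]] := clear_denominators z.
  exists n, (u - (-1) ^+ s *: perm_chain s u); rewrite to_coinv_perm; split=> //.
  rewrite [RHS]raddfB /= to_chainZ rmorph_sign -col_act_chain -zu linearB /=.
  rewrite [length_part 0 (_ *: _)]linearZ /= [col_act s (_ *+ _)]linearMn /=.
  by rewrite /col_act length_part_wmap mulrnBl scalerMnr.
exists (n * m)%N, (u *+ m - v *+ n); split; first by rewrite muln_gt0 n0.
  rewrite [RHS]raddfB [X in _ = X - _]raddfMn [X in _ = _ - X]raddfMn /=.
  by rewrite -yu -zv -!mulrnA linearB /= mulrnBl [(m * n)%N]mulnC.
by rewrite raddfB [X in X - _]raddfMn [X in _ - X]raddfMn /= u0 v0 !mul0rn subrr.
Qed.

End CoinvariantComparison.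

(** * The comparison *)

(** The equation E between dimensions lets the standard tuple, which lives in
dimension n + 1, be transported to the successor of n. *)
Lemma base_column (F : fieldType) n N (E : (n + 1)%N = N)
    (H : GL F N -> Prop) :
  (forall s : seq F, exists a, a \notin s) ->
  (forall g, H g <-> exists h : GL F n,
     GL_mx g = castmx (E, E) (block_mx (GL_mx h) 0 0 1%:M)) ->
  exists e : genPosTuple F N 1,
  [/\ forall g, H g -> gp_mul g e = e,
      forall z, gen_sub (@full_rel F N H e 1) (wd z) -> bdry (@full_rel F N H e 1) z
    & forall X, exists g, gp_mul g e = X].
Proof.
move=> F_inf; case: _ / E H => H HE; exists (@std_tuple F 1 n).
have leviE g : H g <-> is_levi g.
  rewrite HE; split=> [[h gh]|[h ->]]; exists h; last first.
    by rewrite castmx_id /= mul0mx.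
  by apply: val_inj; rewrite /= gh castmx_id mul0mx.
split; last exact: std_transitive.
  by move=> g /leviE[h ->]; apply: iota_std.
have sub1 z : gen_sub (@full_rel F _ H (@std_tuple F 1 n) 1) z ->
    gen_sub (@pointed_rel F 1 n) z.
  apply: (@gen_sub_map _ _ _ _ idfun) => x /= [[gx|sx]|[c [w [wH ->]]]].
  - by apply: gen_sub_in; left.
  - by rewrite (sgn_rel_small _ (gen_sub_in sx)) //; apply: gen_sub0.
  - by apply: gen_sub_in; right; exists c, w; split=> // g /wH/leviE.
move=> z /sub1 /(pointed_column F_inf); apply: gen_subW => x [[gx|]|dx].
- by apply: gen_sub_in; left; left; left.
- move=> [c [w [wH ->]]]; apply: gen_sub_in; left; right.
  by exists c, w; split=> // g /wH/leviE.
- by apply: gen_sub_in; right.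
Qed.

Section MainComparison.
Variables (F : fieldType) (n : nat).
Notation N := n.+1.
Notation G := (GL F N).
Notation Y k := (genPosTuple F N k).
Notation M k := {freeg (seq G * Y k) / rat}.
Notation P k := {freeg (Y k) / int}.
Notation C := (coinvariants (unordered_gp_gComplex F N)).
Variable e : Y 1.
Notation full k := (gen_sub (@full_rel F N (@incl_letter F n) e k)).
Hypothesis F_inf : forall s : seq F, exists a, a \notin s.
Hypothesis e_fixed : forall g : G, incl_letter g -> gp_mul g e = e.
Hypothesis e_column : forall z, gen_sub (@full_rel F N (@incl_letter F n) e 1) (wd z) ->
  bdry (@full_rel F N (@incl_letter F n) e 1) z.
Hypothesis e_trans : forall X : Y 1, exists g, gp_mul g e = X.

Definition chain_bicycle k p (z : M k) : Prop :=
  [/\ length_part p z = z, full k (wd z) &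
      @row_cycle (fun k => M k) (fun k => @full_rel F N (@incl_letter F n) e k)
        (fun k => @dh F N k) k z].

Lemma column_full k (x : M k.+1) : full k.+1 (wd x) ->
  exists y, full k.+1 (x - wd y).
Proof.
case: k x => [|k] x; first by move/e_column/bdry_ex.
move/tuple_full/(tuple_column F_inf)/bdry_ex => [y xy].
by exists y; apply: full_tuple.
Qed.

Lemma wd_length0 k (x : M k) : wd (length_part 0 x) = 0.
Proof.
suff : @wd _ _ \o @length_part F N k 0 =1 \0 by move=> /(_ x).
apply: freeg_ext => -[w X] /=; rewrite length_partE.
by case: w => [|g w]; rewrite /= ?wd_nil ?raddf0.
Qed.

Lemma bicomplex_balancing m :
  corr (@chain_bicycle 0 m) (fun x => exists w, full 0 (x - wd w))
       (@chain_bicycle m 0) (fun x => exists w, full m (x - dh w)).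
Proof.
apply: (@balancing (fun k => M k) (fun k => @full_rel F N (@incl_letter F n) e k)
  (fun k => @dh F N k) (fun k => @wd _ _) (fun k p => @length_part F N k p)).
- exact: dh_full.
- exact: wd_full.
- exact: length_part_full.
- exact: dh_dh.
- by move=> k; apply: wd_wd.
- exact: wd_dh.
- exact: length_part_wd.
- exact: wd_length0.
- exact: length_part_dh.
- exact: length_part_idem.
- by move=> k p x; apply: length_part_disj.
- by move=> x; apply: full_row0.
- by move=> k x; apply: full_rowS.
- exact: column_full.
Qed.

(** In degrees k <= 1 the group acts transitively on tuples, so row 0 of the
bicomplex is killed there by the base relations. *)
Lemma full_low k (x : M k) : (k <= 1)%N -> length_part 0 x = x -> full k x.
Proof.
case: k x => [|[|//]] x _; first exact: full_length0.
move=> <-; elim/freeg_ind: x => [|c [w X] x IHx].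
  by rewrite linear0; apply: gen_sub0.
rewrite linearD linearZ; apply: gen_subD => //=; rewrite length_partE.
case: eqP => [/size0nil ->|_]; last by rewrite scaler0; apply: gen_sub0.
have [g <-] := e_trans X; pose t : M 1 := c *: << ([::], e) >>.
have gt : c *: << ([::], gp_mul g e) >> = gl_act g t.
  by rewrite linearZ /= /gl_act wmapE.
rewrite gt -[gl_act g t](subKr t); apply: gen_subB.
  by apply: full_base; apply: gen_sub_in; exists c, [::].
apply/full_tuple/gl_tuple_rel.
exact: (@diag_relE _ _ _ (fun g => mulg g) (fun g => gp_mul g)).
Qed.

Lemma to_coinv1 (X : Y 1) : to_coinv << X >> = to_coinv << e >>.
Proof.
have [g <-] := e_trans X; apply/eqP; rewrite eq_sym -subr_eq0 -raddfB /=.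
have <- : gp_act g 1 << e >> = << gp_mul g e >> by apply: freeg_mapE.
by rewrite to_coinv_act.
Qed.

Lemma to_coinv1E (x : P 1) : exists z, to_coinv x = to_coinv << e >> *~ z.
Proof.
elim/freeg_ind: x => [|c X x [z IHx]]; first by exists 0; rewrite raddf0 mulr0z.
exists (c + z); rewrite raddfD /= IHx mulrzDr; congr (_ + _).
have -> : c *: << X >> = << X >> *~ c :> P 1 by rewrite -scaler_int intz.
by rewrite raddfMz /= to_coinv1.
Qed.

Lemma coinv_d1 (c : C 2) : cc_d C 1 c = 0.
Proof.
have [x ->] := to_coinvP c; rewrite to_coinv_d.
elim/freeg_ind: x => [|z X x IHx]; first by rewrite !raddf0.
have -> : z *: << X >> = << X >> *~ z :> P 2 by rewrite -scaler_int intz.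
rewrite !raddfD /= IHx addr0 raddfMz raddfMz /=.
rewrite /gp_d /= alt_bdE !big_ord_recl big_ord0 addr0 expr0 expr1 scale1r.
by rewrite scaleN1r raddfB /= !to_coinv1 subrr mul0rz.
Qed.

(** The complex of coinvariants starts with the identity of the integers and
a zero map: the group is transitive on tuples of length at most 1, and the two
faces of a pair of vectors are equivalent.  So nothing is lost when these
degrees are killed in row 0. *)
Lemma homology_low k (h : homology_nat C k) : (k <= 1)%N -> h = 0.
Proof.
move=> k1; have [R [Rsub RZ RT RT' RB]] := homology_corr C k.
have [c ch] := RT' h I; have [cc _] := RZ _ _ ch.
apply/(RB _ _ ch); have [x cx] := to_coinvP c.
case: k k1 h R Rsub RZ RT RT' RB c ch cc x cx => [|[|//]] _ h R _ _ _ _ _ c _ cc x cx.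
  rewrite cx; elim/freeg_ind: {cx cc} x => [|z X x [y IHx]].
    by exists 0; rewrite !raddf0.
  exists (to_coinv << e >> *~ z + y); rewrite !raddfD -IHx raddfMz to_coinv_d.
  congr (_ + _).
  have -> : z *: << X >> = << X >> *~ z :> P 0 by rewrite -scaler_int intz.
  rewrite raddfMz /= /gp_d /= alt_bdE big_ord1 expr0 scale1r.
  by congr (to_coinv << _ >> *~ _); apply: empty_tuple.
have [z xz] := to_coinv1E x; suff z0 : z = 0.
  by exists 0; rewrite raddf0 cx xz z0 mulr0z.
have : cc_d C 0 c = 0 by apply/eqP.
have dE : gp_d F N 0 << e >> = << gp_face ord0 e >>.
  by rewrite /gp_d /= alt_bdE big_ord1 expr0 scale1r.
have -> : cc_d C 0 c = to_coinv (<< gp_face ord0 e >> *~ z).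
  by rewrite cx xz raddfMz to_coinv_d dE [RHS]raddfMz.
move/to_coinv_eq0.
(* The augmentation detects the class of the empty tuple. *)
pose deg0 : {linear M 0 -> rat^o} := fglift (fun=> 1).
have kill t : gen_sub (@tuple_rel F N 0) t -> deg0 t = 0.
  elim=> [|y [[g [u ->]]|sy]|y y' _ y0 _ y'0].
  - by rewrite raddf0.
  - rewrite raddfB; apply/eqP; rewrite subr_eq0; apply/eqP.
    suff : deg0 =1 deg0 \o gl_act g by apply.
    by apply: freeg_ext => -[w X]; rewrite /= /gl_act wmapE !fglift1.
  - by rewrite (sgn_rel_small _ (gen_sub_in sy)) // raddf0.
  - by rewrite linearB [deg0 y]y0 [deg0 y']y'0 subrr.
move/kill; rewrite raddfMz /= to_chain1 raddfMz /= fglift1 => /eqP.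
by rewrite intr_eq0 => /eqP.
Qed.

Lemma low_corr m : (m <= 1)%N ->
  corr (@chain_bicycle m 0) (fun x => exists w, full m (x - dh w))
       (@all_of (tensor (homology_nat C m) rat))
       (@zero_of (tensor (homology_nat C m) rat)).
Proof.
move=> m1; exists (fun x t => chain_bicycle 0 x /\ t = 0); split.
- move=> a b _ _ [[la va ha] ->] [[lb vb hb] ->]; rewrite subrr; split=> //.
  split; [by rewrite linearB /= la lb | by rewrite linearB; apply: gen_subB |].
  exact: row_cycleB.
- by move=> a t [Za ->].
- by move=> a Za; exists 0.
- move=> t _; exists 0; split; last first.
    have [h [k [k0 ->]]] := tensorP t.
    by rewrite (homology_low h m1) tens0l.
  split; rewrite ?raddf0 //; first exact: gen_sub0.
  by rewrite -(subrr (0 : M m)); case: (m) => //= k; rewrite subrr raddf0; apply: gen_sub0.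
move=> a _ [[la _ _] ->]; split=> // _; exists 0.
by rewrite raddf0 subr0; apply: full_low.
Qed.

Lemma full_scale k c (z : M k) : full k z -> full k (c *: z).
Proof.
apply: gen_subZ => y [/tuple_relZ|by_]; first by left.
right; case: k y by_ {z} => [|[|k]] //= y [d [w [wH ->]]];
  by exists (c * d), w; rewrite scalerA.
Qed.

Lemma full_natmul k d (z : M k) : (0 < d)%N -> full k (z *+ d) -> full k z.
Proof.
move=> n0 /(full_scale d%:R^-1); rewrite -scaler_nat scalerA.
by rewrite mulVf ?natq0 // scale1r.
Qed.

Lemma boundary_torsion m (a : P m.+2) : full m.+1 (dh (to_chain a)) ->
  exists2 k, (0 < k)%N & cc_d C m.+1 (to_coinv (a *+ k)) = 0.
Proof.
case: m a => [|m] a; first by exists 1%N => //; rewrite coinv_d1.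
rewrite -to_chain_d => /tuple_full/tuple_rel_coinv[k k0 dk].
by exists k => //; rewrite to_coinv_d raddfMn.
Qed.

(** x corresponds to the tensor h (x) 1/d when d x is the class of an integral
cycle representing h. *)
Lemma high_corr m :
  corr (@chain_bicycle m.+2 0) (fun x => exists w, full m.+2 (x - dh w))
       (@all_of (tensor (homology_nat C m.+2) rat))
       (@zero_of (tensor (homology_nat C m.+2) rat)).
Proof.
have [R [Rsub RZ RT RT' RB]] := homology_corr C m.+2.
exists (fun x t => chain_bicycle 0 x /\ exists d a h,
  [/\ (0 < d)%N, R (to_coinv a) h, x *+ d = to_chain a & t = tens h d%:R^-1]).
split.
- move=> x y t s [[lx vx hx] [d [a [h [n0 ah xa ->]]]]].
  move=> [[ly vy hy] [p [b [g [p0 bg yb ->]]]]]; split.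
    split; [by rewrite linearB /= lx ly | by rewrite linearB; apply: gen_subB |].
    exact: row_cycleB.
  exists (d * p)%N, (a *+ p - b *+ d), (h *+ p - g *+ d); split.
  + by rewrite muln_gt0 n0.
  + have -> : to_coinv (a *+ p - b *+ d) = to_coinv a *+ p - to_coinv b *+ d.
      by rewrite raddfB [X in X - _]raddfMn [X in _ - X]raddfMn.
    exact: (Rsub _ _ _ _ (corr_natmul p Rsub ah) (corr_natmul d Rsub bg)).
  + rewrite [RHS]raddfB [X in _ = X - _]raddfMn [X in _ = _ - X]raddfMn /=.
    by rewrite -xa -yb -!mulrnA mulrnBl [(p * d)%N]mulnC.
  rewrite tensBl (tens_frac h n0 p0) (tens_frac g p0 n0).
  by rewrite [(p * d)%N]mulnC.
- by move=> x t [].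
- move=> x Zx; have [lx vx hx] := Zx.
  have [d [a [n0 xa]]] := clear_denominators x; rewrite lx in xa.
  have [|k k0 ak] := @boundary_torsion m a.
    by rewrite -xa raddfMn -scaler_nat; apply: full_scale.
  have [|h ah] := RT (to_coinv (a *+ k)); first by apply/eqP.
  exists (tens h (d * k)%:R^-1); split=> //; exists (d * k)%N, (a *+ k), h.
  by split=> //; [rewrite muln_gt0 n0 | rewrite mulrnA xa raddfMn].
- move=> t _; have [h [d [n0 ->]]] := tensorP t.
  have [c ch] := RT' h I; have [cc _] := RZ _ _ ch; have [a ca] := to_coinvP c.
  exists (d%:R^-1 *: to_chain a); split; last first.
    exists d, a, h; rewrite -ca; split=> //.
    by rewrite -scaler_nat scalerA divff ?natq0 // scale1r.
  have la : length_part 0 (d%:R^-1 *: to_chain a) = d%:R^-1 *: to_chain a.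
    by rewrite linearZ /= to_chain_len.
  split=> //; first by rewrite -la wd_length0; apply: gen_sub0.
  suff : full m.+1 (dh (d%:R^-1 *: to_chain a)) by [].
  rewrite linearZ; apply: full_scale; rewrite /= -to_chain_d.
  apply/full_tuple/to_coinv_eq0; rewrite -to_coinv_d -ca.
  by apply/eqP.
move=> x _ [[lx _ _] [d [a [h [n0 ah xa ->]]]]]; rewrite /zero_of tens_eq0 //.
have Bk k : h *+ k = 0 <-> exists y, to_coinv a *+ k = cc_d C m.+2 y.
  by have [h1 h2] := RB _ _ (corr_natmul k Rsub ah); split=> [/h2|/h1].
split=> [[w0 xw0]|[k k0 /Bk[y ay]]].
  pose w := length_part 0 w0.
  have xw : full m.+2 (x - dh w).
    by have := length_part_full 0 xw0; rewrite linearB /= lx length_part_dh.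
  have [p [b [p0 wb]]] := clear_denominators w0.
  have : full m.+2 (to_chain (a *+ p - gp_d F N m.+2 b *+ d)).
    rewrite raddfB [X in _ (X - _)]raddfMn [X in _ (_ - X)]raddfMn /= to_chain_d.
    have dw : dh (w *+ p) = dh w *+ p by rewrite raddfMn.
    rewrite -xa -wb dw -!mulrnA [(p * d)%N]mulnC -mulrnBl.
    by rewrite -scaler_nat; apply: full_scale.
  move/tuple_full/tuple_rel_coinv => [k k0].
  have -> : to_coinv ((a *+ p - gp_d F N m.+2 b *+ d) *+ k) =
      to_coinv a *+ (p * k) - cc_d C m.+2 (to_coinv b *+ (d * k)).
    rewrite mulrnBl -!mulrnA raddfB [X in X - _]raddfMn; congr (_ - _).
    by rewrite [LHS]raddfMn [RHS]raddfMn to_coinv_d.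
  move/eqP; rewrite subr_eq0 => /eqP abk.
  exists (p * k)%N; first by rewrite muln_gt0 p0.
  by apply/Bk; exists (to_coinv b *+ (d * k)).
have [b yb] := to_coinvP y.
have : full m.+2 (to_chain (a *+ k - gp_d F N m.+2 b)).
  by apply/full_tuple/to_coinv_eq0; rewrite raddfB raddfMn /= ay yb to_coinv_d subrr.
rewrite raddfB raddfMn /= to_chain_d -xa -mulrnA => xb.
exists ((d * k)%:R^-1 *: to_chain b).
have nk0 : (0 < d * k)%N by rewrite muln_gt0 n0.
have dE : dh ((d * k)%:R^-1 *: to_chain b) *+ (d * k) = dh (to_chain b).
  by rewrite linearZ /= -scaler_nat scalerA divff ?natq0 // scale1r.
by apply: (full_natmul nk0); rewrite mulrnBl dE.
Qed.

End MainComparison.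

Lemma infinite_notin (F : fieldType) :
  infinite_set [set: F]%classic -> forall s : seq F, exists a, a \notin s.
Proof.
move=> F_inf s; apply: contrapT => sF; apply: F_inf.
apply: (@sub_finite_set _ _ [set` s]%classic); last exact: finite_seq.
by move=> a _ /=; apply: contrapT => /negP nas; apply: sF; exists a.
Qed.

Local Open Scope classical_set_scope.

Theorem theorem4p8 (F : fieldType) (F_infinite : infinite_set [set: F])
    (n : nat) (i : int) :
  zmod_isomorphic
    (rel_group_homology rat (@GL_incl F n) i)
    (tensor (homology (coinvariants (unordered_gp_gComplex F n.+1)) (i + 1))
            rat).
Proof.
have F_inf := infinite_notin F_infinite.
have inclE (g : GL F n.+1) : incl_letter g <-> exists h : GL F n,
    GL_mx g = castmx (addn1 n, addn1 n) (block_mx (GL_mx h) 0 0 1%:M).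
  by split=> -[h gh]; exists h; [rewrite gh | apply: val_inj].
have [e [e_fixed e_column e_trans]] := base_column F_inf inclE.
have trivial_iso (A B : zmodType) : (forall x : A, x = 0) ->
    (forall x : B, x = 0) -> zmod_isomorphic A (tensor B rat).
  move=> A0 B0; apply: zero_iso => // t.
  by have [h [k [_ ->]]] := tensorP t; rewrite (B0 h) tens0l.
case: i => [q|[|q]].
- have -> : Posz q + 1 = Posz q.+1 by rewrite -PoszD addn1.
  apply: corr_iso; apply: corr_trans (corr_sym (rel_bar_corr e q)) _.
  apply: corr_trans (bicomplex_balancing F_inf e_fixed e_column q.+1) _.
  case: q => [|q]; first exact: low_corr.
  exact: high_corr.
- apply: trivial_iso => [x|x]; first exact: ord1.
  exact: (homology_low e_trans).
- apply: trivial_iso => x; exact: ord1.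
Qed.
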